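(* Let $1<p<\infty$, let $1/p+1/q=1$, and let $F\in A^p$ with $\|F\|_{A^p}=1$. Then $F$ is the extremal function for the functional with kernel $$k=\mathcal{P}(|F|^{p-1}\operatorname{sgn}F)\in A^q .$$ Furthermore, if $F$ is the extremal function for some nonzero functional $\phi\in(A^p)^*$ with kernel $k\in A^q$, then $$\mathcal{P}(|F|^{p-1}\operatorname{sgn}F)=\frac{k}{\|\phi\|},$$ where $\|\phi\|$ is the norm of $\phi$ in $(A^p)^*$.
   Context: $\mathbb{D}$ is the open unit disc in $\mathbb{C}$ and $\sigma$ is area measure normalized so that $\sigma(\mathbb{D})=1$. For $1<p<\infty$, $A^p$ is the Bergman space of analytic functions $f$ on $\mathbb{D}$ with $\|f\|_{A^p}=\left(\int_{\mathbb{D}}|f|^p\,d\sigma\right)^{1/p}<\infty$. With $1/p+1/q=1$, each $\phi\in(A^p)^*$ is represented by a unique $k\in A^q$ via $\phi(f)=\int_{\mathbb{D}}f\,\overline{k}\,d\sigma$, and $k$ is called the kernel of $\phi$. For $f\in L^1(\mathbb{D},\sigma)$ the Bergman projection is $(\mathcal{P}f)(z)=\int_{\mathbb{D}}\frac{f(\zeta)}{(1-\overline{\zeta}z)^2}\,d\sigma(\zeta)$; it maps $L^p$ boundedly onto $A^p$ for $1<p<\infty$. For complex $w\neq0$, $\operatorname{sgn}w=w/|w|$, and $\operatorname{sgn}0=0$. For nonzero $\phi\in(A^p)^*$, a function $F\in A^p$ with $\|F\|_{A^p}=1$ is the extremal function for $\phi$ if $\operatorname{Re}\phi(F)=\sup_{\|g\|_{A^p}=1}\operatorname{Re}\phi(g)=\|\phi\|$;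 such a function exists and is unique. *)

(* Defs.v *)
From HB Require Import structures.
From mathcomp Require Import all_boot all_order all_algebra.
From mathcomp Require Import complex.
From mathcomp Require Import all_classical all_reals all_analysis.

Set Implicit Arguments.
Unset Strict Implicit.
Unset Printing Implicit Defensive.

Import Order.TTheory GRing.Theory Num.Theory.
Import numFieldNormedType.Exports.

Local Open Scope classical_set_scope.
Local Open Scope ring_scope.
Local Open Scope complex_scope.

Section Bergman.
Variable R : realType.
Local Notation C := R[i].

(* The norm of the numFieldType C is C-valued; this is the R-valued modulus. *)
Definition modulus (z : C) : R := complex.Re `|z|.

Definition disc : set C := [set z | modulus z < 1].

(* Functions on the disc are total functions C -> C whose values off [disc]
   are irrelevant; accordingly, they are compared only on [disc]. *)
Definition analytic_on_disc (f : C -> C) : Prop :=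
  forall z0 : C, disc z0 ->
    exists (a : nat -> C) (r : R), 0 < r /\
      forall z : C, modulus (z - z0) < r ->
        series (fun n => a n * (z - z0) ^+ n : C^o) @ \oo --> (f z : C^o).

Definition of_plane (xy : measurableTypeR R * measurableTypeR R) : C :=
  xy.1 +i* xy.2.

Lemma invpi_ge0 : 0 <= (pi : R)^-1.
Proof. by rewrite invr_ge0 pi_ge0. Qed.

(* Area measure in the coordinates [of_plane]; the factor 1/pi gives the unit
   disc mass 1. *)
Definition sigma :=
  mscale (NngNum invpi_ge0)
    ((@lebesgue_measure R) \x (@lebesgue_measure R))%E.

Definition plane_disc : set (measurableTypeR R * measurableTypeR R) :=
  of_plane @^-1` disc.

Definition disc_integral (f : C -> C) : C :=
  (\int[sigma]_(xy in plane_disc) complex.Re (f (of_plane xy)))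
  +i* (\int[sigma]_(xy in plane_disc) complex.Im (f (of_plane xy))).

Definition bergman (p : R) (f : C -> C) : Prop :=
  analytic_on_disc f /\
  (\int[sigma]_(xy in plane_disc) ((modulus (f (of_plane xy))) `^ p)%:E
     < +oo)%E.

Definition bergman_norm (p : R) (f : C -> C) : R :=
  (\int[sigma]_(xy in plane_disc) (modulus (f (of_plane xy))) `^ p) `^ p^-1.

Definition csgn (w : C) : C := if w == 0 then 0 else w / `|w|.

Definition bergman_proj (f : C -> C) (z : C) : C :=
  disc_integral (fun zeta => f zeta / (1 - zeta^* * z) ^+ 2).

(* Boundedness forces phi f = phi g whenever f = g on [disc], so these are
   exactly the functionals on the space of functions restricted to [disc]. *)
Definition bergman_dual (p : R) (phi : (C -> C) -> C) : Prop :=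
  (forall (a : C) f g, bergman p f -> bergman p g ->
     phi (fun z => a * f z + g z) = a * phi f + phi g) /\
  (exists M : R, forall f, bergman p f ->
     modulus (phi f) <= M * bergman_norm p f).

Definition nonzero_functional (p : R) (phi : (C -> C) -> C) : Prop :=
  exists2 f, bergman p f & phi f != 0.

Definition bergman_sphere (p : R) : set (C -> C) :=
  [set g | bergman p g /\ bergman_norm p g = 1].

Definition dual_norm (p : R) (phi : (C -> C) -> C) : R :=
  sup [set modulus (phi g) | g in bergman_sphere p].

Definition functional_of_kernel (k f : C -> C) : C :=
  disc_integral (fun z => f z * (k z)^*).

Definition is_kernel (p q : R) (phi : (C -> C) -> C) (k : C -> C) : Prop :=
  bergman q k /\ forall f, bergman p f -> phi f = functional_of_kernel k f.

Definition is_extremal (p : R) (phi : (C -> C) -> C) (F : C -> C) : Prop :=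
  [/\ bergman_dual p phi, nonzero_functional p phi, bergman_sphere p F,
      complex.Re (phi F) = sup [set complex.Re (phi g) | g in bergman_sphere p]
    & sup [set complex.Re (phi g) | g in bergman_sphere p] = dual_norm p phi].

Definition extremal_density (p : R) (F : C -> C) (z : C) : C :=
  ((modulus (F z)) `^ (p - 1))%:C * csgn (F z).

End Bergman.

(* Main.v *)
From HB Require Import structures.
Require Import Defs.
From mathcomp Require Import all_boot all_order all_algebra.
From mathcomp Require Import complex.
From mathcomp Require Import all_classical all_reals all_analysis.
From mathcomp Require Import measurable_realfun.
From mathcomp Require Import ring lra zify.
Set Implicit Arguments.
Unset Strict Implicit.
Unset Printing Implicit Defensive.
Import Order.TTheory GRing.Theory Num.Theory.
Import numFieldNormedType.Exports.
Local Open Scope classical_set_scope.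
Local Open Scope ring_scope.
Local Open Scope complex_scope.
Local Notation "z ^*" := (Num.conj z) : complex_scope.

(** Write <f, g> for the integral of f conj(g) over the disc, K for the Bergman
    kernel, and G for the density |F|^(p-1) sgn F.

    Since (p - 1) q = p, the function G has norm 1 in L^q, and F conj(G) = |F|^p
    gives <F, G> = 1. Hölder's inequality then makes F extremal for the
    functional <., G> (density_functional_extremal). On analytic functions this
    functional is <., PG>: interchanging integrals, <f, PG> is the integral
    against conj(G) of the function w |-> <f, K(., w)>, which is f by the
    reproducing formula (proj_adjoint). As PG lies in A^q (proj_lp), it is the
    kernel of the functional.

    Conversely, let F be extremal for phi. For every h and every t > 0,
    Re phi(F + t h) <= |phi| |F + t h|, with equality at t = 0. The norm has
    one-sided derivative at most Re <h, G> at t = 0 because the density is a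
    subgradient of |.|^p / p and depends continuously on the point, so that
    Re phi(h) <= |phi| Re <h, G>. Replacing h by complex multiples of h gives
    phi = |phi| <., G> (extremal_functionalE). For h = K(., z) the left-hand side
    is conj(k(z)) by the reproducing formula, and the right-hand side is
    |phi| conj(PG(z)) (extremal_kernelE). No duality theorem enters.

    The reproducing formula is derived from Green's formula for functions
    vanishing on a circle, hence from the fundamental theorem of calculus along
    the slices of a disc (green). If g is the divided difference
    (f(w) - f(z)) / (w - z), then g(w) (|w|^2 - s^2) / (s^2 - conj(w) z) vanishes
    for |w| = s, and its conj(w)-derivative is
    s^2 (f(w) - f(z)) / (s^2 - conj(w) z)^2, which therefore has integral 0 on
    the disc of radius s (cint_pdisc_kernel); then s tends to 1.

    That PG lies in L^q, and that the integrals above may be interchanged, is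
    Schur's test (abs_projectionP) for the weights (1 - |w|)^(-a) with
    0 < a < 1: the integral of (1 - |w|)^(-a) |K(z, w)| over w is at most a
    multiple of (1 - |z|)^(-a) (integral_kernel_weight_le). The integrand is
    compared, on each quarter of the disc, with a function that can be integrated
    explicitly along horizontal or vertical lines and then across them. *)

(** * The modulus of a complex number *)

Section Modulus.
Variable R : realType.
Local Notation C := R[i].
Implicit Types z w : C.

Lemma modulusE z : modulus z = Num.sqrt (complex.Re z ^+ 2 + complex.Im z ^+ 2).
Proof. by case: z. Qed.

Lemma modulusC z : (modulus z)%:C = `|z|.
Proof. by case: z. Qed.

Lemma modulus_ge0 z : 0 <= modulus z.
Proof. by rewrite modulusE sqrtr_ge0. Qed.

Lemma sqr_modulus z : modulus z ^+ 2 = complex.Re z ^+ 2 + complex.Im z ^+ 2.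
Proof. by rewrite modulusE sqr_sqrtr// addr_ge0// sqr_ge0. Qed.

Lemma modulusM z w : modulus (z * w) = modulus z * modulus w.
Proof. by apply: complexI; rewrite rmorphM/= !modulusC normrM. Qed.

Lemma modulusV z : modulus z^-1 = (modulus z)^-1.
Proof. by apply: complexI; rewrite fmorphV/= !modulusC normfV. Qed.

Lemma modulusX z n : modulus (z ^+ n) = modulus z ^+ n.
Proof. by apply: complexI; rewrite rmorphXn/= !modulusC normrX. Qed.

Lemma modulusN z : modulus (- z) = modulus z.
Proof. by apply: complexI; rewrite !modulusC normrN. Qed.

Lemma modulusB z w : modulus (z - w) = modulus (w - z).
Proof. by rewrite -modulusN opprB. Qed.

Lemma ler_modulusD z w : modulus (z + w) <= modulus z + modulus w.
Proof. by rewrite -lecR rmorphD/= !modulusC ler_normD. Qed.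

Lemma ler_modulusB z w : modulus z - modulus w <= modulus (z - w).
Proof. by rewrite lerBlDr -{1}(subrK w z) ler_modulusD. Qed.

Lemma modulus0 : modulus (0 : C) = 0.
Proof. by apply: complexI; rewrite modulusC normr0. Qed.

Lemma modulus1 : modulus (1 : C) = 1.
Proof. by apply: complexI; rewrite modulusC normr1. Qed.

Lemma modulus_eq0 z : (modulus z == 0) = (z == 0).
Proof. by rewrite -(inj_eq (@complexI R)) modulusC normr_eq0. Qed.

Lemma modulus_gt0 z : (0 < modulus z) = (z != 0).
Proof. by rewrite lt_def modulus_ge0 andbT modulus_eq0. Qed.

Lemma modulus_real (x : R) : modulus x%:C = `|x|.
Proof. by rewrite modulusE/= expr0n/= addr0 sqrtr_sqr. Qed.

Lemma cRe_conj z : complex.Re z^* = complex.Re z.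
Proof. by case: z. Qed.
Lemma cIm_conj z : complex.Im z^* = - complex.Im z.
Proof. by case: z. Qed.

Lemma modulus_conj z : modulus z^* = modulus z.
Proof. by rewrite !modulusE cRe_conj cIm_conj sqrrN. Qed.

Lemma modulus_natr n : modulus (n%:R : C) = n%:R.
Proof. by apply: complexI; rewrite modulusC rmorph_nat normr_nat. Qed.

Lemma ler_modulus_sum (I : Type) (r : seq I) (P : pred I) (f : I -> C) :
  modulus (\sum_(i <- r | P i) f i) <= \sum_(i <- r | P i) modulus (f i).
Proof.
elim/big_rec2: _ => [|i x y _ IH]; first by rewrite modulus0.
by rewrite (le_trans (ler_modulusD _ _))// lerD2l.
Qed.

Lemma ler_norm_Re z : `|complex.Re z| <= modulus z.
Proof.
rewrite -(@ler_pXn2r _ 2)// ?nnegrE ?modulus_ge0// sqr_modulus real_normK ?num_real//.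
by rewrite lerDl sqr_ge0.
Qed.

Lemma ler_norm_Im z : `|complex.Im z| <= modulus z.
Proof.
rewrite -(@ler_pXn2r _ 2)// ?nnegrE ?modulus_ge0// sqr_modulus real_normK ?num_real//.
by rewrite lerDr sqr_ge0.
Qed.

Lemma ler_Re_modulus z : complex.Re z <= modulus z.
Proof. exact: le_trans (ler_norm _) (ler_norm_Re _). Qed.

Lemma ler_modulus_ReIm z : modulus z <= `|complex.Re z| + `|complex.Im z|.
Proof.
rewrite -(@ler_pXn2r _ 2)// ?nnegrE ?modulus_ge0 ?addr_ge0// sqr_modulus.
rewrite sqrrD !real_normK ?num_real// lerD2r lerDl mulrn_wge0// mulr_ge0//.
Qed.

Lemma cReD z w : complex.Re (z + w) = complex.Re z + complex.Re w.
Proof. by case: z; case: w. Qed.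
Lemma cImD z w : complex.Im (z + w) = complex.Im z + complex.Im w.
Proof. by case: z; case: w. Qed.
Lemma cReN z : complex.Re (- z) = - complex.Re z.
Proof. by case: z. Qed.
Lemma cImN z : complex.Im (- z) = - complex.Im z.
Proof. by case: z. Qed.
Lemma cReM z w :
  complex.Re (z * w) = complex.Re z * complex.Re w - complex.Im z * complex.Im w.
Proof. by case: z; case: w. Qed.
Lemma cImM z w :
  complex.Im (z * w) = complex.Re z * complex.Im w + complex.Im z * complex.Re w.
Proof. by case: z; case: w. Qed.
Lemma cReV z : complex.Re z^-1 = complex.Re z / modulus z ^+ 2.
Proof. by rewrite sqr_modulus; case: z. Qed.
Lemma cImV z : complex.Im z^-1 = - (complex.Im z / modulus z ^+ 2).
Proof. by rewrite sqr_modulus; case: z. Qed.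

Lemma complexP z w :
  complex.Re z = complex.Re w -> complex.Im z = complex.Im w -> z = w.
Proof. by case: z => a b; case: w => c d /= -> ->. Qed.

Lemma conjC_D z w : (z + w)^* = z^* + w^*.
Proof. exact: rmorphD. Qed.
Lemma conjC_N z : (- z)^* = - z^*.
Proof. exact: rmorphN. Qed.
Lemma conjC_M z w : (z * w)^* = z^* * w^*.
Proof. exact: rmorphM. Qed.
Lemma conjC_V z : (z^-1)^* = (z^*)^-1.
Proof. exact: fmorphV. Qed.
Lemma conjC_X z n : (z ^+ n)^* = z^* ^+ n.
Proof. exact: rmorphXn. Qed.
Lemma conjC_K z : z^*^* = z.
Proof. by apply: complexP; rewrite !(cRe_conj, cIm_conj) ?opprK. Qed.
Lemma conjC_1 : 1^* = 1 :> C.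
Proof. exact: rmorph1. Qed.
Lemma conjC_real (x : R) : (x%:C)^* = x%:C.
Proof. by apply: complexP; rewrite !(cRe_conj, cIm_conj) ?oppr0. Qed.

Lemma mul_conjC z : z * z^* = (modulus z ^+ 2)%:C.
Proof.
rewrite sqr_modulus; apply: complexP; rewrite ?cReM ?cImM cRe_conj cIm_conj /=; ring.
Qed.

Lemma csgnE z : z = (modulus z)%:C * csgn z.
Proof.
rewrite /csgn modulusC; have [->|z0] := eqVneq z 0; first by rewrite mulr0.
by rewrite mulrC divfK// normr_eq0.
Qed.

Lemma modulus_csgn z : modulus (csgn z) = (z != 0)%:R.
Proof.
rewrite /csgn; case: eqVneq => [z0|z0]; first by rewrite modulus0.
rewrite modulusM modulusV -modulusC modulus_real ger0_norm ?modulus_ge0//.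
by rewrite divff// modulus_eq0.
Qed.

(** The modulus is the real part of a unimodular multiple; this is how bounds
    on moduli of integrals are reduced to real integrals. *)
Lemma modulus_rotate z : exists2 u : C, modulus u = 1 & u * z = (modulus z)%:C.
Proof.
have [->|z0] := eqVneq z 0; first by exists 1; rewrite ?modulus1// mulr0 modulus0.
exists (csgn z)^*; first by rewrite modulus_conj modulus_csgn z0.
transitivity ((csgn z)^* * ((modulus z)%:C * csgn z)); first by rewrite -csgnE.
by rewrite mulrCA [_^* * _]mulrC mul_conjC modulus_csgn z0 expr1n mulr1.
Qed.

End Modulus.

(** * Complex-valued integrals *)

Section ComplexIntegral.
Context d (T : measurableType d) (R : realType).
Variables (mu : {measure set T -> \bar R}) (D : set T).
Hypothesis mD : measurable D.
Local Notation C := R[i].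
Implicit Types (f g : T -> C) (h : T -> R).

Definition cmeasurable (E : set T) f :=
  measurable_fun E (fun x => complex.Re (f x)) /\
  measurable_fun E (fun x => complex.Im (f x)).

Definition cintegrable f :=
  mu.-integrable D (EFin \o (fun x => complex.Re (f x))) /\
  mu.-integrable D (EFin \o (fun x => complex.Im (f x))).

Definition cint f : C :=
  (\int[mu]_(x in D) complex.Re (f x)) +i* (\int[mu]_(x in D) complex.Im (f x)).

Lemma cmeasurable_cst E (c : C) : cmeasurable E (fun=> c).
Proof. by split; exact: measurable_cst. Qed.

Lemma cmeasurableD E f g :
  cmeasurable E f -> cmeasurable E g -> cmeasurable E (fun x => f x + g x).
Proof.
move=> [f1 f2] [g1 g2]; split; rewrite /cmeasurable.
- by under eq_fun do rewrite cReD; exact: measurable_funD.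
- by under eq_fun do rewrite cImD; exact: measurable_funD.
Qed.

Lemma cmeasurableN E f : cmeasurable E f -> cmeasurable E (fun x => - f x).
Proof.
move=> [f1 f2]; split.
- by under eq_fun do rewrite cReN; exact: measurableT_comp.
- by under eq_fun do rewrite cImN; exact: measurableT_comp.
Qed.

Lemma cmeasurableM E f g :
  cmeasurable E f -> cmeasurable E g -> cmeasurable E (fun x => f x * g x).
Proof.
move=> [f1 f2] [g1 g2]; split.
- under eq_fun do rewrite cReM.
  by apply: measurable_funB; exact: measurable_funM.
- under eq_fun do rewrite cImM.
  by apply: measurable_funD; exact: measurable_funM.
Qed.

Lemma cmeasurableX E f n : cmeasurable E f -> cmeasurable E (fun x => f x ^+ n).
Proof.
move=> mf; elim: n => [|n IH]; first by under eq_fun do rewrite expr0; exact: cmeasurable_cst.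
by under eq_fun do rewrite exprS; exact: cmeasurableM.
Qed.

Lemma cmeasurable_conj E f : cmeasurable E f -> cmeasurable E (fun x => (f x)^*).
Proof.
move=> [f1 f2]; split; first by apply: eq_measurable_fun f1 => x _; case: (f x).
have := measurableT_comp (@oppr_measurable R setT) f2.
by apply: eq_measurable_fun => x _ /=; case: (f x).
Qed.

Lemma cmeasurable_real E h : measurable_fun E h -> cmeasurable E (fun x => (h x)%:C).
Proof. by move=> mh; split => //=; exact: measurable_cst. Qed.

Lemma measurable_modulus E f :
  cmeasurable E f -> measurable_fun E (fun x => modulus (f x)).
Proof.
move=> [f1 f2]; under eq_fun do rewrite modulusE.
apply: measurableT_comp => //.
  by apply: continuous_measurable_fun; exact: sqrt_continuous.
by apply: measurable_funD; exact: measurable_funX.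
Qed.

Lemma cmeasurableV E f : cmeasurable E f -> cmeasurable E (fun x => (f x)^-1).
Proof.
move=> mf; have [f1 f2] := mf.
have mi : measurable_fun E (fun x => (modulus (f x) ^+ 2)^-1).
  under eq_fun do rewrite -powR_inv1 ?exprn_ge0 ?modulus_ge0//.
  apply: (measurableT_comp (measurable_powR _)).
  by apply: measurable_funX; exact: measurable_modulus.
split.
- by under eq_fun do rewrite cReV; exact: measurable_funM.
- under eq_fun do rewrite cImV.
  by apply: measurableT_comp => //; exact: measurable_funM.
Qed.

Lemma cmeasurable_csgn E f : measurable E ->
  cmeasurable E f -> cmeasurable E (fun x => csgn (f x)).
Proof.
move=> mE mf.
have -> : (fun x => csgn (f x)) = (fun x => f x * ((modulus (f x))%:C)^-1).
  apply/funext => x; rewrite modulusC /csgn; case: eqVneq => [->|//].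
  by rewrite mul0r.
apply: cmeasurableM => //; apply: cmeasurableV; apply: cmeasurable_real.
exact: measurable_modulus.
Qed.

Lemma cmeasurableS E F f :
  measurable E -> F `<=` E -> cmeasurable E f -> cmeasurable F f.
Proof. by move=> mE FE [f1 f2]; split; exact: measurable_funS FE _. Qed.

Lemma cintegrable_measurable f : cintegrable f -> cmeasurable D f.
Proof.
by move=> [/measurable_int/measurable_EFinP ? /measurable_int/measurable_EFinP ?].
Qed.

(** Domination is the working form of integrability. *)
Lemma le_cintegrable f h : cmeasurable D f -> mu.-integrable D (EFin \o h) ->
  (forall x, D x -> modulus (f x) <= h x) -> cintegrable f.
Proof.
move=> [f1 f2] ih fh; split; apply: le_integrable ih => //;
  try exact/measurable_EFinP.
- move=> x Dx /=; rewrite lee_fin (le_trans (ler_norm_Re _))//.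
  by rewrite (le_trans (fh _ Dx))// ler_norm.
- move=> x Dx /=; rewrite lee_fin (le_trans (ler_norm_Im _))//.
  by rewrite (le_trans (fh _ Dx))// ler_norm.
Qed.

Lemma integrable_modulus f :
  cintegrable f -> mu.-integrable D (EFin \o (fun x => modulus (f x))).
Proof.
move=> ifc; have mf := cintegrable_measurable ifc; case: ifc => f1 f2.
have i12 := integrableD mD (integrable_abse f1) (integrable_abse f2).
apply: le_integrable i12 => //.
  by apply/measurable_EFinP; exact: measurable_modulus.
move=> x Dx /=; rewrite lee_fin ger0_norm ?modulus_ge0//.
by rewrite (le_trans (ler_modulus_ReIm _))// ler_norm.
Qed.

Lemma cintegrableD f g :
  cintegrable f -> cintegrable g -> cintegrable (fun x => f x + g x).
Proof.
move=> [f1 f2] [g1 g2]; split.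
- by apply: eq_integrable (integrableD mD f1 g1) => // x _; rewrite /= cReD.
- by apply: eq_integrable (integrableD mD f2 g2) => // x _; rewrite /= cImD.
Qed.

Lemma cintegrableZ (c : C) f : cintegrable f -> cintegrable (fun x => c * f x).
Proof.
move=> ifc.
have im := integrableZl mD (modulus c) (integrable_modulus ifc).
apply: (@le_cintegrable _ (fun x => modulus c * modulus (f x))) => //.
- by apply: cmeasurableM; [exact: cmeasurable_cst|exact: cintegrable_measurable].
- by move=> x _; rewrite modulusM.
Qed.

Lemma cintegrable_conj f : cintegrable f -> cintegrable (fun x => (f x)^*).
Proof.
move=> ifc; apply: (@le_cintegrable _ (fun x => modulus (f x))).
- exact/cmeasurable_conj/cintegrable_measurable.
- exact: integrable_modulus.
- by move=> x _; rewrite modulus_conj.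
Qed.

Lemma eq_cint f g : (forall x, D x -> f x = g x) -> cint f = cint g.
Proof.
by move=> fg; rewrite /cint; congr (_ +i* _); apply: eq_Rintegral => x /set_mem Dx;
  rewrite fg.
Qed.

Lemma eq_cintegrable f g :
  (forall x, D x -> f x = g x) -> cintegrable f -> cintegrable g.
Proof.
by move=> fg [f1 f2]; split; [apply: eq_integrable f1|apply: eq_integrable f2] => //
  x /set_mem Dx; rewrite /= fg.
Qed.

Lemma cintD f g : cintegrable f -> cintegrable g ->
  cint (fun x => f x + g x) = cint f + cint g.
Proof.
move=> [f1 f2] [g1 g2]; rewrite /cint; apply: complexP => /=.
- by under eq_Rintegral do rewrite cReD; rewrite RintegralD.
- by under eq_Rintegral do rewrite cImD; rewrite RintegralD.
Qed.

Lemma cintZ (c : C) f : cintegrable f -> cint (fun x => c * f x) = c * cint f.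
Proof.
move=> [f1 f2]; have Z (r : R) h : mu.-integrable D (EFin \o h) ->
    mu.-integrable D (EFin \o (fun x => r * h x)) by move=> ih; exact: (integrableZl mD r ih).
rewrite /cint; apply: complexP; rewrite ?cReM ?cImM/=.
- under eq_Rintegral do rewrite cReM.
  by rewrite RintegralB ?RintegralZl//; exact: Z.
- under eq_Rintegral do rewrite cImM.
  by rewrite RintegralD ?RintegralZl//; exact: Z.
Qed.

Lemma cintN f : cintegrable f -> cint (fun x => - f x) = - cint f.
Proof.
by move=> ifc; rewrite -mulN1r -cintZ//; apply: eq_cint => x _; rewrite mulN1r.
Qed.

Lemma cint_conj f : cintegrable f -> cint (fun x => (f x)^*) = (cint f)^*.
Proof.
move=> [f1 f2]; rewrite /cint; apply: complexP => /=.
  by apply: eq_Rintegral => x _; case: (f x).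
rewrite -mulN1r -RintegralZl//; apply: eq_Rintegral => x _.
by rewrite mulN1r; case: (f x).
Qed.

Lemma cintegrable_sum (I : Type) (s : seq I) (f : I -> T -> C) :
  (forall i, cintegrable (f i)) -> cintegrable (fun x => \sum_(i <- s) f i x).
Proof.
move=> fi; elim: s => [|i s IH].
  apply: (@eq_cintegrable (fun=> 0)) => [x _|]; first by rewrite big_nil.
  by split; exact: integrable0.
apply: (@eq_cintegrable (fun x => f i x + \sum_(j <- s) f j x)) => [x _|].
  by rewrite big_cons.
exact: cintegrableD.
Qed.

Lemma cint_sum (I : Type) (s : seq I) (f : I -> T -> C) :
  (forall i, cintegrable (f i)) ->
  cint (fun x => \sum_(i <- s) f i x) = \sum_(i <- s) cint (f i).
Proof.
move=> fi; elim: s => [|i s IH].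
  rewrite big_nil (@eq_cint _ (fun=> 0)) => [|x _]; last by rewrite big_nil.
  by rewrite /cint /= /Rintegral integral0.
rewrite big_cons -IH -cintD//; last exact: cintegrable_sum.
by apply: eq_cint => x _; rewrite big_cons.
Qed.

Lemma Re_cint f : complex.Re (cint f) = \int[mu]_(x in D) complex.Re (f x).
Proof. by []. Qed.

Lemma modulus_cint f : cintegrable f ->
  modulus (cint f) <= \int[mu]_(x in D) modulus (f x).
Proof.
move=> ifc; have [u u1 uE] := modulus_rotate (cint f).
have -> : modulus (cint f) = complex.Re (u * cint f) by rewrite uE.
rewrite -cintZ// Re_cint; apply: le_Rintegral => //.
- by have [] := cintegrableZ u ifc.
- exact: integrable_modulus.
- by move=> x _; rewrite (le_trans (ler_Re_modulus _))// modulusM u1 mul1r.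
Qed.

Lemma cint_dominated (f_ : nat -> T -> C) f h :
  (forall n, cmeasurable D (f_ n)) -> mu.-integrable D (EFin \o h) ->
  (forall n x, D x -> modulus (f_ n x) <= h x) ->
  (forall x, D x -> modulus (f_ n x - f x) @[n --> \oo] --> (0 : R)) ->
  (complex.Re (cint (f_ n)) @[n --> \oo] --> complex.Re (cint f)) /\
  (complex.Im (cint (f_ n)) @[n --> \oo] --> complex.Im (cint f)).
Proof.
move=> mf ih fh ff.
have cvgP (p : C -> R) : (forall z, `|p z| <= modulus z) ->
    (forall z w, p (z - w) = p z - p w) ->
    (forall n, measurable_fun D (fun x => p (f_ n x))) ->
    \int[mu]_(x in D) p (f_ n x) @[n --> \oo] --> \int[mu]_(x in D) p (f x).
  move=> pm pB mp.
  have pf x : D x -> p (f_ n x) @[n --> \oo] --> p (f x).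
    move=> Dx; apply/cvgrPdist_le => e e0.
    have /cvgrPdist_le/(_ _ e0) := ff _ Dx; apply: filterS => n.
    rewrite sub0r normrN ger0_norm ?modulus_ge0// => fn.
    by rewrite distrC -pB (le_trans (pm _)).
  have mEp n : measurable_fun D (EFin \o (fun x => p (f_ n x))).
    exact/measurable_EFinP.
  have Epf x : D x -> (EFin \o (fun x => p (f_ n x))) x @[n --> \oo] --> (p (f x))%:E.
    by move=> Dx; apply: cvg_EFin; [exact: nearW|exact: pf].
  have Eph n x : D x -> (`|(EFin \o (fun x => p (f_ n x))) x| <= (EFin \o h) x)%E.
    by move=> Dx /=; rewrite lee_fin (le_trans (pm _))// fh.
  have mpf : measurable_fun D (EFin \o (fun x => p (f x))).
    exact: (emeasurable_fun_cvg _ _ mEp Epf).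
  have [||ipf _ cvgI] := dominated_convergence mD mEp mpf _ ih.
  - exact: aeW.
  - by apply: aeW => x n; exact: Eph.
  apply: fine_cvg; rewrite fineK; last exact: integrable_fin_num.
  exact: cvgI.
split; rewrite /cint /=; apply: cvgP.
- exact: ler_norm_Re.
- by move=> z w; rewrite cReD cReN.
- by move=> n; have [] := mf n.
- exact: ler_norm_Im.
- by move=> z w; rewrite cImD cImN.
- by move=> n; have [] := mf n.
Qed.

End ComplexIntegral.

Lemma integrable_cst_lty d (T : measurableType d) (R : realType)
    (mu : {measure set T -> \bar R}) (D : set T) (M : R) :
  measurable D -> (mu D < +oo)%E -> mu.-integrable D (EFin \o cst M).
Proof.
move=> mD mDy; apply/integrableP; split.
  exact: (@measurable_cst _ _ _ _ D M%:E).
by rewrite -/(cst `|M%:E|%E) integral_cst//= lte_mul_pinfty.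
Qed.

(** * Fubini's theorem on products of measurable sets *)

Section FubiniOnProducts.
Context d1 d2 (T1 : measurableType d1) (T2 : measurableType d2) (R : realType).
Variables (m1 : {sigma_finite_measure set T1 -> \bar R})
          (m2 : {sigma_finite_measure set T2 -> \bar R}).
Variables (D1 : set T1) (D2 : set T2).
Hypotheses (mD1 : measurable D1) (mD2 : measurable D2).

Lemma patch_setX (f : T1 * T2 -> \bar R) x y :
  (f \_ (D1 `*` D2)) (x, y) =
  ((fun x => ((fun y => f (x, y)) \_ D2) y) \_ D1) x.
Proof.
rewrite /patch; case: ifPn => [/set_mem[/= xD yD]|xyD]; first by rewrite (@mem_set _ D1 x xD) (@mem_set _ D2 y yD).
case: ifPn => // /set_mem xD; case: ifPn => // /set_mem yD.
by move/negP: xyD; case; apply/mem_set.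
Qed.

Lemma iterated_patch12 (f : T1 * T2 -> \bar R) :
  (\int[m1]_x \int[m2]_y (f \_ (D1 `*` D2)) (x, y) =
   \int[m1]_(x in D1) \int[m2]_(y in D2) f (x, y))%E.
Proof.
rewrite [RHS]integral_mkcond; apply: eq_integral => x _.
under eq_integral do rewrite patch_setX.
rewrite [in RHS]/patch; case: ifPn => xD.
  by rewrite [RHS]integral_mkcond; apply: eq_integral => y _; rewrite /patch xD.
by rewrite integral0_eq// => y _; rewrite /patch (negbTE xD).
Qed.

Lemma iterated_patch21 (f : T1 * T2 -> \bar R) :
  (\int[m2]_y \int[m1]_x (f \_ (D1 `*` D2)) (x, y) =
   \int[m2]_(y in D2) \int[m1]_(x in D1) f (x, y))%E.
Proof.
rewrite [RHS]integral_mkcond; apply: eq_integral => y _.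
under eq_integral do rewrite patch_setX.
rewrite [in RHS]/patch; case: ifPn => yD.
  by rewrite [RHS]integral_mkcond; apply: eq_integral => x _; rewrite /patch yD.
by rewrite integral0_eq// => x _; rewrite /patch (negbTE yD); case: ifP.
Qed.

Lemma measurable_patch_setX (f : T1 * T2 -> \bar R) :
  measurable_fun (D1 `*` D2) f -> measurable_fun setT (f \_ (D1 `*` D2)).
Proof.
by move=> mf; apply/(measurable_restrictT f) => //; exact: measurableX.
Qed.

Lemma tonelli_setX (f : T1 * T2 -> \bar R) :
  measurable_fun (D1 `*` D2) f -> (forall x, 0 <= f x)%E ->
  (\int[m1]_(x in D1) \int[m2]_(y in D2) f (x, y) =
   \int[m2]_(y in D2) \int[m1]_(x in D1) f (x, y))%E.
Proof.
move=> mf f0; rewrite -iterated_patch12 -iterated_patch21.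
apply: fubini_tonelli; first exact: measurable_patch_setX.
by move=> x; rewrite /patch; case: ifP.
Qed.

Lemma measurable_partial_integral (f : T1 * T2 -> \bar R) :
  measurable_fun (D1 `*` D2) f -> (forall x, 0 <= f x)%E ->
  measurable_fun D1 (fun x => \int[m2]_(y in D2) f (x, y))%E.
Proof.
move=> mf f0.
have mF := measurable_fun_fubini_tonelli_F (m2 := m2) _ (measurable_patch_setX mf) _.
apply: eq_measurable_fun (measurable_funS measurableT (@subsetT _ D1) (mF _)).
  move=> x /= xD; rewrite /fubini_F [RHS]integral_mkcond; apply: eq_integral => y _.
  by rewrite patch_setX /patch xD.
by move=> x; rewrite /patch; case: ifP.
Qed.

(** Integrability of all slices makes both inner integrals finite, so that
    neither side involves the default value of the real-valued integral. *)
Lemma fubini_setX (h : T1 * T2 -> R) :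
  measurable_fun (D1 `*` D2) h ->
  (\int[m1]_(x in D1) \int[m2]_(y in D2) (`|h (x, y)|)%:E < +oo)%E ->
  (forall x, D1 x -> m2.-integrable D2 (fun y => (h (x, y))%:E)) ->
  (forall y, D2 y -> m1.-integrable D1 (fun x => (h (x, y))%:E)) ->
  \int[m1]_(x in D1) (\int[m2]_(y in D2) h (x, y)) =
  \int[m2]_(y in D2) (\int[m1]_(x in D1) h (x, y)).
Proof.
move=> mh hoo i1 i2; rewrite /Rintegral; congr fine.
transitivity (\int[m1]_(x in D1) \int[m2]_(y in D2) (EFin \o h) (x, y))%E.
  by apply: eq_integral => x /set_mem xD; rewrite fineK//;
    apply: integrable_fin_num => //; exact: i1.
transitivity (\int[m2]_(y in D2) \int[m1]_(x in D1) (EFin \o h) (x, y))%E; last first.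
  by apply: eq_integral => y /set_mem yD; rewrite fineK//;
    apply: integrable_fin_num => //; exact: i2.
rewrite -iterated_patch12 -iterated_patch21.
have mEh : measurable_fun setT ((EFin \o h) \_ (D1 `*` D2)).
  by apply: measurable_patch_setX; exact/measurable_EFinP.
apply: (@Fubini _ _ _ _ _ m1 m2); apply/integrable12ltyP => //.
rewrite (_ : (\int[m1]_x _)%E =
  (\int[m1]_(x in D1) \int[m2]_(y in D2) (`|h (x, y)|)%:E)%E)//.
rewrite -(iterated_patch12 (fun xy => (`|h xy|)%:E)).
apply: eq_integral => x _; apply: eq_integral => y _.
by rewrite /patch; case: ifP => // _; rewrite abse0.
Qed.

Lemma cint_fubini (f : T1 * T2 -> R[i]) :
  cmeasurable (D1 `*` D2) f ->
  (\int[m1]_(x in D1) \int[m2]_(y in D2) (modulus (f (x, y)))%:E < +oo)%E ->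
  (forall x, D1 x -> cintegrable m2 D2 (fun y => f (x, y))) ->
  (forall y, D2 y -> cintegrable m1 D1 (fun x => f (x, y))) ->
  cint m1 D1 (fun x => cint m2 D2 (fun y => f (x, y))) =
  cint m2 D2 (fun y => cint m1 D1 (fun x => f (x, y))).
Proof.
move=> [f1 f2] foo i1 i2.
have lt_part (p : R[i] -> R) : (forall z, `|p z| <= modulus z) ->
    measurable_fun (D1 `*` D2) (fun xy => p (f xy)) ->
    (\int[m1]_(x in D1) \int[m2]_(y in D2) (`|p (f (x, y))|)%:E < +oo)%E.
  move=> pm mp; apply: le_lt_trans foo.
  have mm : measurable_fun (D1 `*` D2) (fun xy => (modulus (f xy))%:E).
    by apply/measurable_EFinP; exact: measurable_modulus.
  have mpE : measurable_fun (D1 `*` D2) (fun xy => (`|p (f xy)|)%:E).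
    by apply/measurable_EFinP; exact: measurableT_comp.
  have msec (g : T1 * T2 -> \bar R) x : D1 x -> measurable_fun (D1 `*` D2) g ->
      measurable_fun D2 (fun y => g (x, y)).
    move=> xD /measurable_patch_setX mg.
    have := measurableT_comp mg (pair1_measurable x).
    move=> /(measurable_funS measurableT (@subsetT _ D2)).
    apply: eq_measurable_fun => y yD /=; have := set_mem yD => yD'.
    by rewrite /patch (@mem_set _ (D1 `*` D2) (x, y)).
  apply: ge0_le_integral => //.
  - by move=> x _; apply: integral_ge0 => y _; rewrite lee_fin.
  - by refine (measurable_partial_integral mpE _) => xy; rewrite lee_fin.
  - by refine (measurable_partial_integral mm _) => xy; rewrite lee_fin modulus_ge0.
  - move=> x xD; apply: ge0_le_integral => //.
    + exact: (msec _ _ xD mpE).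
    + exact: (msec _ _ xD mm).
    + by move=> y yD; rewrite lee_fin pm.
rewrite /cint; apply: complexP => /=.
  apply: (@fubini_setX (fun xy => complex.Re (f xy))) => //.
  - by apply: lt_part => //; exact: ler_norm_Re.
  - by move=> x /i1[].
  - by move=> y /i2[].
apply: (@fubini_setX (fun xy => complex.Im (f xy))) => //.
- by apply: lt_part => //; exact: ler_norm_Im.
- by move=> x /i1[].
- by move=> y /i2[].
Qed.

End FubiniOnProducts.

(** * Strict differentiability *)

Section StrictDifferentiability.
Variable R : realType.
Local Notation C := R[i].
Implicit Types (f g : C -> C) (z w : C).

(** Strict real differentiability, with the differential written as
    h |-> p h + q h^*, so that p and q are the two Wirtinger derivatives and
    q = 0 is holomorphy. The strict form makes p and q continuous in the base
    point without any further argument, and it follows from a local power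
    series expansion without differentiating the series. *)
Definition sdiff f z0 (p q : C) := forall e : R, 0 < e -> exists2 d : R, 0 < d &
  forall z w, modulus (z - z0) < d -> modulus (w - z0) < d ->
    modulus (f z - f w - (p * (z - w) + q * (z - w)^*)) <= e * modulus (z - w).

Definition ccontinuous_at f z0 := forall e : R, 0 < e -> exists2 d : R, 0 < d &
  forall z, modulus (z - z0) < d -> modulus (f z - f z0) < e.

Lemma sdiff_cst c z0 : sdiff (fun=> c) z0 0 0.
Proof.
move=> e e0; exists 1 => // z w _ _.
by rewrite !mul0r !subrr addr0 subrr modulus0 mulr_ge0 ?modulus_ge0// ltW.
Qed.

Lemma sdiff_id z0 : sdiff (fun z => z) z0 1 0.
Proof.
move=> e e0; exists 1 => // z w _ _.
by rewrite mul0r mul1r addr0 subrr modulus0 mulr_ge0 ?modulus_ge0// ltW.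
Qed.

Lemma sdiff_conj f z0 p q : sdiff f z0 p q -> sdiff (fun z => (f z)^*) z0 q^* p^*.
Proof.
move=> fpq e e0; have [d d0 fd] := fpq e e0; exists d => // z w zd wd.
rewrite (_ : _ - _ = (f z - f w - (p * (z - w) + q * (z - w)^*))^*).
  by rewrite modulus_conj; exact: fd.
rewrite !(conjC_D, conjC_N, conjC_M, conjC_K). ring.
Qed.

Lemma sdiffD f g z0 p q p' q' : sdiff f z0 p q -> sdiff g z0 p' q' ->
  sdiff (fun z => f z + g z) z0 (p + p') (q + q').
Proof.
move=> fpq gpq e e0; have e20 : 0 < e / 2 by rewrite divr_gt0.
have [d d0 fd] := fpq _ e20; have [d' d'0 gd] := gpq _ e20.
exists (Num.min d d') => [|z w]; first by rewrite lt_min d0.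
rewrite !lt_min => /andP[zd zd'] /andP[wd wd'].
rewrite (_ : _ - _ = (f z - f w - (p * (z - w) + q * (z - w)^*)) +
  (g z - g w - (p' * (z - w) + q' * (z - w)^*))); last by ring.
rewrite (le_trans (ler_modulusD _ _))//.
by rewrite (le_trans (lerD (fd _ _ zd wd) (gd _ _ zd' wd')))// -mulrDl -splitr.
Qed.

Lemma sdiff_lipschitz f z0 p q : sdiff f z0 p q -> exists2 d : R, 0 < d &
  forall z w, modulus (z - z0) < d -> modulus (w - z0) < d ->
    modulus (f z - f w) <= (1 + modulus p + modulus q) * modulus (z - w).
Proof.
move=> fpq; have [d d0 fd] := fpq 1 ltr01; exists d => // z w zd wd.
rewrite -(subrK (p * (z - w) + q * (z - w)^*) (f z - f w)).
have h1 := fd _ _ zd wd.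
have := ler_modulusD (p * (z - w)) (q * (z - w)^*).
have := ler_modulusD (f z - f w - (p * (z - w) + q * (z - w)^*)) (p * (z - w) + q * (z - w)^*).
rewrite !modulusM modulus_conj !mulrDl; lra.
Qed.

Lemma sdiff_continuous f z0 p q : sdiff f z0 p q -> ccontinuous_at f z0.
Proof.
move=> /sdiff_lipschitz[d d0 fd] e e0.
set K := 1 + modulus p + modulus q in fd.
have K0 : 0 < K by rewrite /K ltr_pwDl ?modulus_ge0// ltr_pwDl ?modulus_ge0.
exists (Num.min d (e / K)) => [|z]; first by rewrite lt_min d0 divr_gt0.
rewrite lt_min => /andP[zd ze]; rewrite (le_lt_trans (fd _ _ zd _))//.
  by rewrite subrr modulus0.
by rewrite mulrC -ltr_pdivlMr.
Qed.

Lemma sdiffM f g z0 p q p' q' : sdiff f z0 p q -> sdiff g z0 p' q' ->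
  sdiff (fun z => f z * g z) z0 (p * g z0 + f z0 * p') (q * g z0 + f z0 * q').
Proof.
move=> fpq gpq e e0.
have [d1 d10 f1] := sdiff_lipschitz fpq.
pose K := 1 + modulus p + modulus q.
pose K' := modulus p' + modulus q'.
have K0 : 0 < K by rewrite /K ltr_pwDl ?modulus_ge0// ltr_pwDl ?modulus_ge0.
(* M bounds the large factor of each of the four products below, whose small
   factor is at most e / (4 M) *)
pose M := modulus (f z0) + 1 + modulus (g z0) + K + K' + 1.
have [fM gM KM K'M M1] : [/\ modulus (f z0) + 1 <= M, modulus (g z0) <= M,
    K <= M, K' <= M & 1 <= M].
  have ? := modulus_ge0 (f z0); have ? := modulus_ge0 (g z0).
  have ? : 0 <= K' by rewrite addr_ge0 ?modulus_ge0.
  by rewrite /M; split; lra.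
have M0 : 0 < M by rewrite (lt_le_trans _ M1).
have e1 : 0 < e / (4 * M) by rewrite divr_gt0// mulr_gt0.
have [d2 d20 f2] := fpq _ e1; have [d3 d30 g3] := gpq _ e1.
have [d4 d40 f4] := sdiff_continuous fpq (ltr01 : 0 < 1 :> R).
have [d5 d50 f5] := sdiff_continuous fpq e1.
have [d6 d60 g6] := sdiff_continuous gpq e1.
exists (Num.min (Num.min d1 d2) (Num.min (Num.min d3 d4) (Num.min d5 d6))).
  by rewrite !lt_min d10 d20 d30 d40 d50 d60.
move=> z w; rewrite !lt_min => /andP[/andP[z1 z2] /andP[/andP[z3 z4] /andP[z5 z6]]].
move=> /andP[/andP[w1 w2] /andP[/andP[w3 w4] /andP[w5 w6]]].
set h := z - w.
rewrite (_ : _ - _ = (f z - f w - (p * h + q * h^*)) * g z0 +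
  f z * (g z - g w - (p' * h + q' * h^*)) +
  (f z - f w) * (g w - g z0) + (f z - f z0) * (p' * h + q' * h^*)); last by ring.
have h0 : 0 <= modulus h by exact: modulus_ge0.
have fz : modulus (f z) <= modulus (f z0) + 1.
  rewrite -lerBlDl (le_trans (ler_modulusB _ _))// ltW//; exact: f4.
have B (x y : C) (X Y : R) : modulus x <= e / (4 * M) * X -> modulus y <= M * Y ->
    0 <= X -> 0 <= Y -> modulus (x * y) <= e / 4 * (X * Y).
  move=> xX yY X0 Y0; rewrite modulusM.
  rewrite (le_trans (ler_pM (modulus_ge0 _) (modulus_ge0 _) xX yY))//.
  rewrite le_eqVlt; apply/orP; left; apply/eqP; field; exact: lt0r_neq0.
have b1 : modulus ((f z - f w - (p * h + q * h^*)) * g z0) <= e / 4 * (modulus h * 1).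
  by apply: B => //; [exact: f2|rewrite mulr1].
have b2 : modulus (f z * (g z - g w - (p' * h + q' * h^*))) <= e / 4 * (modulus h * 1).
  by rewrite mulrC; apply: B => //; [exact: g3|rewrite mulr1 (le_trans fz)].
have b3 : modulus ((f z - f w) * (g w - g z0)) <= e / 4 * (1 * modulus h).
  rewrite mulrC; apply: B => //; first by rewrite mulr1 ltW// g6.
  by rewrite (le_trans (f1 _ _ z1 w1))// ler_wpM2r.
have b4 : modulus ((f z - f z0) * (p' * h + q' * h^*)) <= e / 4 * (1 * modulus h).
  apply: B => //; first by rewrite mulr1 ltW// f5.
  rewrite (le_trans (ler_modulusD _ _))// !modulusM modulus_conj -mulrDl.
  by rewrite ler_wpM2r.
do 3 (rewrite (le_trans (ler_modulusD _ _))// -?lerBrDr).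
all: lra.
Qed.

Lemma sdiffV f z0 p q : f z0 != 0 -> sdiff f z0 p q ->
  sdiff (fun z => (f z)^-1) z0 (- p / f z0 ^+ 2) (- q / f z0 ^+ 2).
Proof.
move=> fz0 fpq e e0.
pose m := modulus (f z0); have m0 : 0 < m by rewrite modulus_gt0.
have [d1 d10 f1] := sdiff_lipschitz fpq.
pose K := 1 + modulus p + modulus q.
have K0 : 0 < K by rewrite /K ltr_pwDl ?modulus_ge0// ltr_pwDl ?modulus_ge0.
have e2 : 0 < e / 2 * m ^+ 2 by rewrite mulr_gt0 ?divr_gt0// exprn_gt0.
have e3 : 0 < Num.min (m / 2) (e / 2 * m ^+ 3 / (6 * K)).
  by rewrite lt_min !(divr_gt0, mulr_gt0, exprn_gt0).
have [d2 d20 f2] := fpq _ e2; have [d3 d30 f3] := sdiff_continuous fpq e3.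
exists (Num.min d1 (Num.min d2 d3)) => [|z w]; first by rewrite !lt_min d10 d20.
rewrite !lt_min => /andP[z1 /andP[z2 z3]] /andP[w1 /andP[w2 w3]].
have half x : modulus (x - z0) < d3 -> m / 2 <= modulus (f x).
  move=> /f3; rewrite lt_min modulusB => /andP[xm _].
  have := ler_modulusB (f z0) (f x); rewrite -/m; lra.
have nz x : modulus (x - z0) < d3 -> f x != 0.
  by move=> /half; rewrite -modulus_gt0; apply: lt_le_trans; rewrite divr_gt0.
set h := z - w.
(* the linear part over f(z0)^2, plus f z - f w times
   1 / f(z0)^2 - 1 / (f z f w), which is small by continuity *)
rewrite (_ : _ - _ = - ((f z - f w - (p * h + q * h^*)) / f z0 ^+ 2) +
   (f z - f w) * ((f z * (f w - f z0) + (f z - f z0) * f z0) /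
      (f z0 ^+ 2 * (f z * f w)))); last first.
  by field; rewrite fz0 !nz.
rewrite (le_trans (ler_modulusD _ _))//.
have h0 : 0 <= modulus h by exact: modulus_ge0.
have t1 : modulus (- ((f z - f w - (p * h + q * h^*)) / f z0 ^+ 2)) <= e / 2 * modulus h.
  rewrite modulusN modulusM modulusV modulusX -/m ler_pdivrMr ?exprn_gt0//.
  by rewrite mulrAC; exact: f2.
have t2 : modulus ((f z - f w) * ((f z * (f w - f z0) + (f z - f z0) * f z0) /
      (f z0 ^+ 2 * (f z * f w)))) <= e / 2 * modulus h.
  set a := modulus (f z); set b := modulus (f w).
  have [am bm] : m / 2 <= a /\ m / 2 <= b by split; exact: half.
  have a2 : a <= 3 / 2 * m.
    have := f3 _ z3; rewrite lt_min => /andP[zm _].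
    have := ler_modulusB (f z) (f z0); rewrite -/m -/a; lra.
  set c := e / 2 * m ^+ 3 / (6 * K) in e3 f3.
  have fwc : modulus (f w - f z0) <= c by apply: ltW; have := f3 _ w3; rewrite lt_min => /andP[].
  have fzc : modulus (f z - f z0) <= c by apply: ltW; have := f3 _ z3; rewrite lt_min => /andP[].
  have num : modulus (f z * (f w - f z0) + (f z - f z0) * f z0) <= a * (3 * c).
    rewrite (le_trans (ler_modulusD _ _))// !modulusM -/a -/m.
    have := modulus_ge0 (f w - f z0); have := modulus_ge0 (f z - f z0) => F1 F2.
    have : a * modulus (f w - f z0) <= a * c by rewrite ler_wpM2l ?modulus_ge0.
    have : modulus (f z - f z0) * m <= c * (2 * a) by apply: ler_pM => //; lra.
    by lra.
  rewrite modulusM modulusM modulusV (modulusM (f z0 ^+ 2)) modulusX (modulusM (f z)) -/m -/a -/b.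
  have a0 : 0 < a by rewrite modulus_gt0 nz.
  have b0 : 0 < b by rewrite modulus_gt0 nz.
  rewrite (@le_trans _ _ (K * modulus h * (a * (3 * c) / (m ^+ 2 * (a * b)))))//.
    apply: ler_pM; rewrite ?modulus_ge0//.
    - by rewrite divr_ge0 ?modulus_ge0// ltW// !(mulr_gt0, exprn_gt0).
    - exact: f1.
    - by rewrite ler_wpM2r// invr_ge0 ltW// !(mulr_gt0, exprn_gt0).
  rewrite (_ : K * modulus h * _ = e / 2 * modulus h * (m / 2 / b)); last first.
    by rewrite /c; field; rewrite !lt0r_neq0.
  rewrite -[leRHS]mulr1 ler_wpM2l//; first by rewrite mulr_ge0// divr_ge0// ltW.
  by rewrite ler_pdivrMr// mul1r.
by rewrite (le_trans (lerD t1 t2))// -mulrDl -splitr.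
Qed.

(** Both differentials approximate the same increment of f; the increments
    h = t and h = i t pin down p + q and p - q. *)
Lemma sdiff_near f z0 p q : sdiff f z0 p q -> forall e : R, 0 < e ->
  exists2 d : R, 0 < d & forall z p' q', modulus (z - z0) < d -> sdiff f z p' q' ->
    modulus (p' - p) < e /\ modulus (q' - q) < e.
Proof.
move=> fpq e e0; have e3 : 0 < e / 3 by rewrite divr_gt0.
have [d d0 fd] := fpq _ e3; exists d => // z p' q' zd fz.
have [d' d'0 fd'] := fz _ e3.
pose m : R := Num.min (d - modulus (z - z0)) d'.
have m0 : 0 < m by rewrite lt_min subr_gt0 zd.
have [md md'] : m <= d - modulus (z - z0) /\ m <= d'.
  by rewrite !ge_min !lexx orbT.
pose t := m / 2; have [t0 td td'] : [/\ 0 < t, t < d - modulus (z - z0) & t < d'].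
  by rewrite /t; split; lra.
have B (h : C) : modulus h = t ->
    modulus ((p' - p) * h + (q' - q) * h^*) <= 2 * (e / 3) * t.
  move=> ht; have zh : modulus (z + h - z0) < d.
    by rewrite addrAC; have := ler_modulusD (z - z0) h; rewrite ht; lra.
  have := fd _ _ zh zd; have := fd' (z + h) z.
  rewrite (addrC z) addrK subrr modulus0 ht => /(_ td' d'0) h1 h2.
  rewrite (_ : (p' - p) * h + (q' - q) * h^* = (f (h + z) - f z - (p * h + q * h^*)) -
     (f (h + z) - f z - (p' * h + q' * h^*))); last by ring.
  rewrite (le_trans (ler_modulusD _ _))// modulusN.
  by rewrite (le_trans (lerD h2 h1))//; lra.
have B1 := B t%:C; have B2 := B ('i * t%:C).
rewrite modulusM !modulus_real gtr0_norm// in B1 B2.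
have mi : modulus ('i : C) = 1 by rewrite modulusE/= expr0n/= expr1n add0r sqrtr1.
rewrite mi mul1r in B2.
have {}B1 := B1 erefl; have {}B2 := B2 erefl.
have ii : ('i : C) * 'i = -1 by rewrite -expr2 sqr_i.
have ci : ('i : C)^* = - 'i by apply: complexP; rewrite /= ?oppr0.
rewrite conjC_real in B1; rewrite conjC_M conjC_real ci in B2.
have {}B1 : modulus (p' - p + (q' - q)) <= 2 * (e / 3).
  by move: B1; rewrite -mulrDl modulusM modulus_real gtr0_norm// ler_pM2r.
have {}B2 : modulus (p' - p - (q' - q)) <= 2 * (e / 3).
  move: B2; rewrite (_ : (p' - p) * ('i * t%:C) + _ = 'i * t%:C * (p' - p - (q' - q))); last by ring.
  by rewrite !modulusM mi mul1r modulus_real gtr0_norm// mulrC ler_pM2r.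
have two (x : C) : 2 * modulus x = modulus (2%:R * x) by rewrite modulusM modulus_natr.
have h1 : modulus (2%:R * (p' - p)) <= 4 * (e / 3).
  rewrite (_ : _ * _ = (p' - p + (q' - q)) + (p' - p - (q' - q))); last by ring.
  by rewrite (le_trans (ler_modulusD _ _))//; lra.
have h2 : modulus (2%:R * (q' - q)) <= 4 * (e / 3).
  rewrite (_ : _ * _ = (p' - p + (q' - q)) - (p' - p - (q' - q))); last by ring.
  by rewrite (le_trans (ler_modulusD _ _))// modulusN; lra.
by rewrite -!two in h1 h2; split; lra.
Qed.

Lemma disc_open z0 : disc z0 -> exists2 d : R, 0 < d &
  forall z, modulus (z - z0) < d -> disc z.
Proof.
rewrite /disc /= => z01; exists (1 - modulus z0); first by rewrite subr_gt0.
by move=> z; rewrite /= ltrBrDr; apply: le_lt_trans;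
  rewrite -{1}(subrK z0 z) ler_modulusD.
Qed.

Lemma sdiff_continuous_pq f (p q : C -> C) :
  (forall z, disc z -> sdiff f z (p z) (q z)) ->
  forall z, disc z -> ccontinuous_at p z /\ ccontinuous_at q z.
Proof.
move=> fpq z zD; split=> e e0; have [d d0 fd] := sdiff_near (fpq _ zD) e0;
  have [d' d'0 dD] := disc_open zD; exists (Num.min d d'); rewrite ?lt_min ?d0//;
  by move=> w; rewrite lt_min => /andP[wd wd'];
    have [] := fd _ _ _ wd (fpq _ (dD _ wd')).
Qed.

End StrictDifferentiability.

(** * Power series *)

Section PowerSeries.
Variable R : realType.
Local Notation C := R[i].
Implicit Types (f g : C -> C) (z w : C).

Lemma cvg_modulusP (u : nat -> C) (l : C) :
  (u @ \oo --> (l : C^o)) <-> (modulus (u n - l) @[n --> \oo] --> (0 : R)).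
Proof.
split.
- move=> /(@cvgrPdist_lt C C^o) ul; apply/cvgrPdist_lt => e e0.
  have e0C : 0 < e%:C by rewrite ltcR.
  have := ul _ e0C; apply: filterS => n h.
  by rewrite sub0r normrN ger0_norm ?modulus_ge0// -ltcR modulusC distrC.
- move=> /cvgrPdist_lt ul; apply/(@cvgrPdist_lt C C^o) => e e0.
  have [eE e0R] : e = (complex.Re e)%:C /\ 0 < complex.Re e.
    by move: e0; rewrite ltcE/= => /andP[/eqP eI eR]; split => //; apply: complexP.
  have := ul _ e0R; apply: filterS => n.
  rewrite sub0r normrN ger0_norm ?modulus_ge0// => h.
  by rewrite distrC -modulusC eE ltcR.
Qed.

Lemma modulus_lim_le (u : nat -> C) (l : C) (B : R) :
  (modulus (u n - l) @[n --> \oo] --> (0 : R)) ->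
  (forall n, modulus (u n) <= B) -> modulus l <= B.
Proof.
move=> ul uB; apply/ler_addgt0Pr => e e0.
have /cvgrPdist_le/(_ _ e0)[N _ /(_ N (leqnn _))] := ul.
rewrite /= sub0r normrN ger0_norm ?modulus_ge0// => h.
have := ler_modulusB l (u N); have := uB N; rewrite (modulusB l); lra.
Qed.

Lemma cvg_modulusD (u v : nat -> C) (l m : C) :
  (modulus (u n - l) @[n --> \oo] --> (0 : R)) ->
  (modulus (v n - m) @[n --> \oo] --> (0 : R)) ->
  (modulus (u n + v n - (l + m)) @[n --> \oo] --> (0 : R)).
Proof.
move=> ul vm.
have uv : modulus (u n - l) + modulus (v n - m) @[n --> \oo] --> (0 : R).
  by rewrite -[X in _ --> X]addr0; exact: cvgD.
have c0 : 0 @[n --> \oo] --> (0 : R) by exact: cvg_cst.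
apply: (squeeze_cvgr _ c0 uv); apply: nearW => n.
rewrite modulus_ge0 /= (_ : _ - _ = (u n - l) + (v n - m)); last by ring.
exact: ler_modulusD.
Qed.

Lemma cvg_modulusZ (c : C) (u : nat -> C) (l : C) :
  (modulus (u n - l) @[n --> \oo] --> (0 : R)) ->
  (modulus (c * u n - c * l) @[n --> \oo] --> (0 : R)).
Proof.
move=> ul; rewrite -(mulr0 (modulus c)).
under eq_fun do rewrite -mulrBr modulusM.
by apply: cvgM => //; exact: cvg_cst.
Qed.

Lemma modulus_subXX z w (s : R) n : modulus z <= s -> modulus w <= s ->
  modulus (z ^+ n.+1 - w ^+ n.+1) <= n.+1%:R * s ^+ n * modulus (z - w).
Proof.
move=> zs ws; have s0 : 0 <= s by rewrite (le_trans (modulus_ge0 z)).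
elim: n => [|n IH]; first by rewrite !expr1 expr0 !mul1r.
rewrite (_ : _ - _ = z * (z ^+ n.+1 - w ^+ n.+1) + w ^+ n.+1 * (z - w)); last first.
  by rewrite (exprS z n.+1) (exprS w n.+1); ring.
rewrite (le_trans (ler_modulusD _ _))// !modulusM modulusX.
have h1 : modulus z * modulus (z ^+ n.+1 - w ^+ n.+1) <=
    s * (n.+1%:R * s ^+ n * modulus (z - w)).
  by apply: ler_pM => //; exact: modulus_ge0.
have h2 : modulus w ^+ n.+1 * modulus (z - w) <= s ^+ n.+1 * modulus (z - w).
  by rewrite ler_wpM2r ?modulus_ge0// lerXn2r ?nnegrE ?modulus_ge0.
rewrite (le_trans (lerD h1 h2))// le_eqVlt; apply/orP; left; apply/eqP.
by rewrite -[in RHS]natr1 !exprS; ring.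
Qed.

Lemma sum_halfX N : \sum_(0 <= n < N) (1 / 2) ^+ n <= 2 :> R.
Proof.
suff -> : \sum_(0 <= n < N) (1 / 2) ^+ n = 2 - 2 * (1 / 2) ^+ N :> R.
  by rewrite gerBl mulr_ge0// exprn_ge0// divr_ge0.
elim: N => [|N IH]; first by rewrite big_geq// expr0; ring.
by rewrite big_nat_recr//= IH exprS; field.
Qed.

(** Geometric domination of n s^(n-1), with a ratio that is still summable. *)
Lemma natmulX_le (s : R) n : 0 <= s -> s <= 1 / 4 ->
  n.+2%:R * s ^+ n.+1 <= s * 8 * (1 / 2) ^+ n.+2.
Proof.
move=> s0 s4.
have k2 : n.+2%:R <= 2 * 2 ^+ n :> R.
  elim: n => [|n IH]; first by rewrite expr0; lra.
  have : 1 <= 2 ^+ n :> R by rewrite exprn_ege1// ler1n.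
  by rewrite -natr1 exprS; lra.
have -> : s * 8 * (1 / 2) ^+ n.+2 = s * (2 * 2 ^+ n) * (1 / 4) ^+ n :> R.
  set c := 1 / 2 : R.
  have e1 : 2 ^+ n * c ^+ n = 1 by rewrite -exprMn /c mulrC divfK ?expr1n.
  have -> : 1 / 4 = c * c by rewrite /c; field.
  rewrite (exprMn n c c) [RHS](_ : _ = 2 * s * c ^+ n * (2 ^+ n * c ^+ n)); last by ring.
  by rewrite e1 !exprS /c; field.
rewrite exprS mulrCA -mulrA ler_wpM2l// ler_pM ?exprn_ge0//.
by rewrite lerXn2r ?nnegrE// divr_ge0.
Qed.

Variables (f : C -> C) (z0 : C) (a : nat -> C) (r : R).
Hypothesis r0 : 0 < r.
Hypothesis fa : forall z, modulus (z - z0) < r ->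
  series (fun n => a n * (z - z0) ^+ n : C^o) @ \oo --> (f z : C^o).

(** The terms of the series are bounded at distance r / 2 from the centre, where
    it converges. *)
Lemma power_series_coef_bound :
  exists2 M : R, 0 < M & forall n, modulus (a n) <= M * (2 / r) ^+ n.
Proof.
have zr : modulus (z0 + (r / 2)%:C - z0) < r.
  rewrite addrC addKr modulus_real ger0_norm; last by rewrite divr_ge0// ltW.
  by rewrite ltr_pdivrMr// ltr_pMr// ltr1n.
have /cvg_modulusP fz := fa zr.
have [M [Mr MP]] : bounded_fun (fun n => modulus (series
    (fun n => a n * (z0 + (r / 2)%:C - z0) ^+ n : C^o) n - f (z0 + (r / 2)%:C))).
  by apply: cvg_seq_bounded; apply/cvg_ex; exists 0.
set u := (fun n => a n * (z0 + (r / 2)%:C - z0) ^+ n : C^o) in fz MP.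
exists (2 * (`|M| + 1)) => [|n]; first by rewrite mulr_gt0// ltr_wpDl.
have B m : modulus (series u m - f (z0 + (r / 2)%:C)) <= `|M| + 1.
  have hM : M < `|M| + 1 by rewrite (le_lt_trans (ler_norm _))// ltrDl.
  by have := MP _ hM m I; rewrite /= ger0_norm ?modulus_ge0.
have un : modulus (u n) <= 2 * (`|M| + 1).
  rewrite (_ : u n = (series u n.+1 - f (z0 + (r / 2)%:C)) -
      (series u n - f (z0 + (r / 2)%:C))); last first.
    by rewrite seriesSr; ring.
  rewrite (le_trans (ler_modulusD _ _))// modulusN.
  by have := B n; have := B n.+1; lra.
have r2 : 0 < r / 2 by rewrite divr_gt0.
move: un; rewrite /u addrC addKr modulusM modulusX modulus_real ger0_norm; last exact: ltW.
rewrite -ler_pdivlMr ?exprn_gt0// => /le_trans; apply.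
by rewrite -exprVn invf_div.
Qed.

(** Term by term, z^n - w^n is at most n s^(n-1) |z - w|, so the terms of
    degree at least 2 contribute O(s) |z - w| on the disc of radius s. *)
Lemma power_series_sdiff : sdiff f z0 (a 1%N) 0.
Proof.
have [M M0 aM] := power_series_coef_bound.
move=> e e0.
(* 2 s / r <= 1 / 4 makes the remainder geometric, and s <= e r^2 / (64 M)
   makes its sum at most e |z - w| *)
pose s := Num.min (r / 8) (e * r ^+ 2 / (64 * M)).
have s0 : 0 < s by rewrite lt_min !(divr_gt0, mulr_gt0, exprn_gt0).
have [sr se] : s <= r / 8 /\ s <= e * r ^+ 2 / (64 * M).
  by rewrite !ge_min !lexx orbT.
exists s => // z w zs ws.
have sltr : s < r by apply: (le_lt_trans sr); lra.
have /cvg_modulusP fz := fa (lt_trans zs sltr).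
have /cvg_modulusP fw := fa (lt_trans ws sltr).
rewrite mul0r addr0.
pose t n := a n * ((z - z0) ^+ n - (w - z0) ^+ n) - (if n == 1%N then a 1%N * (z - w) else 0).
have tb n : modulus (t n) <= M * (2 / r) * (8 * (2 * s / r)) * modulus (z - w) * (1 / 2) ^+ n.
  have pos : 0 <= M * (2 / r) * (8 * (2 * s / r)) * modulus (z - w) * (1 / 2) ^+ n.
    by rewrite !(mulr_ge0, modulus_ge0, invr_ge0, exprn_ge0, divr_ge0)// ltW.
  rewrite /t; case: n pos => [|[|n]] pos.
  - by rewrite !expr0 subrr mulr0 subr0 modulus0.
  - by rewrite eqxx !expr1 (_ : _ - _ = 0) ?modulus0//; ring.
  rewrite subr0 modulusM.
  have Z := modulus_subXX n.+1 (ltW zs) (ltW ws).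
  rewrite (le_trans (ler_pM (modulus_ge0 _) (modulus_ge0 _) (aM _) Z))//.
  rewrite (_ : z - z0 - (w - z0) = z - w); last by ring.
  have s14 : 2 * s / r <= 1 / 4 by rewrite ler_pdivrMr//; lra.
  have s02 : 0 <= 2 * s / r by rewrite divr_ge0 ?mulr_ge0// ltW.
  have := natmulX_le n s02 s14.
  have W0 : 0 <= M * (2 / r) * modulus (z - w).
    by rewrite !(mulr_ge0, modulus_ge0, invr_ge0)// ltW.
  move=> /(ler_wpM2l W0) => W.
  apply: (@le_trans _ _ (M * (2 / r) * modulus (z - w) *
      (n.+2%:R * (2 * s / r) ^+ n.+1))).
    rewrite (_ : 2 * s / r = 2 / r * s); last by rewrite mulrAC.
    move: (2 / r) => c; rewrite exprMn (exprS c n.+1) le_eqVlt; apply/orP; left; apply/eqP.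
    by ring.
  by rewrite (le_trans W)// le_eqVlt; apply/orP; left; apply/eqP; ring.
have tE N : \sum_(0 <= n < N.+2) t n =
    series (fun n => a n * (z - z0) ^+ n : C^o) N.+2 -
    series (fun n => a n * (w - z0) ^+ n : C^o) N.+2 - a 1%N * (z - w).
  rewrite /series /= /t big_split/= sumrN; congr (_ - _).
    by rewrite -sumrB; apply: eq_bigr => n _; rewrite mulrBr.
  by rewrite big_nat_recl// big_nat_recl//= big1 ?addr0 ?add0r.
have lim : modulus ((\sum_(0 <= n < N.+2) t n) - (f z - f w - a 1%N * (z - w)))
    @[N --> \oo] --> (0 : R).
  have c0 : modulus (- (a 1%N * (z - w)) - (- (a 1%N * (z - w)))) @[_ --> \oo] --> (0 : R).
    by rewrite subrr modulus0; exact: cvg_cst.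
  have := cvg_modulusD (cvg_modulusD fz (cvg_modulusZ (-1) fw)) c0.
  rewrite -(cvg_shiftn 2)/= => L.
  apply: cvg_trans L; apply: near_eq_cvg; apply: nearW => N /=.
  by rewrite tE addn2; congr modulus; ring.
have := modulus_lim_le lim; apply => N.
rewrite (le_trans (ler_modulus_sum _ _ _))//.
apply: (@le_trans _ _ (\sum_(0 <= n < N.+2)
   M * (2 / r) * (8 * (2 * s / r)) * modulus (z - w) * (1 / 2) ^+ n)).
  by apply: ler_sum => n _; exact: tb.
rewrite -big_distrr/=.
set K := _ * modulus (z - w).
have K0 : 0 <= K by rewrite !(mulr_ge0, modulus_ge0, invr_ge0, divr_ge0)// ltW.
rewrite (le_trans (ler_wpM2l K0 (sum_halfX _)))// /K mulrAC ler_wpM2r ?modulus_ge0//.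
rewrite (_ : _ * 2 = 64 * M / r ^+ 2 * s); last by field; exact: lt0r_neq0.
rewrite mulrC -ler_pdivlMr; last by rewrite divr_gt0 ?mulr_gt0// exprn_gt0.
by rewrite invf_div mulrA.
Qed.

Lemma power_series_center : f z0 = a 0%N.
Proof.
have z0r : modulus (z0 - z0) < r by rewrite subrr modulus0.
have /cvg_modulusP := fa z0r; rewrite subrr => fz.
apply/eqP; rewrite -subr_eq0 -modulus_eq0 modulusB; apply/eqP.
apply: (@cvg_unique _ _ (modulus (a 0%N - f z0) @[_ --> \oo])) => //.
- exact: cvg_cst.
- apply: cvg_trans fz; apply: near_eq_cvg; exists 1%N => // n /= n0.
  rewrite /series /= big_ltn// big1_seq ?addr0 ?expr0 ?mulr1// => i /andP[_].
  by rewrite mem_index_iota => /andP[i0 _]; rewrite expr0n (gtn_eqF i0) mulr0.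
Qed.

End PowerSeries.

(** * Analytic functions and the Bergman kernel *)

Section AnalyticFunctions.
Variable R : realType.
Local Notation C := R[i].
Implicit Types (f g : C -> C) (z w : C).

Lemma sdiff_eq_near f g z0 (p q : C) :
  (exists2 d : R, 0 < d & forall z, modulus (z - z0) < d -> f z = g z) ->
  sdiff f z0 p q -> sdiff g z0 p q.
Proof.
move=> [d d0 fg] fpq e e0; have [d' d'0 fd] := fpq _ e0.
exists (Num.min d d') => [|z w]; first by rewrite lt_min d0.
by rewrite !lt_min => /andP[zd zd'] /andP[wd wd']; rewrite -!fg//; exact: fd.
Qed.

Lemma analytic_sdiff f : analytic_on_disc f ->
  forall z, disc z -> exists a : C, sdiff f z a 0.
Proof.
move=> fa z zD; have [a [r [r0 fr]]] := fa _ zD.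
by exists (a 1%N); exact: power_series_sdiff r0 fr.
Qed.

(** At the point z itself the quotient has the power series of f with the
    coefficients shifted by one. *)
Lemma analytic_divided_difference f z : analytic_on_disc f -> disc z ->
  exists g, (forall w, f w - f z = (w - z) * g w) /\
    (forall w, disc w -> exists b : C, sdiff g w b 0).
Proof.
move=> fa zD; have [a [r [r0 fr]]] := fa _ zD.
pose g w := if w == z then a 1%N else (f w - f z) / (w - z).
exists g; split=> [w|w wD].
  rewrite /g; case: eqVneq => [->|wz]; first by rewrite !subrr mul0r.
  by rewrite mulrC divfK// subr_eq0.
have [->|wz] := eqVneq w z.
  suff gS u : modulus (u - z) < r ->
      series (fun n => a n.+1 * (u - z) ^+ n : C^o) @ \oo --> (g u : C^o).
    by exists (a 2%N); exact: (power_series_sdiff r0 gS).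
  move=> ur.
  apply/cvg_modulusP; rewrite /g; case: eqVneq => [->|uz].
    have c0 : 0 @[n --> \oo] --> (0 : R) by exact: cvg_cst.
    rewrite -(cvg_shiftn 1)/=; apply: cvg_trans c0.
    apply: near_eq_cvg; apply: nearW => n /=.
    rewrite /series /= addn1 big_nat_recl// subrr big1 => [|i _].
      by rewrite addr0 expr0 mulr1 subrr modulus0.
    by rewrite expr0n mulr0.
  have /cvg_modulusP := fr _ ur; rewrite -(cvg_shiftn 1)/= => fru.
  have := cvg_modulusZ ((u - z)^-1) (cvg_modulusD fru
    (_ : modulus (- f z - - f z) @[_ --> \oo] --> (0 : R))).
  have c0 : modulus (- f z - - f z) @[_ --> \oo] --> (0 : R).
    by rewrite subrr modulus0; exact: cvg_cst.
  move=> /(_ c0); apply: cvg_trans; apply: near_eq_cvg; apply: nearW => n /=.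
  congr modulus; rewrite [(f u - f z) / _]mulrC; congr (_ - _).
  rewrite (power_series_center r0 fr) addn1 /series /= big_nat_recl// expr0 mulr1.
  rewrite addrAC subrr add0r big_distrr/=; apply: eq_bigr => i _.
  by rewrite exprS; field; rewrite subr_eq0.
have [b fb] := analytic_sdiff fa wD.
have wz0 : w - z != 0 by rewrite subr_eq0.
have s1 := sdiffD fb (sdiff_cst (- f z) w).
have s2 := @sdiffV _ (fun u => u - z) w _ _ wz0 (sdiffD (sdiff_id w) (sdiff_cst (- z) w)).
have s3 := @sdiffM _ (fun u => f u - f z) (fun u => (u - z)^-1) w _ _ _ _ s1 s2; rewrite !(addr0, oppr0, mul0r, mulr0) in s3.
eexists; apply: sdiff_eq_near s3; exists (modulus (w - z)); first by rewrite modulus_gt0.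
move=> u uw; rewrite /g; case: eqVneq => // uz.
by rewrite uz modulusB ltxx in uw.
Qed.

Lemma analytic_linear (c : C) f g : analytic_on_disc f -> analytic_on_disc g ->
  analytic_on_disc (fun z => c * f z + g z).
Proof.
move=> fa ga z0 z0D; have [a [r [r0 fr]]] := fa _ z0D.
have [b [s [s0 gs]]] := ga _ z0D.
exists (fun n => c * a n + b n), (Num.min r s); split; first by rewrite lt_min r0.
move=> z; rewrite lt_min => /andP[/fr/cvg_modulusP fz /gs/cvg_modulusP gz].
apply/cvg_modulusP; have := cvg_modulusD (cvg_modulusZ c fz) gz.
apply: cvg_trans; apply: near_eq_cvg; apply: nearW => n.
rewrite /series /=; congr (modulus (_ - _)).
by rewrite big_distrr -big_split/=; apply: eq_bigr => i _; rewrite mulrDl mulrA.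
Qed.

Lemma geometric2_remainder (t : C) N : t != 1 ->
  ((1 - t) ^+ 2)^-1 = \sum_(0 <= n < N) n.+1%:R * t ^+ n +
    (N.+1%:R * t ^+ N - N%:R * t ^+ N.+1) / (1 - t) ^+ 2.
Proof.
rewrite eq_sym -subr_eq0 => t1; elim: N => [|N IH].
  by rewrite big_geq// expr0 mul0r subr0 mulr1 add0r mul1r.
rewrite big_nat_recr//= [LHS]IH -addrA; congr (_ + _).
by rewrite -!natr1 !exprS; field.
Qed.

Lemma cvg_geometric2_remainder :
  (2 * N%:R + 1) * (1 / 2) ^+ N @[N --> \oo] --> (0 : R).
Proof.
have up N : (2 * N%:R + 1) * (1 / 2) ^+ N <= 4 * (3 / 4) ^+ N :> R.
  have h : 2 * N%:R + 1 <= 4 * (3 / 2) ^+ N :> R.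
    elim: N => [|N IH]; first by rewrite expr0; lra.
    have : 1 <= (3 / 2) ^+ N :> R by rewrite exprn_ege1// ler_pdivlMr// mul1r ler_nat.
    by rewrite (_ : N.+1%:R = N%:R + 1) ?natr1// exprS; lra.
  rewrite (_ : 3 / 4 = 3 / 2 * (1 / 2)); last by field.
  by rewrite (exprMn N (3 / 2) (1 / 2)) mulrA ler_wpM2r// exprn_ge0// divr_ge0.
have g0 : 4 * (3 / 4) ^+ N @[N --> \oo] --> (0 : R).
  rewrite -(mulr0 4); apply: cvgM; first exact: cvg_cst.
  by apply: cvg_expr; rewrite ger0_norm ?divr_ge0// ltr_pdivrMr// mul1r ltr_nat.
have c0 : 0 @[n --> \oo] --> (0 : R) by exact: cvg_cst.
apply: (squeeze_cvgr _ c0 g0); apply: nearW => N.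
by rewrite up andbT mulr_ge0 ?exprn_ge0 ?divr_ge0// addr_ge0// mulr_ge0.
Qed.

Lemma kernel_neq0 (c z : C) : modulus c <= 1 -> modulus z < 1 ->
  1 - modulus z <= modulus (1 - c * z) /\ 1 - c * z != 0.
Proof.
move=> c1 z1; have cz : modulus (c * z) <= modulus z.
  by rewrite modulusM ler_piMl ?modulus_ge0.
have h : 1 - modulus z <= modulus (1 - c * z).
  by have := ler_modulusB 1 (c * z); rewrite modulus1; lra.
by split => //; rewrite -modulus_gt0 (lt_le_trans _ h)// subr_gt0.
Qed.

(** Expansion of the Bergman kernel about an arbitrary centre, with an error
    uniform in c; this gives analyticity of the kernel and, after integration
    in c, of the Bergman projection. *)
Lemma kernel_remainder (c z0 z : C) N : modulus c <= 1 -> modulus z0 < 1 ->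
  modulus (z - z0) <= (1 - modulus z0) / 2 ->
  modulus (((1 - c * z) ^+ 2)^-1 -
    \sum_(0 <= n < N) n.+1%:R * (c ^+ n / (1 - c * z0) ^+ n.+2) * (z - z0) ^+ n) <=
  4 / (1 - modulus z0) ^+ 2 * ((2 * N%:R + 1) * (1 / 2) ^+ N).
Proof.
move=> c1 z01 zz0; have [d0 nz] := kernel_neq0 c1 z01.
set d := 1 - modulus z0 in zz0 d0 *; have dp : 0 < d by rewrite subr_gt0.
set t := c * (z - z0) / (1 - c * z0).
have t2 : modulus t <= 1 / 2.
  rewrite /t modulusM modulusV ler_pdivrMr ?modulus_gt0// modulusM.
  rewrite (@le_trans _ _ (1 * (d / 2)))//; last by lra.
  by apply: ler_pM => //; exact: modulus_ge0.
have t1 : t != 1.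
  by apply/eqP => tE; move: t2; rewrite tE modulus1; lra.
have E : 1 - c * z = (1 - c * z0) * (1 - t) by rewrite /t; field.
rewrite E exprMn invfM (geometric2_remainder N t1) mulrDr big_distrr/=.
rewrite (eq_bigr (fun n => n.+1%:R * (c ^+ n / (1 - c * z0) ^+ n.+2) * (z - z0) ^+ n)).
  rewrite addrAC subrr add0r !modulusM.
  have n1 : modulus (1 - t) ^- 2 <= 4.
    have h2 : 1 / 2 <= modulus (1 - t).
      by have := ler_modulusB 1 t; rewrite modulus1; lra.
    rewrite -[leRHS]invrK lef_pV2 ?posrE ?exprn_gt0//; [|lra].
    rewrite (_ : 4^-1 = (1 / 2) ^+ 2); last by rewrite expr2; field.
    by rewrite lerXn2r ?nnegrE ?modulus_ge0//; lra.
  have n2 : modulus ((1 - c * z0) ^- 2) <= d ^- 2.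
    rewrite modulusV modulusX lef_pV2 ?posrE ?exprn_gt0//; last exact: lt_le_trans d0.
    by rewrite lerXn2r ?nnegrE ?modulus_ge0// ltW.
  have n3 : modulus (N.+1%:R * t ^+ N - N%:R * t ^+ N.+1) <=
      (2 * N%:R + 1) * (1 / 2) ^+ N.
    rewrite (le_trans (ler_modulusD _ _))// modulusN (modulusM N.+1%:R) (modulusM N%:R) !modulusX !modulus_natr.
    have a1 : modulus t ^+ N <= (1 / 2) ^+ N.
      by rewrite lerXn2r ?nnegrE ?modulus_ge0//; lra.
    have a2 : modulus t ^+ N.+1 <= (1 / 2) ^+ N.
      rewrite exprS (le_trans _ a1)// ler_piMl ?exprn_ge0 ?modulus_ge0//; lra.
    rewrite (_ : (2 * N%:R + 1) * _ = N.+1%:R * (1 / 2) ^+ N + N%:R * (1 / 2) ^+ N).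
      by rewrite lerD// ler_wpM2l.
    by rewrite -natr1; ring.
  rewrite (modulusV ((1 - t) ^+ 2)) modulusX (mulrC 4) -(mulrA _ 4).
  apply: ler_pM; rewrite ?mulr_ge0 ?modulus_ge0 ?invr_ge0 ?exprn_ge0 ?modulus_ge0//.
  rewrite mulrC; apply: ler_pM; rewrite ?mulr_ge0 ?modulus_ge0 ?invr_ge0 ?exprn_ge0 ?modulus_ge0//.
move=> n _; rewrite /t (exprMn n (c * (z - z0))) (exprMn n c) exprVn.
by rewrite !exprS expr0 ; field; rewrite nz expf_neq0.
Qed.

Lemma analytic_kernel (c : C) : modulus c <= 1 ->
  analytic_on_disc (fun z => ((1 - c * z) ^+ 2)^-1).
Proof.
move=> c1 z0 z0D; exists (fun n => n.+1%:R * (c ^+ n / (1 - c * z0) ^+ n.+2)).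
have dp : 0 < 1 - modulus z0 by rewrite subr_gt0.
exists ((1 - modulus z0) / 2); split; first by rewrite divr_gt0.
move=> z zr; apply/cvg_modulusP.
have c0 : 0 @[n --> \oo] --> (0 : R) by exact: cvg_cst.
have g0 : 4 / (1 - modulus z0) ^+ 2 * ((2 * N%:R + 1) * (1 / 2) ^+ N)
    @[N --> \oo] --> (0 : R).
  rewrite -[X in _ --> X](mulr0 (4 / (1 - modulus z0) ^+ 2)).
  by apply: cvgM; [exact: cvg_cst|exact: cvg_geometric2_remainder].
apply: (squeeze_cvgr _ c0 g0); apply: nearW => N.
rewrite modulus_ge0 /= modulusB; apply: kernel_remainder => //; exact: ltW.
Qed.

End AnalyticFunctions.

(** * The plane as a measure space *)

Section PlaneMeasure.
Variable R : realType.
Local Notation C := R[i].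
Local Notation leb := (@lebesgue_measure R).
Local Notation P := (measurableTypeR R * measurableTypeR R)%type.
Implicit Types (z w : C) (xy : P).

Lemma modulus_of_plane_lt z w (d : R) :
  `|complex.Re z - complex.Re w| < d / 2 -> `|complex.Im z - complex.Im w| < d / 2 ->
  modulus (z - w) < d.
Proof.
have := ler_modulus_ReIm (z - w); rewrite cReD cImD cReN cImN => h h1 h2.
by rewrite (le_lt_trans h)// (splitr d) ltrD.
Qed.

Lemma cmeasurable_of_plane : cmeasurable setT (@of_plane R).
Proof. by split; [exact: measurable_fst|exact: measurable_snd]. Qed.

(** An open set is the union of the squares with rational centre and side
    2/(n+1) contained in it. *)
Lemma measurable_plane_open (A : set C) :
  (forall z, A z -> exists2 d : R, 0 < d & forall w, modulus (w - z) < d -> A w) ->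
  measurable (@of_plane R @^-1` A).
Proof.
move=> oA.
pose Q (q1 q2 : rat) (n : nat) : set P :=
  ball (ratr q1 : R) (n.+1%:R^-1) `*` ball (ratr q2 : R) (n.+1%:R^-1).
pose Q' q1 q2 n := if `[< Q q1 q2 n `<=` @of_plane R @^-1` A >] then Q q1 q2 n else set0.
rewrite (_ : _ @^-1` _ = \bigcup_q1 \bigcup_q2 \bigcup_n Q' q1 q2 n); last first.
  apply/seteqP; split => [[x y] /= Axy|xy [q1 _ [q2 _ [n _]]]]; last first.
    by rewrite /Q'; case: ifPn => // /asboolP QA /QA.
  have [d d0 dA] := oA _ Axy.
  have [n nd] : exists n : nat, n.+1%:R^-1 < d / 4.
    have [n _ /(_ n (leqnn _)) h] := near_infty_natSinv_lt (PosNum (divr_gt0 d0 (ltr0n R 4))).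
    by exists n.
  have n0 : 0 < n.+1%:R^-1 :> R by rewrite invr_gt0.
  have [q1 xq1] : exists q : rat, `|x - ratr q| < n.+1%:R^-1.
    have h : x - n.+1%:R^-1 < x + n.+1%:R^-1 by move: n0; move: (n.+1%:R^-1) => i; lra.
    have [q] := rat_in_itvoo h.
    by rewrite in_itv/= => /andP[h1 h2]; exists q; move: h1 h2; rewrite ltr_norml; move: (n.+1%:R^-1) => i; lra.
  have [q2 yq2] : exists q : rat, `|y - ratr q| < n.+1%:R^-1.
    have h : y - n.+1%:R^-1 < y + n.+1%:R^-1 by move: n0; move: (n.+1%:R^-1) => i; lra.
    have [q] := rat_in_itvoo h.
    by rewrite in_itv/= => /andP[h1 h2]; exists q; move: h1 h2; rewrite ltr_norml; move: (n.+1%:R^-1) => i; lra.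
  exists q1 => //; exists q2 => //; exists n => //; rewrite /Q'.
  have -> : `[< Q q1 q2 n `<=` @of_plane R @^-1` A >].
    apply/asboolP => -[u v] [/= uq vq]; apply: dA; apply: modulus_of_plane_lt => /=.
      have := ler_distD (ratr q1) u x; move: uq; rewrite /ball/= (distrC x) in xq1 *.
      by rewrite (distrC _ u); move: nd xq1; move: (n.+1%:R^-1) => i; lra.
    have := ler_distD (ratr q2) v y; move: vq; rewrite /ball/= (distrC y) in yq2 *.
    by rewrite (distrC _ v); move: nd yq2; move: (n.+1%:R^-1) => i; lra.
  by split; rewrite /ball /= distrC.
apply: bigcupT_measurable_rat => q1; apply: bigcupT_measurable_rat => q2.
apply: bigcupT_measurable => n; rewrite /Q'; case: ifP => // _.
by apply: measurableX; exact: measurable_ball.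
Qed.

Lemma measurable_plane_disc : measurable (@plane_disc R).
Proof. by apply: measurable_plane_open => z; exact: disc_open. Qed.

Lemma continuous_measurable_plane_disc (h : C -> R) :
  (forall z, disc z -> forall e : R, 0 < e -> exists2 d : R, 0 < d &
     forall w, modulus (w - z) < d -> `|h w - h z| < e) ->
  measurable_fun (@plane_disc R) (h \o @of_plane R).
Proof.
move=> ch mD; apply: (measurability _ (RGenOInfty.measurableE R)) => //.
move=> /= _ [_ [a ->] <-]; rewrite preimage_itvoy.
apply: (@measurable_plane_open [set z | disc z /\ a < h z]) => z [zD az].
have ea : 0 < h z - a by rewrite subr_gt0.
have [d d0 dh] := ch _ zD _ ea; have [d' d'0 dD] := disc_open zD.
exists (Num.min d d'); first by rewrite lt_min d0.
move=> w; rewrite lt_min => /andP[/dh + /dD wD]; rewrite ltr_norml => /andP[h1 _].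
by split => //; lra.
Qed.

Lemma ccontinuous_cmeasurable (f : C -> C) :
  (forall z, disc z -> ccontinuous_at f z) ->
  cmeasurable (@plane_disc R) (f \o @of_plane R).
Proof.
move=> cf; split.
- apply: (@continuous_measurable_plane_disc (fun z => complex.Re (f z))) => z zD e e0.
  have [d d0 fd] := cf _ zD _ e0; exists d => // w /fd.
  by apply: le_lt_trans; rewrite -cReN -cReD; exact: ler_norm_Re.
- apply: (@continuous_measurable_plane_disc (fun z => complex.Im (f z))) => z zD e e0.
  have [d d0 fd] := cf _ zD _ e0; exists d => // w /fd.
  by apply: le_lt_trans; rewrite -cImN -cImD; exact: ler_norm_Im.
Qed.

(** Compactness of a square containing the closed disc; at a point of the square
    outside that disc the bound is vacuous nearby. *)
Lemma ccontinuous_bounded (f : C -> C) (s : R) :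
  (forall z, modulus z <= s -> ccontinuous_at f z) ->
  exists M : R, forall z, modulus z <= s -> modulus (f z) <= M.
Proof.
move=> cf.
have cK : compact (`[- s, s]%classic `*` `[- s, s]%classic : set (R * R)).
  by apply: compact_setX; exact: segment_compact.
pose B (M : R) (xy : R * R) := modulus (xy.1 +i* xy.2) <= s -> modulus (f (xy.1 +i* xy.2)) <= M.
have near_ball (x y : R) (d : R) : 0 < d ->
    \forall p \near (x, y), modulus ((p.1 +i* p.2) - (x +i* y)) < d.
  move=> d0; have d2 : 0 < d / 2 by rewrite divr_gt0.
  exists (ball x (d / 2), ball y (d / 2)) => /=.
    by split; exact: nbhsx_ballx.
  move=> [u v] [/= xu yv]; apply: modulus_of_plane_lt => /=; rewrite distrC.
    exact: xu.
  exact: yv.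
have /compact_near_coveringP/(_ _ (+oo%R : set_system R) B) := cK.
have H : forall x : R * R, (`[- s, s]%classic `*` `[- s, s]%classic) x ->
    \forall x' \near x & i \near +oo%R, B i x'.
  move=> [x y] _; have [xs|xs] := leP (modulus (x +i* y)) s.
    have [d d0 fd] := cf _ xs _ ltr01.
    exists ([set p | modulus ((p.1 +i* p.2) - (x +i* y)) < d],
      [set M | modulus (f (x +i* y)) + 1 <= M]) => /=.
      by split; [exact: near_ball|apply: nbhs_pinfty_ge; exact: num_real].
    move=> [[u v] M] [/= uv hM] _ /=; have := fd _ uv.
    by have := ler_modulusB (f (u +i* v)) (f (x +i* y)); lra.
  exists ([set p | modulus ((p.1 +i* p.2) - (x +i* y)) < modulus (x +i* y) - s],
      [set M | True]) => /=.
    by split; [apply: near_ball; rewrite subr_gt0|exact: filterT].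
  move=> [[u v] M] [/= uv _] uvs.
  have := ler_modulusB (x +i* y) (u +i* v); rewrite modulusB in uv.
  by move: uvs uv => /=; lra.
move=> /(_ _ H) [M0 [_ hM]].
exists (M0 + 1) => z zs.
have zK : (`[- s, s]%classic `*` `[- s, s]%classic) (complex.Re z, complex.Im z).
  split; rewrite /= in_itv/= -ler_norml (le_trans _ zs)//.
    exact: ler_norm_Re.
  exact: ler_norm_Im.
have := hM (M0 + 1) _ _ zK; rewrite /B /=; case: z zs {zK} => a b /= zs; apply => //.
by rewrite ltrDl.
Qed.

Lemma sigma_sigma_finite : sigma_finite setT (@sigma R).
Proof.
have /sigma_finiteP[F [TF ndF Foo]] := sigma_finiteT leb.
exists (fun n => F n `*` F n).
  rewrite -setXTT TF predeqE => -[x y]; split; last first.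
    by move=> [n _ [/= ? ?]]; split; exists n.
  move=> [/= [n _ Fnx] [k _ Fky]]; exists (maxn n k) => //; split.
  - by move: x Fnx; exact/subsetPset/ndF/leq_maxl.
  - by move: y Fky; exact/subsetPset/ndF/leq_maxr.
move=> k; have [mF Fy] := Foo k; split; first exact: measurableX.
rewrite /sigma /mscale /= product_measure1E//.
rewrite lte_mul_pinfty// ?lee_fin ?invpi_ge0// lte_mul_pinfty//.
by rewrite ge0_fin_numE.
Qed.

HB.instance Definition _ := Measure.on (@sigma R).
HB.instance Definition _ := Measure_isSigmaFinite.Build _ _ _ (@sigma R)
  sigma_sigma_finite.

Lemma disc_integralE (f : C -> C) :
  disc_integral f = cint (@sigma R) (@plane_disc R) (f \o @of_plane R).
Proof. by []. Qed.

Lemma ge0_integral_sigma (D : set P) (f : P -> \bar R) : measurable D ->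
  measurable_fun D f -> (forall x, D x -> 0 <= f x)%E ->
  (\int[@sigma R]_(xy in D) f xy = (pi^-1)%:E * \int[leb \x leb]_(xy in D) f xy)%E.
Proof. by move=> mD mf f0; rewrite /sigma ge0_integral_mscale. Qed.

Lemma integral_sigma (D : set P) (f : P -> \bar R) : measurable D ->
  (leb \x leb)%E.-integrable D f ->
  (\int[@sigma R]_(xy in D) f xy = (pi^-1)%:E * \int[leb \x leb]_(xy in D) f xy)%E.
Proof.
move=> mD ifn; have mf := measurable_int _ ifn.
rewrite integralE [in RHS]integralE !ge0_integral_sigma//;
  [|exact: measurable_funeneg|exact: measurable_funepos].
by rewrite [RHS]muleBr//; exact: integrable_add_def ifn.
Qed.

End PlaneMeasure.

(** * Green's formula on discs *)

Section Green.
Variable R : realType.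
Local Notation C := R[i].
Local Notation leb := (@lebesgue_measure R).
Local Notation P := (measurableTypeR R * measurableTypeR R)%type.
Implicit Types (z w : C) (xy : P).

Lemma is_derive_eps (u : R -> R) (x a : R) :
  (forall e, 0 < e -> exists2 d, 0 < d & forall t, `|t| < d ->
     `|u (x + t) - u x - a * t| <= e * `|t|) ->
  is_derive x (1 : R) u a.
Proof.
move=> H; have L : (h^-1 *: (u (h *: (1:R) + x) - u x)) @[h --> (0:R)^'] --> a.
  apply/cvgrPdist_le => e e0; have [d d0 ud] := H _ e0.
  exists d => //= h; rewrite /ball/= sub0r normrN => hd h0.
  have h00 : 0 < `|h| by rewrite normr_gt0.
  rewrite -(ler_pM2r h00) -normrM mulrBl -[_ *: _ * h]mulrC /GRing.scale/=.
  rewrite mulrA mulfV// mul1r mulr1 distrC [h + x]addrC; exact: ud.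
by apply: DeriveDef; [apply/cvg_ex; exists a|exact: cvg_lim].
Qed.

Lemma FTC_vanishing (r : R) (u v : R -> R) : 0 < r ->
  (forall x, - r <= x <= r -> is_derive x (1 : R) u (v x)) ->
  (forall x, - r <= x <= r -> {for x, continuous v}) ->
  u r = 0 -> u (- r) = 0 ->
  (\int[leb]_(x in `](- r)%R, r[) (v x)%:E = 0)%E.
Proof.
move=> r0 uv cv ur uNr.
have rr : - r < r by lra.
have cvw : {within `[- r, r], continuous v}.
  by apply: continuous_in_subspaceT => x /set_mem; rewrite /= in_itv/= => /cv.
have cu x : - r <= x <= r -> {for x, continuous u}.
  by move=> /uv[du _]; exact/differentiable_continuous/derivable1_diffP.
transitivity (\int[leb]_(x in `[(- r)%R, r]) (v x)%:E)%E.
  symmetry; apply: integral_itv_bndoo; apply/measurable_EFinP.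
  apply: measurable_funS (subspace_continuous_measurable_fun _ cvw) => //.
  exact: subset_itv_oo_cc.
rewrite (@continuous_FTC2 _ v u _ _ rr cvw).
- by rewrite ur uNr subee.
- split.
  + by move=> x; rewrite in_itv/= => /andP[h1 h2]; have [|du _] := uv x; [lra|].
  + by apply: cvg_at_right_filter; apply: cu; lra.
  + by apply: cvg_at_left_filter; apply: cu; lra.
- move=> x; rewrite in_itv/= => /andP[h1 h2].
  by have [|du dE] := uv x; [lra|rewrite derive1E].
Qed.

(** With squares, the slices of the disc are explicit. *)
Definition pdisc (s : R) : set P := [set xy | xy.1 ^+ 2 + xy.2 ^+ 2 < s ^+ 2].

Lemma pdiscP (s : R) xy : 0 < s -> pdisc s xy <-> modulus (of_plane xy) < s.
Proof.
move=> s0; rewrite /pdisc /=.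
have -> : (modulus (of_plane xy) < s) = (modulus (of_plane xy) ^+ 2 < s ^+ 2).
  by rewrite ltr_pXn2r// nnegrE ?modulus_ge0// ltW.
by rewrite sqr_modulus.
Qed.

Lemma plane_discE : @plane_disc R = pdisc 1.
Proof. by apply/seteqP; split => xy /(pdiscP xy ltr01). Qed.

Lemma measurable_pdisc (s : R) : measurable (pdisc s).
Proof.
have mf : measurable_fun setT (fun xy : P => xy.1 ^+ 2 + xy.2 ^+ 2).
  by apply: measurable_funD; apply: measurable_funX;
    [exact: measurable_fst|exact: measurable_snd].
have := mf measurableT _ (measurable_itv `]-oo, (s ^+ 2)[); rewrite setTI.
by congr measurable; apply/seteqP; split => xy; rewrite /pdisc /= in_itv.
Qed.

(** The endpoints of a slice lie on the circle, and the closed slice stays in the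
    closed disc, where the functions to be integrated are still defined. *)
Lemma slice_itv (s y : R) : y ^+ 2 < s ^+ 2 -> let r := Num.sqrt (s ^+ 2 - y ^+ 2) in
  [/\ 0 < r, (fun x => x ^+ 2 + y ^+ 2 < s ^+ 2) = `]- r, r[%classic :> set R,
     r ^+ 2 + y ^+ 2 = s ^+ 2 &
     forall x, - r <= x <= r -> x ^+ 2 + y ^+ 2 <= s ^+ 2].
Proof.
move=> ys r; have r0 : 0 < r by rewrite sqrtr_gt0 subr_gt0.
have r2 : r ^+ 2 = s ^+ 2 - y ^+ 2 by rewrite sqr_sqrtr// subr_ge0 ltW.
split => //; last 2 first.
- by rewrite r2 subrK.
- move=> x; rewrite -ler_norml => xr; rewrite -lerBrDr -r2 -[x ^+ 2]real_normK ?num_real//.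
  by rewrite lerXn2r ?nnegrE// ltW.
apply/seteqP; split => x /=; rewrite in_itv/= -ltr_norml -ltrBrDr -r2 -[x ^+ 2]real_normK ?num_real//.
  by rewrite ltr_pXn2r// nnegrE// ltW.
by rewrite ltr_pXn2r// nnegrE// ltW.
Qed.

Lemma integral_pdisc_slices_x (s : R) (h : P -> R) :
  (leb \x leb)%E.-integrable (pdisc s) (EFin \o h) ->
  (forall y, y ^+ 2 < s ^+ 2 ->
    (\int[leb]_(x in (fun x : R => (x ^+ 2 + y ^+ 2 < s ^+ 2)%R)) (h (x, y))%:E = 0)%E) ->
  (\int[leb \x leb]_(xy in pdisc s) (h xy)%:E = 0)%E.
Proof.
move=> ih h0; rewrite integral_mkcond -integral21_prod_meas1; last first.
  by apply/(integrable_mkcond _ (measurable_pdisc s)).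
apply: integral0_eq => y _; rewrite /fubini_G.
have [ys|ys] := ltP (y ^+ 2) (s ^+ 2).
  rewrite -[RHS](h0 _ ys) [RHS]integral_mkcond; apply: eq_integral => x _.
  by rewrite /patch; congr (if _ then _ else _).
apply: integral0_eq => x _; rewrite /patch; case: ifPn => // /set_mem.
rewrite /pdisc /= => xys; exfalso; move: xys ys; have := sqr_ge0 (x : R); lra.
Qed.

Lemma integral_pdisc_slices_y (s : R) (h : P -> R) :
  (leb \x leb)%E.-integrable (pdisc s) (EFin \o h) ->
  (forall x, x ^+ 2 < s ^+ 2 ->
    (\int[leb]_(y in (fun y : R => (y ^+ 2 + x ^+ 2 < s ^+ 2)%R)) (h (x, y))%:E = 0)%E) ->
  (\int[leb \x leb]_(xy in pdisc s) (h xy)%:E = 0)%E.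
Proof.
move=> ih h0; rewrite integral_mkcond -integral12_prod_meas1; last first.
  by apply/(integrable_mkcond _ (measurable_pdisc s)).
apply: integral0_eq => x _; rewrite /fubini_F.
have [xs|xs] := ltP (x ^+ 2) (s ^+ 2).
  rewrite -[RHS](h0 _ xs) [RHS]integral_mkcond; apply: eq_integral => y _.
  rewrite /patch; congr (if _ then _ else _).
  by apply/idP/idP => /set_mem; rewrite /pdisc /= addrC => ?; apply/mem_set.
apply: integral0_eq => y _; rewrite /patch; case: ifPn => // /set_mem.
rewrite /pdisc /= => xys; exfalso; move: xys xs; have := sqr_ge0 (y : R); lra.
Qed.

Lemma leb2_pdisc_lty (s : R) : ((leb \x leb)%E (pdisc s) < +oo)%E.
Proof.
pose Q := (`[- `|s|, `|s|]%classic `*` `[- `|s|, `|s|]%classic : set P).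
have mQ : measurable Q by apply: measurableX; exact: measurable_itv.
apply: (@le_lt_trans _ _ ((leb \x leb)%E Q)).
  apply: le_measure; rewrite ?inE//; first exact: measurable_pdisc.
  move=> [x y]; rewrite /pdisc /= => xys.
  have S : 0 <= `|s| by [].
  by split; rewrite /= in_itv/= -ler_norml -(@ler_pXn2r _ 2)// ?nnegrE//
     !real_normK ?num_real//; have := sqr_ge0 x; have := sqr_ge0 y; lra.
rewrite product_measure1E//= lebesgue_measure_itv/=.
by case: ifP => _; rewrite ?mul0e// -EFinD -EFinM ltry.
Qed.

Lemma sigma_pdisc_lty (s : R) : (@sigma R (pdisc s) < +oo)%E.
Proof.
rewrite /sigma /mscale/= lte_mul_pinfty ?lee_fin ?invpi_ge0//.
exact: leb2_pdisc_lty.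
Qed.

Section GreenFormula.
Variables (U p q : C -> C) (s : R).
Hypotheses (s0 : 0 < s) (s1 : s < 1).
Hypothesis Upq : forall z, disc z -> sdiff U z (p z) (q z).
Hypothesis U0 : forall z, modulus z = s -> U z = 0.

Let sub_disc z : modulus z <= s -> disc z.
Proof. by move=> zs; rewrite /disc /= (le_lt_trans zs). Qed.

Let cU (c : C) : (c = 1 \/ c = 'i) -> forall z, disc z ->
  ccontinuous_at (fun z => c * p z + c^* * q z) z.
Proof.
move=> c1 z zD e e0.
have mc : modulus c = 1.
  by case: c1 => ->; rewrite ?modulus1// modulusE/= expr0n/= expr1n add0r sqrtr1.
have e2 : 0 < e / 2 by rewrite divr_gt0.
have [cp cq] := sdiff_continuous_pq Upq zD.
have [d d0 pd] := cp _ e2; have [d' d'0 qd] := cq _ e2.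
exists (Num.min d d'); first by rewrite lt_min d0.
move=> w; rewrite lt_min => /andP[/pd wp /qd wq].
rewrite (_ : _ - _ = c * (p w - p z) + c^* * (q w - q z)); last by ring.
rewrite (le_lt_trans (ler_modulusD _ _))// !modulusM modulus_conj mc !mul1r.
by rewrite (splitr e) ltrD.
Qed.

Let cint_bounded (f : C -> C) : (forall z, disc z -> ccontinuous_at f z) ->
  exists2 M : R, 0 <= M & forall xy, pdisc s xy -> modulus (f (of_plane xy)) <= M.
Proof.
move=> cf; have [M fM] := @ccontinuous_bounded _ f s (fun z zs => cf z (sub_disc zs)).
exists M; first by rewrite (le_trans (modulus_ge0 _) (fM 0 _))// modulus0 ltW.
by move=> xy /(pdiscP xy s0) xys; apply: fM; exact: ltW.
Qed.

Let cmeas (f : C -> C) : (forall z, disc z -> ccontinuous_at f z) ->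
  cmeasurable (pdisc s) (f \o @of_plane R).
Proof.
move=> cf.
apply: (cmeasurableS (@measurable_plane_disc R)).
  by move=> xy /(pdiscP xy s0) xys; apply: sub_disc; exact: ltW.
exact: ccontinuous_cmeasurable.
Qed.

(** The part L of U (real or imaginary) has derivative L (c p + c^* q) in the
    direction c, and it vanishes at both ends of every slice. *)
Let directional (L : C -> R) (c : C) :
  (forall z w, L (z - w) = L z - L w) -> (forall z, `|L z| <= modulus z) ->
  (forall (t : R) z, L (t%:C * z) = t * L z) -> (c = 1 \/ c = 'i) ->
  forall z (r : R), 0 < r -> (forall x, - r <= x <= r -> modulus (z + x%:C * c) <= s) ->
  modulus (z + r%:C * c) = s -> modulus (z + (- r)%:C * c) = s ->
  (\int[leb]_(x in `](- r)%R, r[)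
     (L (c * p (z + x%:C * c) + c^* * q (z + x%:C * c))%R)%:E = 0)%E.
Proof.
move=> LB Lm LZ c1 z r r0 zr zr1 zr2.
have mc : modulus c = 1.
  by case: c1 => ->; rewrite ?modulus1// modulusE/= expr0n/= expr1n add0r sqrtr1.
have LU0 w : modulus w = s -> L (U w) = 0.
  by move=> /U0 ->; have := LB 0 0; rewrite !subrr.
apply: (@FTC_vanishing r (fun x => L (U (z + x%:C * c)))) => //.
- move=> x /zr/sub_disc zD; apply: is_derive_eps => e e0.
  have [d d0 Ud] := Upq zD e0; exists d => // t td.
  have := Ud (z + (x + t)%:C * c) (z + x%:C * c).
  rewrite (_ : z + (x + t)%:C * c - (z + x%:C * c) = t%:C * c); last first.
    by rewrite rmorphD; ring.
  rewrite subrr modulus0 modulusM modulus_real mc mulr1 => /(_ td d0) h.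
  rewrite [_ * t]mulrC -LZ -!LB (le_trans (Lm _))//.
  move: h; rewrite conjC_M conjC_real; congr (modulus (_ - _) <= _); ring.
- move=> x /zr/sub_disc zD; apply/cvgrPdist_lt => e e0.
  have [d d0 cd] := cU c1 zD e0; exists d => //= t; rewrite /ball/= => xt.
  rewrite -LB (le_lt_trans (Lm _))// modulusB; apply: cd.
  rewrite (_ : z + t%:C * c - _ = (t - x)%:C * c); last by rewrite rmorphB/=; ring.
  by rewrite modulusM mc mulr1 modulus_real distrC.
- exact: LU0.
- exact: LU0.
Qed.

Let integrable_part (f : C -> C) : (forall z, disc z -> ccontinuous_at f z) ->
  cintegrable (@sigma R) (pdisc s) (f \o @of_plane R) /\
  cintegrable (leb \x leb)%E (pdisc s) (f \o @of_plane R).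
Proof.
move=> cf; have [M M0 fM] := cint_bounded cf.
have mP := measurable_pdisc s.
by split; apply: (@le_cintegrable _ _ _ _ _ mP _ (cst M)); rewrite ?fM//;
  [exact: cmeas|exact: integrable_cst_lty (sigma_pdisc_lty s)|
   exact: cmeas|exact: integrable_cst_lty (leb2_pdisc_lty s)].
Qed.

(** The partial derivatives of U are p + q and i (p - q), so that 2 q is the
    first plus i times the second. Each of them integrates to 0 along every
    slice in its direction, because U vanishes at the endpoints. *)
Lemma green : cint (@sigma R) (pdisc s) (q \o @of_plane R) = 0.
Proof.
have i1 : ('i : C) = 1 \/ ('i : C) = 'i by right.
have i2 : (1 : C) = 1 \/ (1 : C) = 'i by left.
have [] := (integrable_part (cU i1), integrable_part (cU i2)).
move=> [iy iy'] [ix ix'].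
have LRe : [/\ forall z w, complex.Re (z - w) = complex.Re z - complex.Re w,
    forall z, `|complex.Re z| <= modulus z &
    forall (t : R) z, complex.Re (t%:C * z) = t * complex.Re z].
  split; [by move=> z w; rewrite cReD cReN|exact: ler_norm_Re|].
  by move=> t z; rewrite cReM/= mul0r subr0.
have LIm : [/\ forall z w, complex.Im (z - w) = complex.Im z - complex.Im w,
    forall z, `|complex.Im z| <= modulus z &
    forall (t : R) z, complex.Im (t%:C * z) = t * complex.Im z].
  split; [by move=> z w; rewrite cImD cImN|exact: ler_norm_Im|].
  by move=> t z; rewrite cImM/= mul0r addr0.
have mod_le (a b : R) : a ^+ 2 + b ^+ 2 <= s ^+ 2 -> modulus (a +i* b) <= s.
  by move=> h; rewrite -(@ler_pXn2r _ 2)// ?nnegrE ?modulus_ge0 ?sqr_modulus// ltW.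
have mod_eq (a b : R) : a ^+ 2 + b ^+ 2 = s ^+ 2 -> modulus (a +i* b) = s.
  by move=> h; rewrite modulusE/= h sqrtr_sqr ger0_norm// ltW.
have Gx (L : C -> R) :
   [/\ forall z w, L (z - w) = L z - L w, forall z, `|L z| <= modulus z &
       forall (t : R) z, L (t%:C * z) = t * L z] ->
   (leb \x leb)%E.-integrable (pdisc s) (EFin \o (fun xy =>
      L (1 * p (of_plane xy) + 1^* * q (of_plane xy)))) ->
   \int[@sigma R]_(xy in pdisc s) L (1 * p (of_plane xy) + 1^* * q (of_plane xy)) = 0.
  move=> [LB Lm LZ] iL; rewrite /Rintegral integral_sigma//; last exact: measurable_pdisc.
  rewrite integral_pdisc_slices_x ?mule0// => y /slice_itv[r0 -> r2 rle].
  set r := Num.sqrt _ in r0 r2 rle *.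
  have E (x : R) : (0 +i* y) + x%:C * 1 = x +i* y by apply: complexP => /=; ring.
  under eq_integral do rewrite /of_plane /= -E.
  apply: directional => // [x /rle xs||]; rewrite E; [exact: mod_le|exact: mod_eq|].
  by apply: mod_eq; rewrite sqrrN.
have Gy (L : C -> R) :
   [/\ forall z w, L (z - w) = L z - L w, forall z, `|L z| <= modulus z &
       forall (t : R) z, L (t%:C * z) = t * L z] ->
   (leb \x leb)%E.-integrable (pdisc s) (EFin \o (fun xy =>
      L ('i * p (of_plane xy) + 'i^* * q (of_plane xy)))) ->
   \int[@sigma R]_(xy in pdisc s) L ('i * p (of_plane xy) + 'i^* * q (of_plane xy)) = 0.
  move=> [LB Lm LZ] iL; rewrite /Rintegral integral_sigma//; last exact: measurable_pdisc.
  rewrite integral_pdisc_slices_y ?mule0// => x /slice_itv[r0 -> r2 rle].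
  set r := Num.sqrt _ in r0 r2 rle *.
  have E (y : R) : (x +i* 0) + y%:C * 'i = x +i* y by apply: complexP => /=; ring.
  under eq_integral do rewrite /of_plane /= -E.
  apply: directional => // [y /rle ys||]; rewrite E; [|apply: mod_eq|apply: mod_eq].
  - by apply: mod_le; rewrite addrC.
  - by rewrite addrC.
  - by rewrite sqrrN addrC.
have X0 : cint (@sigma R) (pdisc s)
    ((fun z => 1 * p z + 1^* * q z) \o @of_plane R) = 0.
  by apply: complexP; rewrite /=; [apply: Gx LRe _|apply: Gx LIm _]; case: ix'.
have Y0 : cint (@sigma R) (pdisc s)
    ((fun z => 'i * p z + 'i^* * q z) \o @of_plane R) = 0.
  by apply: complexP; rewrite /=; [apply: Gy LRe _|apply: Gy LIm _]; case: iy'.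
have mP := measurable_pdisc s.
have := cintD mP ix (cintegrableZ mP 'i iy).
rewrite cintZ// X0 Y0 mulr0 addr0.
have ii : ('i : C) * 'i = -1 by rewrite -expr2 sqr_i.
have ci : ('i : C)^* = - 'i by apply: complexP; rewrite cRe_conj + rewrite cIm_conj; rewrite /= ?oppr0.
have qE xy : 1 * p (of_plane xy) + 1^* * q (of_plane xy) +
    'i * ('i * p (of_plane xy) + 'i^* * q (of_plane xy)) = 2%:R * q (of_plane xy).
  rewrite conjC_1 ci mulrDr !mulrA ii mulrN ii; ring.
under eq_cint do rewrite /= qE.
rewrite cintZ//; last first.
  by have [] := integrable_part (fun z zD => proj2 (sdiff_continuous_pq Upq zD)).
by move=> /eqP; rewrite mulf_eq0 pnatr_eq0 /= => /eqP.
Qed.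

End GreenFormula.
End Green.

(** * The area of the unit disc *)

Section Reproducing.
Variable R : realType.
Local Notation C := R[i].
Local Notation leb := (@lebesgue_measure R).
Local Notation P := (measurableTypeR R * measurableTypeR R)%type.
Implicit Types (z w : C) (xy : P).

(** The primitive of 2 sqrt (1 - y^2): the second term is asin y, written so
    that it is visibly continuous up to the endpoints. *)
Definition disc_area_primitive (y : R) : R :=
  y * Num.sqrt (1 - y ^+ 2) + 2 * atan (y / (1 + Num.sqrt (1 - y ^+ 2))).

Lemma is_derive_disc_area_primitive (y : R) : -1 < y < 1 ->
  is_derive y (1 : R) disc_area_primitive (2 * Num.sqrt (1 - y ^+ 2)).
Proof.
move=> y1; have y2 : 0 < 1 - y ^+ 2.
  by rewrite (_ : 1 - _ = (1 - y) * (1 + y)); [rewrite mulr_gt0//; lra|ring].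
set s := Num.sqrt (1 - y ^+ 2).
have s0 : 0 < s by rewrite sqrtr_gt0.
have s2 : s ^+ 2 = 1 - y ^+ 2 by rewrite sqr_sqrtr// ltW.
have ds : is_derive y (1 : R) (fun y => Num.sqrt (1 - y ^+ 2)) (- y / s).
  have dq : is_derive y (1 : R) (fun y : R => 1 - y ^+ 2) (- (2 * y)).
    by apply: is_derive_eq; rewrite /GRing.scale/=; ring.
  have dr := is_derive1_sqrt y2.
  have := @is_derive1_comp _ (@Num.sqrt R) (fun y => 1 - y ^+ 2) y _ _ dr dq.
  by move/is_derive_eq; apply; rewrite -/s; field; exact: lt0r_neq0.
have s10 : 1 + s != 0 by apply: lt0r_neq0; lra.
have dg : is_derive y (1 : R) (fun y => y / (1 + Num.sqrt (1 - y ^+ 2))) (s * (1 + s))^-1.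
  have d1 : is_derive y (1 : R) (fun y => 1 + Num.sqrt (1 - y ^+ 2)) (0 + - y / s).
    exact: is_deriveD.
  have d2 := @is_deriveV _ (fun y => 1 + Num.sqrt (1 - y ^+ 2)) y _ 1 s10 d1.
  have := @is_deriveM _ _ id _ y _ _ _ (is_derive_id _ _) d2.
  move/is_derive_eq; apply; rewrite /GRing.scale/= -/s !mulr1.
  have -> : y * (- (1 + s) ^- 2 * (0 + - y / s)) = y ^+ 2 / (s * (1 + s) ^+ 2).
    by field; rewrite s10 lt0r_neq0.
  rewrite (_ : y ^+ 2 = 1 - s ^+ 2); last by rewrite s2; ring.
  by field; rewrite s10 lt0r_neq0.
have da : is_derive y (1 : R) (fun y => atan (y / (1 + Num.sqrt (1 - y ^+ 2)))) (2 * s)^-1.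
  have da := is_derive1_atan (y / (1 + s)).
  have := @is_derive1_comp _ (@atan R) (fun y => y / (1 + Num.sqrt (1 - y ^+ 2))) y _ _ da dg.
  move/is_derive_eq; apply; rewrite -/s.
  have -> : 1 + (y / (1 + s)) ^+ 2 = 2 / (1 + s).
    rewrite expr_div_n (_ : y ^+ 2 = 1 - s ^+ 2); last by rewrite s2; ring.
    by field.
  by field; rewrite s10 lt0r_neq0.
have := is_deriveD (@is_deriveM _ _ id _ y _ _ _ (is_derive_id _ _) ds)
  (@is_deriveZ _ _ _ _ 2 _ _ _ da).
move/is_derive_eq; apply; rewrite /GRing.scale/= -/s.
have -> : y * (- y / s) = (s ^+ 2 - 1) / s by rewrite s2; field; exact: lt0r_neq0.
by field; exact: lt0r_neq0.
Qed.

Lemma integral_semicircle :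
  (\int[leb]_(y in `](- 1)%R, 1%R[) (2 * Num.sqrt (1 - y ^+ 2))%:E = pi%:E)%E.
Proof.
have cs (y : R) : {for y, continuous (fun y : R => Num.sqrt (1 - y ^+ 2))}.
  apply: (@continuous_comp _ _ _ (fun y : R => 1 - y ^+ 2) Num.sqrt).
    by apply: cvgB; [exact: cvg_cst|exact: exprn_continuous].
  exact: sqrt_continuous.
have cg (y : R) : {for y, continuous (fun y : R => y / (1 + Num.sqrt (1 - y ^+ 2)))}.
  apply: cvgM; first exact: cvg_id.
  apply: cvgV; first by rewrite gt_eqF// ltr_pwDl// sqrtr_ge0.
  by apply: cvgD; [exact: cvg_cst|exact: cs].
have ca (y : R) : {for y, continuous (fun y : R => atan (y / (1 + Num.sqrt (1 - y ^+ 2))))}.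
  exact: (@continuous_comp _ _ _ (fun y : R => y / (1 + Num.sqrt (1 - y ^+ 2)))
    (@atan R) y (cg y) (@continuous_atan R _)).
have cF (y : R) : {for y, continuous disc_area_primitive}.
  apply: cvgD; first by apply: cvgM; [exact: cvg_id|exact: cs].
  by apply: cvgM; [exact: cvg_cst|exact: ca].
have cf : continuous (fun y : R => 2 * Num.sqrt (1 - y ^+ 2)).
  by move=> y; apply: cvgM; [exact: cvg_cst|exact: cs].
have N11 : -1 < 1 :> R by lra.
transitivity (\int[leb]_(y in `[(- 1)%R, 1%R]) (2 * Num.sqrt (1 - y ^+ 2))%:E)%E.
  symmetry; apply: integral_itv_bndoo; apply/measurable_EFinP.
  by apply: measurable_funS (continuous_measurable_fun cf).
rewrite (@continuous_FTC2 _ _ disc_area_primitive _ _ N11).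
- rewrite /disc_area_primitive sqrrN expr1n subrr sqrtr0 !mulr0 addr0 !divr1 atanN atan1.
  by rewrite -EFinB; congr EFin; field.
- exact: continuous_subspaceT.
- split.
  + by move=> y; rewrite in_itv/= => /is_derive_disc_area_primitive[].
  + by apply: cvg_at_right_filter; exact: cF.
  + by apply: cvg_at_left_filter; exact: cF.
- move=> y; rewrite in_itv/= => /is_derive_disc_area_primitive[_ dE].
  by rewrite derive1E.
Qed.

Lemma sigma_plane_disc : (@sigma R (@plane_disc R) = 1)%E.
Proof.
rewrite plane_discE /sigma /mscale/= /product_measure1.
transitivity ((pi^-1)%:E * \int[leb]_(y in `](- 1)%R, 1%R[) (2 * Num.sqrt (1 - y ^+ 2))%:E)%E; last first.
  by rewrite integral_semicircle -EFinM mulVf// gt_eqF// pi_gt0.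
congr (_ * _)%E; rewrite [RHS]integral_mkcond; apply: eq_integral => x _.
rewrite patchE /=.
have secE : xsection (pdisc 1) x = (fun y : R => y ^+ 2 + x ^+ 2 < 1 ^+ 2).
  by apply/seteqP; split => y; rewrite /xsection /= ?inE /pdisc /= addrC.
rewrite secE; case: ifPn => [/set_mem|xN].
  rewrite /= in_itv/= => x1; have x2 : x ^+ 2 < 1 ^+ 2.
    by rewrite expr1n -[x ^+ 2]real_normK ?num_real// expr_lt1// ltr_norml.
  have [r0 -> _ _] := slice_itv x2; rewrite lebesgue_measure_itv/= lte_fin.
  rewrite ifT; last by lra.
  by rewrite -EFinB opprK expr1n mulr_natl.
rewrite (_ : (fun y : R => _) = set0) ?measure0//.
apply/seteqP; split => // y /=; rewrite expr1n => h.
move: xN; rewrite notin_setE /= in_itv/= -ltr_norml => /negP; rewrite -leNgt => x1.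
have : 1 <= x ^+ 2 by rewrite -[x ^+ 2]real_normK ?num_real// exprn_ege1.
by have := sqr_ge0 y; lra.
Qed.

End Reproducing.

(** * Kernel integrals that vanish *)

Section ReproducingFormula.
Variable R : realType.
Local Notation C := R[i].
Local Notation P := (measurableTypeR R * measurableTypeR R)%type.
Local Notation sig := (@sigma R).
Local Notation D := (@plane_disc R).
Implicit Types (z w : C) (xy : P).

Lemma integrable_disc_cst (M : R) : sig.-integrable D (EFin \o cst M).
Proof.
have sy : (sig D < +oo)%E by rewrite sigma_plane_disc ltry.
exact: integrable_cst_lty (@measurable_plane_disc R) sy.
Qed.

Lemma cintegrable_disc_cst (c : C) : cintegrable sig D (fun=> c).
Proof. by split; exact: integrable_disc_cst. Qed.

Lemma cint_disc_cst (c : C) : cint sig D (fun=> c) = c.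
Proof.
have mD := @measurable_plane_disc R.
have E (r : R) : \int[sig]_(_ in D) r = r.
  transitivity (r * fine (sig D)); first exact: Rintegral_cst.
  by rewrite sigma_plane_disc mulr1.
by apply: complexP; exact: E.
Qed.

Lemma cmeasurable_analytic (f : C -> C) : analytic_on_disc f ->
  cmeasurable D (f \o @of_plane R).
Proof.
move=> fa; apply: ccontinuous_cmeasurable => z zD.
by have [a /sdiff_continuous] := analytic_sdiff fa zD.
Qed.

(** The kernel of the disc of radius s, times f - f(z), is the
    conj(w)-derivative of g(w) (|w|^2 - s^2) / (s^2 - conj(w) z), where g is the
    divided difference of f at z. That function vanishes on the circle |w| = s. *)
Lemma cint_pdisc_kernel (f : C -> C) z (s : R) :
  analytic_on_disc f -> disc z -> 0 < s -> s < 1 -> modulus z < s ^+ 2 ->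
  cint sig (pdisc s) (fun xy => (s ^+ 2)%:C * (f (of_plane xy) - f z) /
    ((s ^+ 2)%:C - (of_plane xy)^* * z) ^+ 2) = 0.
Proof.
move=> fa zD s0 s1 zs.
have [g [gE gs]] := analytic_divided_difference fa zD.
pose K w := (s ^+ 2)%:C - w^* * z.
pose q w := (s ^+ 2)%:C * (f w - f z) / (K w) ^+ 2.
pose U w := g w * ((w * w^* - (s ^+ 2)%:C) * (K w)^-1).
have K0 w : disc w -> K w != 0.
  rewrite /disc /= => wD; rewrite -modulus_gt0.
  have := ler_modulusB (s ^+ 2)%:C (w^* * z).
  rewrite modulus_real ger0_norm ?sqr_ge0// -/(K w) modulusM modulus_conj.
  have : modulus w * modulus z <= modulus z by rewrite ler_piMl ?modulus_ge0// ltW.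
  by move=> h1 h2; move: zs h1 h2; move: (s ^+ 2) => t; lra.
have dU w : exists p : C, disc w -> sdiff U w p (q w).
  have [wD|wD] := pselect (disc w); last by exists 0.
  have [b gb] := gs _ wD.
  have dc := sdiff_conj (sdiff_id w).
  have d1 := sdiffD (sdiffM (sdiff_id w) dc) (sdiff_cst (- (s ^+ 2)%:C) w).
  have d2 := sdiffD (sdiff_cst ((s ^+ 2)%:C) w) (sdiffM dc (sdiff_cst (- z) w)).
  have d2' : sdiff K w 0 (- z).
    have e0 : 0 + ((0 : C)^* * - z + w^* * 0) = 0 by rewrite rmorph0; ring.
    have e1 : 0 + ((1 : C)^* * - z + w^* * 0) = - z by rewrite rmorph1; ring.
    have := @sdiff_eq_near _ (fun u => (s ^+ 2)%:C + u^* * - z) K w _ _ _ d2.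
    rewrite e0 e1; apply.
    exists 1 => // u _.
    by rewrite /K mulrN.
  have d3 := sdiffM d1 (sdiffV (K0 _ wD) d2').
  have d4 := sdiffM gb d3.
  move: d4; set p4 := (X in sdiff _ _ X _); set q4 := (X in sdiff _ _ _ X) => d4.
  exists p4 => _; suff -> : q w = q4 by exact: d4.
  rewrite /q4 /q gE conjC_1 !(mul0r, mulr0, mulr1, mul1r, add0r, addr0).
  by have := K0 _ wD; rewrite /K; move: ((s ^+ 2)%:C) (w^*) => S v k0; field.
have [p Up] := choice dU.
rewrite -(@green R U p q s)//.
move=> w ws; rewrite /U mul_conjC ws subrr mul0r mulr0 //.
Qed.

(** The radius s tends to 1 in the previous identity: with 2 m = 1 - |z|, the
    denominators stay at least m in modulus, which dominates the integrands and
    bounds their distance to the limit. *)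
Lemma cint_disc_kernel (f : C -> C) z : analytic_on_disc f -> disc z ->
  cintegrable sig D (f \o @of_plane R) ->
  cint sig D (fun xy => (f (of_plane xy) - f z) / (1 - (of_plane xy)^* * z) ^+ 2) = 0.
Proof.
move=> fa zD fi; have mD := @measurable_plane_disc R.
have z1 : modulus z < 1 := zD.
have z0 := modulus_ge0 z.
pose m := (1 - modulus z) / 2.
have m0 : 0 < m by rewrite divr_gt0// subr_gt0.
have mE : 1 - modulus z = 2 * m by rewrite /m; field.
clearbody m.
pose s (n : nat) : R := 1 - m / 2 * n.+1%:R^-1.
have n01 (n : nat) : (0 < n.+1%:R^-1 :> R) && (n.+1%:R^-1 <= 1 :> R).
  by rewrite invr_gt0 invf_le1 ?ltr0Sn ?ler1n.
have sb n : [/\ 0 < s n, s n < 1, m <= (s n) ^+ 2 - modulus z & modulus z < (s n) ^+ 2].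
  have /andP[i0 i1] := n01 n; rewrite /s; move: (n.+1%:R^-1) i0 i1 => i i0 i1.
  have mi : 0 < m / 2 * i by rewrite mulr_gt0// divr_gt0.
  have mi1 : m / 2 * i <= m / 2 by rewrite ler_piMr// divr_ge0// ltW.
  have m1 : m <= 1 / 2 by lra.
  have sq : 1 - m <= (1 - m / 2 * i) ^+ 2.
    move: mi1; set x := m / 2 * i => mi1.
    rewrite (_ : (1 - x) ^+ 2 = 1 - 2 * x + x ^+ 2); last by ring.
    by have := sqr_ge0 x; lra.
  by split; move: sq; move: ((1 - m / 2 * i) ^+ 2) => t; lra.
pose h xy := modulus (f (of_plane xy)) + modulus (f z).
have hi : sig.-integrable D (EFin \o (fun xy => m ^- 2 * h xy)).
  have i1 := integrableD mD (integrable_modulus mD fi) (integrable_disc_cst (modulus (f z))).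
  exact: (integrableZl mD (m ^- 2) i1).
pose q n xy := ((s n) ^+ 2)%:C * (f (of_plane xy) - f z) /
    (((s n) ^+ 2)%:C - (of_plane xy)^* * z) ^+ 2.
(* the integrand on the disc of radius s n, extended by 0 to the unit disc *)
pose F n xy : C := if xy \in pdisc (s n) then q n xy else 0.
pose l xy := (f (of_plane xy) - f z) / (1 - (of_plane xy)^* * z) ^+ 2.
have Kn n xy : D xy -> m <= modulus (((s n) ^+ 2)%:C - (of_plane xy)^* * z).
  move=> Dxy; have [sn0 _ msn _] := sb n.
  have := ler_modulusB ((s n) ^+ 2)%:C ((of_plane xy)^* * z).
  rewrite modulus_real ger0_norm ?sqr_ge0// modulusM modulus_conj.
  have : modulus (of_plane xy) * modulus z <= modulus z.
    by rewrite ler_piMl//; exact: ltW.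
  by lra.
have K1 xy : D xy -> m <= modulus (1 - (of_plane xy)^* * z).
  move=> Dxy; have c1 : modulus (of_plane xy)^* <= 1 by rewrite modulus_conj; exact: ltW.
  have [h1 _] := kernel_neq0 c1 z1; rewrite (le_trans _ h1)//; lra.
have mfz : cmeasurable D (fun xy => f (of_plane xy) - f z).
  apply: cmeasurableD; first exact: cmeasurable_analytic.
  exact: cmeasurable_cst.
have mop : cmeasurable D (@of_plane R).
  exact: (cmeasurableS measurableT (@subsetT _ D) (cmeasurable_of_plane R)).
have mq n : cmeasurable D (q n).
  apply: cmeasurableM; first by apply: cmeasurableM => //; exact: cmeasurable_cst.
  apply: cmeasurableV; apply: cmeasurableX; apply: cmeasurableD.
    exact: cmeasurable_cst.
  apply: cmeasurableN; apply: cmeasurableM; last exact: cmeasurable_cst.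
  exact: cmeasurable_conj.
have FE n : F n = fun xy => (\1_(pdisc (s n)) xy : R)%:C * q n xy.
  apply/funext => xy; rewrite /F indicE; case: (xy \in _); rewrite ?mul1r ?mul0r//.
have mF n : cmeasurable D (F n).
  rewrite FE; apply: cmeasurableM => //; apply: cmeasurable_real.
  have mi : measurable_fun setT (\1_(pdisc (s n)) : P -> R).
    by apply: measurable_indic; exact: measurable_pdisc.
  exact: (measurable_funS measurableT (@subsetT _ D) mi).
have F0 n : cint sig D (F n) = 0.
  have [s0 s1 _ zs] := sb n; rewrite -(cint_pdisc_kernel fa zD s0 s1 zs).
  have sD : pdisc (s n) = D `&` pdisc (s n) :> set P.
    apply/seteqP; split => xy; last by case.
    move=> xys; split => //; rewrite /plane_disc /disc /=.
    by move/(pdiscP xy s0): xys => /lt_trans; apply.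
  rewrite /cint; apply: complexP => /=; rewrite [in RHS]sD Rintegral_mkcondr;
    apply: eq_Rintegral => xy _; rewrite patchE /F; by case: ifP.
have Fh n xy : D xy -> modulus (F n xy) <= m ^- 2 * h xy.
  move=> Dxy; have h0 : 0 <= m ^- 2 * h xy.
    by rewrite mulr_ge0 ?invr_ge0 ?exprn_ge0 ?addr_ge0 ?modulus_ge0// ltW.
  rewrite /F; case: ifP => _; last by rewrite modulus0.
  rewrite /q !modulusM modulusV modulusX modulus_real ger0_norm ?sqr_ge0//.
  have [s0 s1 _ _] := sb n.
  have a1 : modulus (((s n) ^+ 2)%:C - (of_plane xy)^* * z) ^- 2 <= m ^- 2.
    rewrite lef_pV2 ?posrE ?exprn_gt0 ?(lt_le_trans m0 (Kn n _ Dxy))//.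
    by rewrite lerXn2r ?nnegrE ?modulus_ge0 ?(ltW m0)//; exact: Kn.
  have a2 : (s n) ^+ 2 * modulus (f (of_plane xy) - f z) <= h xy.
    rewrite (@le_trans _ _ (modulus (f (of_plane xy) - f z)))//.
      by rewrite ler_piMl ?modulus_ge0// expr_le1 ?ltW.
    by rewrite (le_trans (ler_modulusD _ _))// modulusN.
  rewrite mulrC; apply: ler_pM => //.
  - by rewrite invr_ge0 exprn_ge0// modulus_ge0.
  - by rewrite mulr_ge0 ?modulus_ge0// exprn_ge0// ltW.
have cs0 : 1 - s n @[n --> \oo] --> (0 : R).
  rewrite -(mulr0 (m / 2)).
  under eq_fun do rewrite /s opprB addrC subrK.
  by apply: cvgM; [exact: cvg_cst|exact: cvg_harmonic].
have Fl xy : D xy -> modulus (F n xy - l xy) @[n --> \oo] --> (0 : R).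
  move=> Dxy; set c := (of_plane xy)^* * z.
  have c1 : modulus c <= 1.
    rewrite /c modulusM modulus_conj -[leRHS]mulr1 ler_pM ?modulus_ge0 ?(ltW z1)//.
    exact: ltW.
  have g0 : modulus (f (of_plane xy) - f z) * (8 / m ^+ 4) * (1 - s n) @[n --> \oo] --> (0 : R).
    rewrite -[X in _ --> X](mulr0 (modulus (f (of_plane xy) - f z) * (8 / m ^+ 4))).
    by apply: cvgM => //; exact: cvg_cst.
  have c0 : 0 @[n --> \oo] --> (0 : R) by exact: cvg_cst.
  apply: (squeeze_cvgr _ c0 g0).
  have r0 : 0 < 1 - modulus (of_plane xy) by rewrite subr_gt0.
  have /cvgrPdist_lt/(_ _ r0) := cs0; apply: filterS => n.
  rewrite sub0r normrN => sn; rewrite modulus_ge0 /=.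
  have [sn0 sn1 _ _] := sb n.
  have xys : pdisc (s n) xy.
    by apply/(pdiscP xy sn0); move: sn; rewrite gtr0_norm ?subr_gt0//; lra.
  rewrite /F (@mem_set _ (pdisc (s n)) xy)// /q /l -/c.
  have k0 : ((s n) ^+ 2)%:C - c != 0.
    by rewrite -modulus_gt0 (lt_le_trans m0)//; exact: Kn.
  have k1 : 1 - c != 0 by rewrite -modulus_gt0 (lt_le_trans m0)//; exact: K1.
  pose S : C := (s n)%:C.
  have SE : ((s n) ^+ 2)%:C = S ^+ 2 by rewrite rmorphXn.
  rewrite SE in k0 *.
  rewrite (_ : _ - _ = (f (of_plane xy) - f z) * ((1 - S) * ((S + c) *
    (S * (1 - c) + (S ^+ 2 - c))) / ((S ^+ 2 - c) ^+ 2 * (1 - c) ^+ 2))); last first.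
    by field; rewrite k0 k1.
  rewrite modulusM -[leRHS]mulrA ler_wpM2l ?modulus_ge0//.
  have mS : modulus S <= 1 by rewrite modulus_real ger0_norm ltW.
  have m1S : modulus (1 - S) = 1 - s n.
    by rewrite -[1]/(1%:C) -rmorphB modulus_real ger0_norm// subr_ge0 ltW.
  rewrite -[X in modulus X]mulrA modulusM m1S [leRHS]mulrC ler_wpM2l ?subr_ge0 ?(ltW sn1)//.
  rewrite modulusM modulusV (modulusM (S + c)) (modulusM ((S ^+ 2 - c) ^+ 2)).
  have n1 : modulus (S + c) <= 2 by rewrite (le_trans (ler_modulusD _ _))//; lra.
  have n2 : modulus (S * (1 - c) + (S ^+ 2 - c)) <= 4.
    rewrite (le_trans (ler_modulusD _ _))// modulusM.
    have a1 : modulus (1 - c) <= 2.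
      by rewrite (le_trans (ler_modulusD _ _))// modulus1 modulusN; lra.
    have a2 : modulus (S ^+ 2 - c) <= 2.
      rewrite (le_trans (ler_modulusD _ _))// modulusN modulusX.
      have : modulus S ^+ 2 <= 1 by rewrite expr_le1// modulus_ge0.
      by lra.
    have : modulus S * modulus (1 - c) <= 1 * 2 by rewrite ler_pM// modulus_ge0.
    by lra.
  apply: ler_pM.
  - by rewrite mulr_ge0 ?modulus_ge0.
  - by rewrite invr_ge0 mulr_ge0 ?modulus_ge0.
  - by rewrite (_ : 8 = 2 * 4 :> R); [rewrite ler_pM// modulus_ge0|ring].
  have k0' : m <= modulus (S ^+ 2 - c) by rewrite -SE; exact: Kn.
  have k1' : m <= modulus (1 - c) by exact: K1.
  have A0 := lt_le_trans m0 k0'; have B0 := lt_le_trans m0 k1'.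
  have sqle (x : R) : m <= x -> m ^+ 2 <= x ^+ 2.
    by move=> mx; rewrite lerXn2r// nnegrE ?(ltW m0)// (le_trans (ltW m0)).
  rewrite !modulusX lef_pV2 ?posrE ?mulr_gt0 ?exprn_gt0//.
  rewrite (_ : m ^+ 4 = m ^+ 2 * m ^+ 2); last by ring.
  by rewrite ler_pM ?sqle// exprn_ge0// ltW.
have [cRe cIm] : (complex.Re (cint sig D (F n)) @[n --> \oo] --> complex.Re (cint sig D l)) /\
    (complex.Im (cint sig D (F n)) @[n --> \oo] --> complex.Im (cint sig D l)).
  exact: (@cint_dominated _ _ R sig D mD F l _ mF hi Fh Fl).
have F0Re : (fun n => complex.Re (cint sig D (F n))) = (fun=> 0).
  by apply/funext => n; exact: (congr1 (@complex.Re R) (F0 n)).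
have F0Im : (fun n => complex.Im (cint sig D (F n))) = (fun=> 0).
  by apply/funext => n; exact: (congr1 (@complex.Im R) (F0 n)).
rewrite F0Re in cRe; rewrite F0Im in cIm.
apply: complexP.
- by apply: (cvg_unique (@Rhausdorff R) cRe); exact: cvg_cst.
- by apply: (cvg_unique (@Rhausdorff R) cIm); exact: cvg_cst.
Qed.

End ReproducingFormula.

(** * The reproducing formula *)

Section KernelIntegrals.
Variable R : realType.
Local Notation C := R[i].
Local Notation P := (measurableTypeR R * measurableTypeR R)%type.
Local Notation sig := (@sigma R).
Local Notation D := (@plane_disc R).
Implicit Types (z w : C) (xy : P) (f : C -> C).

Definition bkernel z w : C := ((1 - w^* * z) ^+ 2)^-1.

Lemma kernel_conj z w : (bkernel z w)^* = bkernel w z.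
Proof.
rewrite /bkernel conjC_V conjC_X conjC_D conjC_N conjC_M conjC_K conjC_1.
by rewrite [w * _]mulrC.
Qed.

Lemma modulus_kernel_le z w : disc z -> disc w ->
  modulus (bkernel z w) <= (1 - modulus z) ^- 2.
Proof.
rewrite /disc /= => z1 w1; have w1' : modulus w^* <= 1 by rewrite modulus_conj ltW.
have [h nz] := kernel_neq0 w1' z1.
rewrite /bkernel modulusV modulusX lef_pV2 ?posrE ?exprn_gt0 ?modulus_gt0 ?subr_gt0//.
by rewrite lerXn2r ?nnegrE ?modulus_ge0// subr_ge0 ltW.
Qed.

Lemma cmeasurable_of_plane_disc : cmeasurable D (@of_plane R).
Proof. exact: (cmeasurableS measurableT (@subsetT _ D) (cmeasurable_of_plane R)). Qed.

Lemma cmeasurable_kernel z : cmeasurable D (fun xy => bkernel z (of_plane xy)).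
Proof.
apply: cmeasurableV; apply: cmeasurableX; apply: cmeasurableD.
  exact: cmeasurable_cst.
apply: cmeasurableN; apply: cmeasurableM; last exact: cmeasurable_cst.
by apply: cmeasurable_conj; exact: cmeasurable_of_plane_disc.
Qed.

Lemma cintegrable_mul_bounded (g k : P -> C) (M : R) :
  cintegrable sig D g -> cmeasurable D k ->
  (forall xy, D xy -> modulus (k xy) <= M) ->
  cintegrable sig D (fun xy => g xy * k xy).
Proof.
move=> ig mk kM; have mD := @measurable_plane_disc R.
have im := integrableZl mD M (integrable_modulus mD ig).
apply: (@le_cintegrable _ _ _ _ _ mD _ (fun xy => M * modulus (g xy))) => //.
  by apply: cmeasurableM => //; exact: cintegrable_measurable ig.
by move=> xy Dxy; rewrite modulusM mulrC ler_wpM2r ?modulus_ge0// kM.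
Qed.

Lemma cintegrable_mul_kernel (g : P -> C) z : disc z -> cintegrable sig D g ->
  cintegrable sig D (fun xy => g xy * bkernel z (of_plane xy)).
Proof.
move=> zD ig; apply: cintegrable_mul_bounded ig (cmeasurable_kernel z) _.
by move=> xy Dxy; exact: modulus_kernel_le.
Qed.

Lemma cintegrable_kernel z : disc z ->
  cintegrable sig D (fun xy => bkernel z (of_plane xy)).
Proof.
move=> zD; have := cintegrable_mul_kernel zD (cintegrable_disc_cst (1 : C)).
by apply: (eq_cintegrable (@measurable_plane_disc R)) => xy _; rewrite mul1r.
Qed.

(** The mean value property at 0 of the analytic function w |-> conj(K(z, w)),
    whose value there is 1. *)
Lemma cint_kernel z : disc z -> cint sig D (fun xy => bkernel z (of_plane xy)) = 1.
Proof.
move=> zD; have mD := @measurable_plane_disc R.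
have D0 : disc (0 : C) by rewrite /disc /= modulus0.
have z1 : modulus z^* <= 1 by rewrite modulus_conj; exact: ltW.
pose f w : C := ((1 - z^* * w) ^+ 2)^-1.
have fE w : f w = (bkernel z w)^*.
  by rewrite kernel_conj.
have fa : analytic_on_disc f := analytic_kernel z1.
have fi : cintegrable sig D (f \o @of_plane R).
  apply: (@eq_cintegrable _ _ _ _ _ mD (fun xy => (bkernel z (of_plane xy))^*)).
    by move=> xy _ /=; rewrite fE.
  exact: (cintegrable_conj mD (cintegrable_kernel zD)).
have f0 : f 0 = 1 by rewrite /f mulr0 subr0 expr1n invr1.
have := cint_disc_kernel fa D0 fi; rewrite f0.
rewrite (@eq_cint _ _ _ _ _ _ (fun xy => (f \o @of_plane R) xy + -1)); last first.
  by move=> xy _; rewrite mulr0 subr0 expr1n divr1.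
rewrite cintD//; last exact: cintegrable_disc_cst.
rewrite cint_disc_cst => /eqP; rewrite subr_eq0 => /eqP f1.
rewrite -[RHS]conjC_1 -f1 -(cint_conj mD fi).
by apply: eq_cint => xy _; rewrite /= fE conjC_K.
Qed.

(** In f = f(z) + (f - f(z)) the second term integrates to 0 against the kernel,
    and the kernel has integral 1. *)
Theorem reproducing f z : analytic_on_disc f -> disc z ->
  cintegrable sig D (f \o @of_plane R) ->
  cint sig D (fun xy => f (of_plane xy) * bkernel z (of_plane xy)) = f z.
Proof.
move=> fa zD fi; have mD := @measurable_plane_disc R.
have i1 := cintegrable_mul_kernel zD fi.
have i2 := cintegrableZ mD (- f z) (cintegrable_kernel zD).
have := cint_disc_kernel fa zD fi.
rewrite (@eq_cint _ _ _ _ _ _ (fun xy =>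
   (f \o @of_plane R) xy * bkernel z (of_plane xy) + - f z * bkernel z (of_plane xy))).
  rewrite cintD// cintZ ?cint_kernel//; last exact: cintegrable_kernel.
  by move=> /eqP; rewrite mulr1 subr_eq0 => /eqP.
by move=> xy _; rewrite -mulrDl.
Qed.

End KernelIntegrals.

(** * One-dimensional integral bounds *)

Section OneDimensionalBounds.
Variable R : realType.
Local Notation leb := (@lebesgue_measure R).

(** The function may be unbounded near the endpoints: closed subintervals exhaust
    the open interval, and the integrals over them converge monotonically. *)
Lemma ge0_integral_le_primitive (l r B : R) (g G : R -> R) : l < r ->
  (forall x, l < x < r -> 0 <= g x) ->
  (forall x, l < x < r -> {for x, continuous g}) ->
  (forall x, l < x < r -> is_derive x (1 : R) G (g x)) ->
  (forall x y, l < x < r -> l < y < r -> G y - G x <= B) ->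
  (\int[leb]_(x in `]l, r[) (g x)%:E <= B%:E)%E.
Proof.
move=> lr g0 cg dG GB.
pose e n := (r - l) / n.+3%:R.
have rl : 0 < r - l by rewrite subr_gt0.
have e0 n : 0 < e n by rewrite divr_gt0.
have e3 n : 3 * e n <= r - l.
  by rewrite /e mulrA ler_pdivrMr// mulrC ler_pM2l// ler_nat.
pose F n := `[l + e n, r - e n]%classic : set R.
have inF n x : F n x -> l < x < r.
  by rewrite /F /= in_itv/= => /andP[h1 h2]; have := e0 n; lra.
have UF : `]l, r[%classic = \bigcup_n F n.
  apply/seteqP; split => [x|x [n _ /inF]]; rewrite /= in_itv//= => /andP[lx xr].
  pose d := Num.min (x - l) (r - x) / (r - l).
  have d0 : 0 < d by rewrite divr_gt0// lt_min !subr_gt0 lx.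
  have [n _ /(_ n (leqnn _)) nd] := near_infty_natSinv_lt (PosNum d0).
  exists n => //; have en : e n <= Num.min (x - l) (r - x).
    rewrite /e mulrC -ler_pdivlMr//; apply: ltW; apply: le_lt_trans nd.
    by rewrite lef_pV2 ?posrE ?ltr0n// ler_nat; lia.
  move: en; rewrite le_min => /andP[h1 h2]; rewrite /F /= in_itv/=.
  by apply/andP; split; lra.
have mg : measurable_fun `]l, r[%classic g.
  apply: open_continuous_measurable_fun; first exact: interval_open.
  by move=> x /set_mem; rewrite /= in_itv/=; exact: cg.
have mF n : measurable (F n) by exact: measurable_itv.
have ndF : nondecreasing_seq F.
  move=> n m nm; rewrite subsetEset => x; rewrite /F /= !in_itv/= => /andP[h1 h2].
  have : e m <= e n.
    by rewrite /e ler_pM2l// lef_pV2 ?posrE ?ltr0n// ler_nat !ltnS.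
  by move=> h; apply/andP; split; lra.
have mgF n : measurable_fun (F n) (EFin \o g).
  apply/measurable_EFinP; apply: measurable_funS mg => //.
  by move=> x /inF; rewrite /= in_itv.
have gF0 n x : F n x -> (0 <= (EFin \o g) x)%E by move=> /inF /g0; rewrite lee_fin.
have cvgF := ge0_nondecreasing_set_cvg_integral (mu := leb) ndF mF mgF gF0.
rewrite UF -(cvg_lim _ cvgF)//.
apply: lime_le; first by apply/cvg_ex; eexists; exact: cvgF.
apply: nearW => n.
have lrn : l + e n < r - e n by have := e3 n; have := e0 n; lra.
have icc x : l + e n <= x <= r - e n -> l < x < r.
  by move=> h; apply: (inF n); rewrite /F /= in_itv.
have cG x : l + e n <= x <= r - e n -> {for x, continuous G}.
  by move=> /icc/dG[du _]; exact/differentiable_continuous/derivable1_diffP.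
rewrite /F (@continuous_FTC2 _ g G _ _ lrn).
- by rewrite -EFinB lee_fin; apply: GB; apply: icc; lra.
- by apply: continuous_in_subspaceT => x /set_mem; rewrite /= in_itv/= => /icc/cg.
- split.
  + by move=> x; rewrite in_itv/= => /andP[h1 h2]; have [|] := dG x; first by apply: icc; lra.
  + by apply: cvg_at_right_filter; apply: cG; lra.
  + by apply: cvg_at_left_filter; apply: cG; lra.
- move=> x; rewrite in_itv/= => /andP[h1 h2].
  by have [|_ dE] := dG x; [apply: icc; lra|rewrite derive1E].
Qed.

(** Substitution of u = c + x or u = c - x in the primitive. *)
Lemma ge0_integral_affine_le (l r B c s : R) (g G : R -> R) : l < r ->
  s ^+ 2 = 1 -> (forall x, l < x < r -> 0 < c + s * x) ->
  (forall u, 0 < u -> [/\ 0 <= g u, {for u, continuous g},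
     is_derive u (1 : R) G (g u) & 0 <= G u <= B]) ->
  (\int[leb]_(x in `]l, r[) (g (c + s * x)%R)%:E <= B%:E)%E.
Proof.
move=> lr s2 pos gG.
have s1 : s = 1 \/ s = -1.
  by have /eqP := s2; rewrite sqrf_eq1 => /orP[/eqP ->|/eqP ->]; [left|right].
apply: (@ge0_integral_le_primitive _ _ _ _ (fun x => s * G (c + s * x))) => //.
- by move=> x /pos/gG[].
- move=> x /pos/gG[_ cgu _ _].
  apply: (@continuous_comp _ _ _ (fun x : R => c + s * x) g); last exact: cgu.
  apply: cvgD; first exact: cvg_cst.
  by apply: cvgM; [exact: cvg_cst|exact: cvg_id].
- move=> x /pos/gG[_ _ dG _].
  have da : is_derive x (1 : R) (fun x : R => c + s * x) s.
    by apply: is_derive_eq; rewrite /GRing.scale/=; ring.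
  have dc := @is_derive1_comp _ G (fun x => c + s * x) x _ _ dG da.
  have := @is_deriveZ _ _ _ _ s _ _ _ dc.
  move/is_derive_eq; apply; rewrite /GRing.scale/= mulrC -mulrA.
  by rewrite -expr2 s2 mulr1.
- move=> x y /pos/gG[_ _ _ /andP[h1 h2]] /pos/gG[_ _ _ /andP[h3 h4]].
  by case: s1 => E; rewrite E !(mul1r, mulN1r) in h1 h2 h3 h4 *; lra.
Qed.

Section Powers.
Variables (a A : R).
Hypotheses (a0 : 0 < a) (a1 : a < 1) (A0 : 0 < A).

Lemma is_derive_powR_shift (b c u : R) : 0 < c + u ->
  is_derive u (1 : R) (fun u => (c + u) `^ b) (b * (c + u) `^ (b - 1)).
Proof.
move=> cu; have da : is_derive u (1 : R) (fun u : R => c + u) 1.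
  by apply: is_derive_eq; rewrite /=; ring.
have := @is_derive1_comp _ (fun x : R => x `^ b) (fun u => c + u) u _ _
  (is_derive1_powR b cu) da.
by move/is_derive_eq; apply; rewrite mulr1.
Qed.

Lemma continuous_powR_shift (b c u : R) : 0 < c + u ->
  {for u, continuous (fun u => (c + u) `^ b)}.
Proof.
move=> /(is_derive_powR_shift b)[du _].
exact/differentiable_continuous/derivable1_diffP.
Qed.

(** This is (u / (A + u))^(1 - a) / ((1 - a) A): the exponents of the density
    below add up to -2, which is what makes its primitive elementary. *)
Definition beta_primitive (u : R) : R :=
  (u `^ (1 - a) * (A + u) `^ (a - 1)) / ((1 - a) * A).

Definition beta_density (u : R) : R := u `^ (- a) * (A + u) `^ (a - 2).

Lemma beta_densityP (u : R) : 0 < u ->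
  [/\ 0 <= beta_density u, {for u, continuous beta_density},
   is_derive u (1 : R) beta_primitive (beta_density u) &
   0 <= beta_primitive u <= ((1 - a) * A)^-1].
Proof.
move=> u0; have Au : 0 < A + u by rewrite addr_gt0.
have u0' : 0 < 0 + u by rewrite add0r.
have f0 (b : R) : (fun u : R => (0 + u) `^ b) = (fun u => u `^ b).
  by apply/funext => x; rewrite add0r.
have cu (b : R) : {for u, continuous (fun u : R => u `^ b)}.
  by have := continuous_powR_shift (b := b) u0'; rewrite f0.
have du (b : R) : is_derive u (1 : R) (fun u : R => u `^ b) (b * u `^ (b - 1)).
  exact: is_derive1_powR.
have k0 : 0 < (1 - a) * A by rewrite mulr_gt0// subr_gt0.
split.
- by rewrite mulr_ge0// powR_ge0.
- by apply: cvgM; [exact: cu|exact: continuous_powR_shift].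
- have -> : beta_primitive = (fun x => ((1 - a) * A)^-1 * (x `^ (1 - a) * (A + x) `^ (a - 1))).
    by apply/funext => x; rewrite /beta_primitive mulrC.
  have dM := @is_deriveM _ _ _ _ u _ _ _ (du (1 - a)) (is_derive_powR_shift (a - 1) Au).
  have dZ := @is_deriveZ _ _ _ _ ((1 - a) * A)^-1 _ _ _ dM.
  apply: (is_derive_eq dZ); rewrite /GRing.scale/= /beta_density.
  have -> : 1 - a - 1 = - a by ring.
  have -> : a - 1 - 1 = a - 2 by ring.
  have -> : u `^ (1 - a) = u * u `^ (- a).
    by rewrite powRD ?powRr1 ?(ltW u0)// (gt_eqF u0) implybT.
  have -> : (A + u) `^ (a - 1) = (A + u) * (A + u) `^ (a - 2).
    rewrite (_ : a - 1 = 1 + (a - 2)); last by ring.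
    rewrite (@powRD _ _ 1 (a - 2)); first by rewrite powRr1 ?(ltW Au).
    by rewrite (gt_eqF Au) implybT.
  by field; rewrite !lt0r_neq0// subr_gt0.
- rewrite /beta_primitive divr_ge0 ?(ltW k0) ?mulr_ge0 ?powR_ge0//=.
  rewrite ler_pdivrMr// mulVf ?lt0r_neq0//.
  rewrite (_ : a - 1 = - (1 - a)); last by ring.
  rewrite powRN ler_pdivrMr ?powR_gt0// mul1r ge0_ler_powR ?nnegrE ?(ltW u0) ?(ltW Au)//.
    by rewrite subr_ge0 ltW.
  by rewrite lerDr ltW.
Qed.

Lemma powR_tailP (u : R) : 0 < u ->
  [/\ 0 <= (A + u) `^ (- 1 - a), {for u, continuous (fun u => (A + u) `^ (- 1 - a))},
   is_derive u (1 : R) (fun u => a^-1 * (A `^ (- a) - (A + u) `^ (- a)))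
     ((A + u) `^ (- 1 - a)) &
   0 <= a^-1 * (A `^ (- a) - (A + u) `^ (- a)) <= a^-1 * A `^ (- a)].
Proof.
move=> u0; have Au : 0 < A + u by rewrite addr_gt0.
split.
- exact: powR_ge0.
- exact: continuous_powR_shift.
- have d := is_derive_powR_shift (- a) Au.
  have dB := is_deriveB (is_derive_cst (A `^ (- a)) u (1 : R)) d.
  have dZ := @is_deriveZ _ _ _ _ a^-1 _ _ _ dB.
  apply: (is_derive_eq dZ); rewrite /GRing.scale/= sub0r.
  rewrite (_ : - a - 1 = -1 - a); last by ring.
  by field; rewrite lt0r_neq0.
- rewrite mulr_ge0 ?invr_ge0 ?(ltW a0) ?subr_ge0//=.
    by rewrite ler_pM2l ?invr_gt0// gerBl powR_ge0.
  by rewrite !powRN lef_pV2 ?posrE ?powR_gt0// ge0_ler_powR ?nnegrE ?(ltW a0) ?(ltW Au) ?(ltW A0)// lerDl ltW.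
Qed.

End Powers.

(** On both sides of y0 the integrand is (d + u)^(-1-a) in the distance
    u = |y - y0|. *)
Lemma integral_powR_dist_le (a d y0 : R) : 0 < a -> 0 < d -> -1 < y0 < 1 ->
  (\int[leb]_(y in `](- 1)%R, 1%R[) ((`|y - y0| + d) `^ (- 1 - a))%:E <=
   (2 * (a^-1 * d `^ (- a)))%:E)%E.
Proof.
move=> a0 d0 /andP[y1 y2].
have dP := powR_tailP a0 d0.
have m01 : measurable_fun setT (fun y : R => ((`|y - y0| + d) `^ (- 1 - a))%:E).
  apply/measurable_EFinP; apply: (measurableT_comp (measurable_powR _)).
  apply: measurable_funD => //; apply: measurableT_comp => //.
  by apply: measurable_funB.
have m02 (E : set R) : measurable_fun E (fun y : R => ((`|y - y0| + d) `^ (- 1 - a))%:E).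
  exact: (measurable_funS measurableT (@subsetT _ E) m01).
have -> : `](- 1)%R, 1%R[%classic = `](- 1)%R, y0]%classic `|` `]y0, 1%R[%classic :> set R.
  by rewrite -itv_bndbnd_setU// ?bnd_simp//; exact: ltW.
rewrite ge0_integral_setU//; [|exact: m02| |].
2: by move=> y _; rewrite lee_fin powR_ge0.
2: apply/disj_setPS => y [] /=; rewrite !in_itv/= => /andP[_ h] /andP[h' _]; lra.
have -> : 2 * (a^-1 * d `^ (- a)) = a^-1 * d `^ (- a) + a^-1 * d `^ (- a) by ring.
rewrite EFinD leeD//.
- rewrite -integral_itv_bndo_bndc//.
  have E : (\int[leb]_(y in `](- 1)%R, y0[) ((`|y - y0| + d) `^ (- 1 - a))%:E =
     \int[leb]_(y in `](- 1)%R, y0[) ((d + (y0 + -1 * y)) `^ (- 1 - a))%:E)%E.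
    apply: eq_integral => y /set_mem; rewrite /= in_itv/= => /andP[h1 h2].
    congr (((_) `^ _)%:E); rewrite ltr0_norm ?subr_lt0//; ring.
  rewrite E; apply: (@ge0_integral_affine_le _ _ _ y0 (-1) (fun u => (d + u) `^ (- 1 - a))
     (fun u => a^-1 * (d `^ (- a) - (d + u) `^ (- a)))) => //.
    by rewrite sqrrN expr1n.
  by move=> y /andP[_ h]; lra.
- have E : (\int[leb]_(y in `]y0, 1%R[) ((`|y - y0| + d) `^ (- 1 - a))%:E =
     \int[leb]_(y in `]y0, 1%R[) ((d + (- y0 + 1 * y)) `^ (- 1 - a))%:E)%E.
    apply: eq_integral => y /set_mem; rewrite /= in_itv/= => /andP[h1 h2].
    congr (((_) `^ _)%:E); rewrite gtr0_norm ?subr_gt0//; ring.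
  rewrite E; apply: (@ge0_integral_affine_le _ _ _ (- y0) 1 (fun u => (d + u) `^ (- 1 - a))
     (fun u => a^-1 * (d `^ (- a) - (d + u) `^ (- a)))) => //.
    by rewrite expr1n.
  by move=> y /andP[h _]; lra.
Qed.

End OneDimensionalBounds.

(** * The weighted kernel estimate *)

Section SchurEstimate.
Variable R : realType.
Local Notation C := R[i].
Local Notation leb := (@lebesgue_measure R).
Local Notation P := (measurableTypeR R * measurableTypeR R)%type.
Local Notation sig := (@sigma R).
Local Notation D := (@plane_disc R).
Implicit Types (z w : C) (xy : P).

Lemma integral_pdisc_le_x (h : P -> R) (H : R -> R) (B : \bar R) :
  measurable_fun setT h -> (forall xy, 0 <= h xy) -> (forall y, 0 <= H y) ->
  measurable_fun setT H ->
  (forall y, y ^+ 2 < 1 ^+ 2 ->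
    (\int[leb]_(x in `](- Num.sqrt (1 ^+ 2 - y ^+ 2))%R, (Num.sqrt (1 ^+ 2 - y ^+ 2))%R[)
      (h (x, y))%:E <= (H y)%:E)%E) ->
  (\int[leb]_(y in `](- 1)%R, 1%R[) (H y)%:E <= B)%E ->
  (\int[leb \x leb]_(xy in pdisc 1) (h xy)%:E <= B)%E.
Proof.
move=> mh h0 H0 mH hH HB; rewrite integral_mkcond.
have mhp : measurable_fun setT ((fun xy => (h xy)%:E) \_ (pdisc 1)).
  apply/(measurable_restrictT _ (measurable_pdisc _)); apply: measurable_funS (_ : measurable_fun setT _) => //.
  exact/measurable_EFinP.
have hp0 xy : (0 <= ((fun xy => (h xy)%:E) \_ (pdisc 1)) xy)%E.
  by rewrite /patch; case: ifP; rewrite ?lee_fin.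
rewrite fubini_tonelli2//; apply: le_trans HB.
rewrite [leRHS]integral_mkcond; apply: ge0_le_integral => //.
- by move=> y _; apply: integral_ge0.
- exact: measurable_fun_fubini_tonelli_G.
- apply/(measurable_restrictT _ (measurable_itv _)).
  apply: measurable_funS (_ : measurable_fun setT _) => //; exact/measurable_EFinP.
move=> y _; rewrite /fubini_G patchE /=.
have [ys|ys] := ltP (y ^+ 2) (1 ^+ 2).
  rewrite (@mem_set _ `]-1, 1[%classic y); last first.
    rewrite /= in_itv/= -ltr_norml -(@expr_lt1 _ 2)// real_normK ?num_real//.
    by rewrite expr1n in ys.
  apply: le_trans (hH _ ys); have [_ <- _ _] := slice_itv ys.
  rewrite [leRHS]integral_mkcond le_eqVlt; apply/orP; left; apply/eqP.
  by apply: eq_integral => x _; rewrite /patch; congr (if _ then _ else _).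
rewrite integral0_eq; first by case: ifP; rewrite ?lee_fin.
move=> x _; rewrite /patch; case: ifPn => // /set_mem.
rewrite /pdisc /= => xys; exfalso; move: xys ys; have := sqr_ge0 (x : R); lra.
Qed.

Lemma ge0_integral_pdisc_swap (h : P -> R) :
  measurable_fun setT h -> (forall xy, 0 <= h xy) ->
  (\int[leb \x leb]_(xy in pdisc 1) (h (xy.2, xy.1))%:E =
   \int[leb \x leb]_(xy in pdisc 1) (h xy)%:E)%E.
Proof.
move=> mh h0; pose f (xy : P) := ((fun xy => (h xy)%:E) \_ (pdisc 1)) xy.
have f0 xy : (0 <= f xy)%E by rewrite /f /patch; case: ifP; rewrite ?lee_fin.
have mf : measurable_fun setT f.
  apply/(measurable_restrictT _ (measurable_pdisc _)).
  by apply: measurable_funS (_ : measurable_fun setT _) => //; exact/measurable_EFinP.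
have mfs : measurable_fun setT (fun xy : P => f (xy.2, xy.1)).
  exact: (measurableT_comp mf (@measurable_swap _ _ _ _)).
rewrite [RHS]integral_mkcond [LHS]integral_mkcond.
transitivity (\int[leb \x leb]_xy f (xy.2, xy.1))%E.
  apply: eq_integral => -[x y] _; rewrite /f /patch; congr (if _ then _ else _).
  by apply/idP/idP => /set_mem; rewrite /pdisc /= addrC => ?; apply/mem_set.
by rewrite fubini_tonelli1// [RHS]fubini_tonelli2.
Qed.

Variable a : R.
Hypotheses (a0 : 0 < a) (a1 : a < 1).

(** Model for (1 - |w|)^(-a) |1 - conj(w) z|^(-2), w = x + i y, on the quarter
    of the disc with |y| <= |x| and s x <= 0. There 1 - |w| is comparable to the
    horizontal distance u = sqrt (1 - y^2) + s x to the circle, and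
    |1 - conj(w) z| is at least a multiple of |y - c| + d + u, where c = Im z and
    d = 1 - |z|. Exchanging the coordinates gives the other two quarters. *)
Definition quarter_model (c d s x y : R) : R :=
  (`|y - c| + d) `^ (- a) *
  beta_density a (`|y - c| + d) (Num.sqrt (1 ^+ 2 - y ^+ 2) + s * x).

Lemma quarter_model_ge0 (c d s x y : R) : 0 <= quarter_model c d s x y.
Proof. by rewrite mulr_ge0 ?mulr_ge0 ?powR_ge0. Qed.

Lemma measurable_quarter_model (c d s : R) d' (T : measurableType d') (f g : T -> R) :
  measurable_fun setT f -> measurable_fun setT g ->
  measurable_fun setT (fun t => quarter_model c d s (f t) (g t)).
Proof.
move=> mf mg.
have m1 : measurable_fun setT (fun t => `|g t - c| + d).
  apply: measurable_funD => //; apply: measurableT_comp => //.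
  by apply: measurable_funB.
have m2 : measurable_fun setT (fun t => Num.sqrt (1 ^+ 2 - g t ^+ 2) + s * f t).
  apply: measurable_funD; last by apply: measurable_funM.
  apply: measurableT_comp.
    by apply: continuous_measurable_fun; exact: sqrt_continuous.
  by apply: measurable_funB => //; exact: measurable_funX.
apply: measurable_funM; first exact: (measurableT_comp (measurable_powR _) m1).
apply: measurable_funM; first exact: (measurableT_comp (measurable_powR _) m2).
apply: (measurableT_comp (measurable_powR _)).
exact: measurable_funD.
Qed.

Definition schur_const : R := (1 - a)^-1 * (2 * a^-1).

Lemma integral_quarter_slice (c d s y : R) : 0 < d -> s ^+ 2 = 1 ->
  y ^+ 2 < 1 ^+ 2 ->
  (\int[leb]_(x in `](- Num.sqrt (1 ^+ 2 - y ^+ 2))%R, (Num.sqrt (1 ^+ 2 - y ^+ 2))%R[)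
     (quarter_model c d s x y)%:E <=
   ((1 - a)^-1 * (`|y - c| + d) `^ (- 1 - a))%:E)%E.
Proof.
move=> d0 s2 y1; set r := Num.sqrt _; set A := `|y - c| + d.
have r0 : 0 < r by rewrite sqrtr_gt0 subr_gt0.
have A0 : 0 < A by rewrite ltr_wpDl.
have s1 : s = 1 \/ s = -1.
  by have /eqP := s2; rewrite sqrf_eq1 => /orP[/eqP ->|/eqP ->]; [left|right].
under eq_integral do rewrite /quarter_model -/A -/r EFinM.
rewrite ge0_integralZl ?lee_fin ?powR_ge0//; last 2 first.
- apply/measurable_EFinP; apply: (@measurable_funS _ _ _ _ setT) => //.
  have m2 : measurable_fun setT (fun x : R => r + s * x).
    by apply: measurable_funD => //; apply: measurable_funM.
  apply: measurable_funM; first exact: (measurableT_comp (measurable_powR _) m2).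
  apply: (measurableT_comp (measurable_powR _)); exact: measurable_funD.
- by move=> x _; rewrite lee_fin mulr_ge0 ?powR_ge0.
have -> : (1 - a)^-1 * A `^ (- 1 - a) = A `^ (- a) * ((1 - a) * A)^-1.
  rewrite (_ : -1 - a = - a + -1); last by ring.
  rewrite powRD ?powR_inv1 ?(ltW A0) ?(gt_eqF A0) ?implybT// invfM; ring.
rewrite EFinM lee_wpmul2l ?lee_fin ?powR_ge0//.
apply: (@ge0_integral_affine_le _ _ _ _ _ _ _ (beta_primitive a A)) => //.
- lra.
- by move=> x /andP[h1 h2]; case: s1 => ->; lra.
- by move=> u u0; exact: beta_densityP.
Qed.

Lemma integral_quarter_bound (c d : R) : 0 < d -> -1 < c < 1 ->
  (\int[leb]_(y in `](- 1)%R, 1%R[) ((1 - a)^-1 * (`|y - c| + d) `^ (- 1 - a))%:E <=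
   (schur_const * d `^ (- a))%:E)%E.
Proof.
move=> d0 c1; have a1' : 0 <= (1 - a)^-1 by rewrite invr_ge0 subr_ge0 ltW.
under eq_integral do rewrite EFinM.
rewrite ge0_integralZl ?lee_fin//.
- rewrite /schur_const -mulrA EFinM lee_wpmul2l ?lee_fin// -mulrA.
  exact: integral_powR_dist_le.
- apply/measurable_EFinP; apply: (@measurable_funS _ _ _ _ setT) => //.
  apply: (measurableT_comp (measurable_powR _)).
  apply: measurable_funD => //; apply: measurableT_comp => //.
  by apply: measurable_funB.
- by move=> y _; rewrite lee_fin powR_ge0.
Qed.

Lemma integral_quarter_x (c d s : R) : 0 < d -> -1 < c < 1 -> s ^+ 2 = 1 ->
  (\int[leb \x leb]_(xy in pdisc 1) (quarter_model c d s xy.1 xy.2)%:E <=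
   (schur_const * d `^ (- a))%:E)%E.
Proof.
move=> d0 c1 s2; apply: (@integral_pdisc_le_x (fun xy => quarter_model c d s xy.1 xy.2)
   (fun y => (1 - a)^-1 * (`|y - c| + d) `^ (- 1 - a))) => //.
- by apply: measurable_quarter_model; [exact: measurable_fst|exact: measurable_snd].
- by move=> xy; exact: quarter_model_ge0.
- by move=> y; rewrite mulr_ge0 ?powR_ge0// invr_ge0 subr_ge0 ltW.
- apply: measurable_funM => //; apply: (measurableT_comp (measurable_powR _)).
  apply: measurable_funD => //; apply: measurableT_comp => //.
  by apply: measurable_funB.
- by move=> y ys; exact: integral_quarter_slice.
- exact: integral_quarter_bound.
Qed.

Lemma integral_quarter_y (c d s : R) : 0 < d -> -1 < c < 1 -> s ^+ 2 = 1 ->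
  (\int[leb \x leb]_(xy in pdisc 1) (quarter_model c d s xy.2 xy.1)%:E <=
   (schur_const * d `^ (- a))%:E)%E.
Proof.
move=> d0 c1 s2; have mq : measurable_fun setT (fun xy : P => quarter_model c d s xy.1 xy.2).
  by apply: measurable_quarter_model; [exact: measurable_fst|exact: measurable_snd].
have := ge0_integral_pdisc_swap mq (fun xy => quarter_model_ge0 c d s xy.1 xy.2).
by move=> /= ->; exact: integral_quarter_x.
Qed.

Lemma quarter_model_bound (c d s x y m t : R) : 0 < d -> 0 < t -> 0 < m ->
  `|y - c| <= m -> d <= m -> t <= m ->
  0 < Num.sqrt (1 ^+ 2 - y ^+ 2) + s * x <= 4 * t ->
  t `^ (- a) * m ^- 2 <= 144 * quarter_model c d s x y.
Proof.
rewrite /quarter_model /beta_density; set u := Num.sqrt _ + _; set A := `|y - c| + d.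
(* 144 = 4 * 36: u <= 4 t costs at most 4 in the power -a, and A + u <= 6 m
   costs 36 in the power -2 *)
move=> d0 t0 m0 ym dm tm /andP[u0 ut]; have A0 : 0 < A by rewrite ltr_wpDl.
have Au0 : 0 < A + u by rewrite addr_gt0.
have t1 : t `^ (- a) <= 4 * u `^ (- a).
  rewrite !powRN (_ : 4 * (u `^ a)^-1 = (u `^ a / 4)^-1); last by rewrite invfM invrK mulrC.
  rewrite lef_pV2 ?posrE ?divr_gt0 ?powR_gt0// ler_pdivrMr//.
  apply: (@le_trans _ _ ((4 * t) `^ a)).
    by rewrite ge0_ler_powR ?nnegrE ?(ltW a0) ?(ltW u0) ?mulr_ge0 ?(ltW t0).
  rewrite powRM ?(ltW t0)// mulrC ler_wpM2l ?powR_ge0//.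
  by rewrite ler1_powR ?ler1n ?(ltW a1).
have m1 : m ^- 2 <= 36 * (A `^ (- a) * (A + u) `^ (a - 2)).
  apply: (@le_trans _ _ (36 * ((A + u) `^ (- a) * (A + u) `^ (a - 2)))); last first.
    rewrite ler_wpM2l// ler_wpM2r ?powR_ge0// !powRN lef_pV2 ?posrE ?powR_gt0//.
    by rewrite ge0_ler_powR ?nnegrE ?(ltW a0) ?(ltW A0) ?(ltW Au0)// lerDl ltW.
  rewrite -powRD ?(gt_eqF Au0) ?implybT// (_ : - a + (a - 2) = - (2%:R)); last by ring.
  rewrite powR_invn ?(ltW Au0)// (_ : 36 / _ = ((A + u) / 6) ^- 2); last first.
    by field; rewrite lt0r_neq0.
  rewrite lef_pV2 ?posrE ?exprn_gt0 ?divr_gt0// lerXn2r ?nnegrE ?(ltW m0) ?divr_ge0 ?(ltW Au0)//.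
  by rewrite ler_pdivrMr// /A; lra.
rewrite (_ : 144 * _ = 4 * u `^ (- a) * (36 * (A `^ (- a) * (A + u) `^ (a - 2)))); last by ring.
by apply: ler_pM; rewrite ?powR_ge0 ?invr_ge0 ?exprn_ge0 ?(ltW m0).
Qed.

(** Where |y| <= |x|, horizontal lines cross the circle at an angle bounded away
    from 0, so that the horizontal distance to the circle is at most a multiple
    of the distance 1 - |w|. *)
Lemma quarter_gap (x y : R) : x ^+ 2 + y ^+ 2 < 1 -> `|y| <= `|x| ->
  0 < Num.sqrt (1 ^+ 2 - y ^+ 2) - `|x| <= 4 * (1 - modulus (x +i* y)).
Proof.
move=> xy1 yx; have x2 : `|x| ^+ 2 = x ^+ 2 by rewrite real_normK ?num_real.
have y2 : y ^+ 2 <= x ^+ 2.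
  by rewrite -x2 -[y ^+ 2]real_normK ?num_real// lerXn2r ?nnegrE.
set s := Num.sqrt _.
have s2 : s ^+ 2 = 1 - y ^+ 2.
  by rewrite sqr_sqrtr expr1n// subr_ge0; have := sqr_ge0 x; lra.
have s0 : 0 <= s by exact: sqrtr_ge0.
have s12 : 1 / 2 <= s.
  rewrite -(@ler_pXn2r _ 2)// ?nnegrE ?divr_ge0// s2 expr_div_n expr1n.
  rewrite (_ : 2 ^+ 2 = 4); last by ring.
  lra.
have xs : `|x| < s by rewrite -(@ltr_pXn2r _ 2)// ?nnegrE// s2 x2; lra.
rewrite subr_gt0 xs /=.
set m := modulus _; have m0 : 0 <= m by exact: modulus_ge0.
have m2 : m ^+ 2 = x ^+ 2 + y ^+ 2 by rewrite sqr_modulus.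
have m1 : m < 1 by rewrite -(@ltr_pXn2r _ 2)// ?nnegrE// m2 expr1n.
have e : (1 - m) * (1 + m) = (s - `|x|) * (s + `|x|).
  by rewrite -!subr_sqr x2 s2 m2 expr1n; ring.
have h1 : (1 - m) * (1 + m) <= (1 - m) * 2 by rewrite ler_wpM2l; lra.
have h2 : (s - `|x|) * (1 / 2) <= (s - `|x|) * (s + `|x|).
  by rewrite ler_wpM2l ?subr_ge0 ?(ltW xs)//; have := normr_ge0 x; lra.
by lra.
Qed.

(** |1 - conj(w) z|^2 = |w - z|^2 + (1 - |w|^2) (1 - |z|^2). *)
Lemma modulus_kernel_denominator z w : modulus z <= 1 -> modulus w <= 1 ->
  modulus (w - z) <= modulus (1 - w^* * z).
Proof.
move=> z1 w1; rewrite -(@ler_pXn2r _ 2)// ?nnegrE ?modulus_ge0//.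
have E : modulus (1 - w^* * z) ^+ 2 =
    modulus (w - z) ^+ 2 + (1 - modulus w ^+ 2) * (1 - modulus z ^+ 2).
  rewrite !sqr_modulus !(cReD, cImD, cReN, cImN, cReM, cImM) cRe_conj cIm_conj /=; ring.
rewrite E lerDl mulr_ge0 ?subr_ge0 ?exprn_ile1 ?modulus_ge0//.
Qed.

Lemma kernel_quarter_bound z w : disc z -> disc w ->
  (1 - modulus w) `^ (- a) * modulus (bkernel z w) <=
  144 * (quarter_model (complex.Im z) (1 - modulus z) 1 (complex.Re w) (complex.Im w) +
         quarter_model (complex.Im z) (1 - modulus z) (-1) (complex.Re w) (complex.Im w) +
         quarter_model (complex.Re z) (1 - modulus z) 1 (complex.Im w) (complex.Re w) +
         quarter_model (complex.Re z) (1 - modulus z) (-1) (complex.Im w) (complex.Re w)).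
Proof.
rewrite /disc /= => z1 w1; have w1' : modulus w^* <= 1 by rewrite modulus_conj ltW.
have [dm nz] := kernel_neq0 w1' z1.
set m := modulus (1 - w^* * z) in dm.
have m0 : 0 < m by rewrite modulus_gt0.
have wm : 1 - modulus w <= m.
  have := ler_modulusB 1 (w^* * z); rewrite modulus1 modulusM modulus_conj -/m.
  have : modulus w * modulus z <= modulus w by rewrite ler_piMr ?modulus_ge0// ltW.
  by lra.
have zw := modulus_kernel_denominator (ltW z1) (ltW w1).
have ym : `|complex.Im w - complex.Im z| <= m.
  by rewrite (le_trans _ zw)// -cImN -cImD; exact: ler_norm_Im.
have xm : `|complex.Re w - complex.Re z| <= m.
  by rewrite (le_trans _ zw)// -cReN -cReD; exact: ler_norm_Re.
have -> : modulus (bkernel z w) = m ^- 2 by rewrite /bkernel modulusV modulusX.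
have d0 : 0 < 1 - modulus z by rewrite subr_gt0.
have t0 : 0 < 1 - modulus w by rewrite subr_gt0.
have g := @quarter_model_bound _ (1 - modulus z) _ _ _ m (1 - modulus w) d0 t0 m0.
have P := quarter_model_ge0.
have w2 : complex.Re w ^+ 2 + complex.Im w ^+ 2 < 1.
  by rewrite -sqr_modulus -(expr1n _ 2) ltr_pXn2r// nnegrE ?modulus_ge0.
have wE : modulus w = modulus (complex.Re w +i* complex.Im w) by case: (w).
have wE' : modulus w = modulus (complex.Im w +i* complex.Re w).
  by rewrite wE !modulusE/= addrC.
have S (A B E F X : R) : 0 <= A -> 0 <= B -> 0 <= E -> 0 <= F ->
    [\/ X <= 144 * A, X <= 144 * B, X <= 144 * E | X <= 144 * F] ->
    X <= 144 * (A + B + E + F) by move=> ? ? ? ?; case; lra.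
apply: S => //.
have [yx|/ltW xy] := leP `|complex.Im w| `|complex.Re w|.
  have := quarter_gap w2 yx; rewrite -wE.
  have [x0|x0] := leP 0 (complex.Re w).
    rewrite (ger0_norm x0) => gap; constructor 2.
    by apply: g ym dm wm _; rewrite mulN1r.
  rewrite (ltr0_norm x0) opprK => gap; constructor 1.
  by apply: g ym dm wm _; rewrite mul1r.
rewrite addrC in w2; have := quarter_gap w2 xy; rewrite -wE'.
have [x0|x0] := leP 0 (complex.Im w).
  rewrite (ger0_norm x0) => gap; constructor 4.
  by apply: g xm dm wm _; rewrite mulN1r.
rewrite (ltr0_norm x0) opprK => gap; constructor 3.
by apply: g xm dm wm _; rewrite mul1r.
Qed.

(** The four models are integrated over the whole disc, along the lines on which
    they are beta densities and then across them. *)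
Lemma integral_kernel_weight_le z : disc z ->
  (\int[sig]_(xy in D) ((1 - modulus (of_plane xy)) `^ (- a) *
     modulus (bkernel z (of_plane xy)))%:E <=
   (pi^-1 * (144 * (4 * schur_const)) * (1 - modulus z) `^ (- a))%:E)%E.
Proof.
move=> zD; have mD := @measurable_plane_disc R.
have z1 : modulus z < 1 := zD.
have d0 : 0 < 1 - modulus z by rewrite subr_gt0.
have [re1 im1] : -1 < complex.Re z < 1 /\ -1 < complex.Im z < 1.
  by rewrite -!ltr_norml; split; apply: le_lt_trans z1;
    [exact: ler_norm_Re|exact: ler_norm_Im].
pose d := 1 - modulus z.
pose Q1 s (xy : P) := quarter_model (complex.Im z) d s xy.1 xy.2.
pose Q2 s (xy : P) := quarter_model (complex.Re z) d s xy.2 xy.1.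
have mQ1 s : measurable_fun setT (Q1 s).
  by apply: measurable_quarter_model; [exact: measurable_fst|exact: measurable_snd].
have mQ2 s : measurable_fun setT (Q2 s).
  by apply: measurable_quarter_model; [exact: measurable_snd|exact: measurable_fst].
have ES (h : P -> R) : measurable_fun setT h -> measurable_fun D (EFin \o h).
  by move=> mh; apply/measurable_EFinP; exact: (measurable_funS measurableT (@subsetT _ D) mh).
have mo := @cmeasurable_of_plane_disc R.
have mw : measurable_fun D (fun xy : P => (1 - modulus (of_plane xy)) `^ (- a) *
     modulus (bkernel z (of_plane xy))).
  apply: measurable_funM; last exact: measurable_modulus (cmeasurable_kernel z).
  apply: (measurableT_comp (measurable_powR _)); apply: measurable_funB => //.
  exact: measurable_modulus.
pose S4 xy := Q1 1 xy + Q1 (-1) xy + Q2 1 xy + Q2 (-1) xy.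
have Q0 : (forall s xy, 0 <= Q1 s xy) /\ (forall s xy, 0 <= Q2 s xy).
  by split=> s xy; exact: quarter_model_ge0.
have [Q10 Q20] := Q0.
have mS4 : measurable_fun setT S4 by repeat apply: measurable_funD => //.
have S40 xy : 0 <= S4 xy by rewrite !addr_ge0.
apply: (@le_trans _ _ (\int[sig]_(xy in D) (144 * S4 xy)%:E)%E).
  apply: ge0_le_integral => //.
  - by move=> xy _; rewrite lee_fin mulr_ge0 ?powR_ge0 ?modulus_ge0.
  - exact/measurable_EFinP.
  - by apply: ES; exact: measurable_funM.
  - by move=> xy Dxy; rewrite lee_fin; exact: kernel_quarter_bound.
rewrite ge0_integral_sigma//; last 2 first.
- by apply: ES; exact: measurable_funM.
- by move=> xy _; rewrite lee_fin mulr_ge0.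
rewrite -(mulrA pi^-1) -(mulrA 144) -(mulrA 4) EFinM lee_wpmul2l// ?lee_fin ?invr_ge0 ?pi_ge0//.
under eq_integral do rewrite EFinM.
rewrite ge0_integralZl ?lee_fin//; last 2 first.
- exact: ES.
- by move=> xy _; rewrite lee_fin.
rewrite EFinM lee_wpmul2l ?lee_fin//.
rewrite plane_discE.
have EP (h : P -> R) : measurable_fun setT h -> measurable_fun (pdisc 1) (EFin \o h).
  by rewrite -plane_discE; exact: ES.
have mP := measurable_pdisc (1 : R).
have add (h k : P -> R) (A B : R) : measurable_fun setT h -> measurable_fun setT k ->
    (forall xy, 0 <= h xy) -> (forall xy, 0 <= k xy) ->
    (\int[leb \x leb]_(xy in pdisc 1) (h xy)%:E <= A%:E)%E ->
    (\int[leb \x leb]_(xy in pdisc 1) (k xy)%:E <= B%:E)%E ->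
    (\int[leb \x leb]_(xy in pdisc 1) (h xy + k xy)%:E <= (A + B)%:E)%E.
  move=> mh mk h0 k0 hA kB; under eq_integral do rewrite EFinD.
  rewrite ge0_integralD//; [by rewrite [leRHS]EFinD; exact: leeD|..].
  - by move=> xy _; rewrite lee_fin.
  - exact: EP.
  - by move=> xy _; rewrite lee_fin.
  - exact: EP.
have s11 : (1 : R) ^+ 2 = 1 by rewrite expr1n.
have sN1 : (-1 : R) ^+ 2 = 1 by rewrite sqrrN expr1n.
set K := schur_const * d `^ (- a).
rewrite (_ : 4 * K = K + K + K + K); last by ring.
have B1 := add (Q1 1) (Q1 (-1)) K K (mQ1 1) (mQ1 (-1)) (Q10 1) (Q10 (-1))
  (integral_quarter_x d0 im1 s11) (integral_quarter_x d0 im1 sN1).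
have B2 := add _ (Q2 1) _ K (measurable_funD (mQ1 1) (mQ1 (-1))) (mQ2 1)
  (fun xy => addr_ge0 (Q10 1 xy) (Q10 (-1) xy)) (Q20 1) B1
  (integral_quarter_y d0 re1 s11).
exact: (add _ (Q2 (-1)) _ K
  (measurable_funD (measurable_funD (mQ1 1) (mQ1 (-1))) (mQ2 1)) (mQ2 (-1))
  (fun xy => addr_ge0 (addr_ge0 (Q10 1 xy) (Q10 (-1) xy)) (Q20 1 xy)) (Q20 (-1)) B2
  (integral_quarter_y d0 re1 sN1)).
Qed.

End SchurEstimate.

(** * Schur's test *)

Section SchurTest.
Variable R : realType.
Local Notation C := R[i].
Local Notation P := (measurableTypeR R * measurableTypeR R)%type.
Local Notation sig := (@sigma R).
Local Notation D := (@plane_disc R).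
Implicit Types (z w xy : P).

Lemma measurable_comp_fst (h : P -> R) : measurable_fun D h ->
  measurable_fun (D `*` D) (fun zw : P * P => h zw.1).
Proof.
move=> mh; have mD := @measurable_plane_disc R.
apply: (@measurable_comp _ _ _ _ _ _ D h (D `*` D) fst) => //.
  by move=> _ [[u v] [/= ? ?] <-].
exact: (measurable_funS measurableT (@subsetT _ _) measurable_fst).
Qed.

Lemma measurable_comp_snd (h : P -> R) : measurable_fun D h ->
  measurable_fun (D `*` D) (fun zw : P * P => h zw.2).
Proof.
move=> mh; have mD := @measurable_plane_disc R.
apply: (@measurable_comp _ _ _ _ _ _ D h (D `*` D) snd) => //.
  by move=> _ [[u v] [/= ? ?] <-].
exact: (measurable_funS measurableT (@subsetT _ _) measurable_snd).
Qed.

Lemma cmeasurable_comp_fst (f : P -> C) : cmeasurable D f ->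
  cmeasurable (D `*` D) (fun zw : P * P => f zw.1).
Proof.
by move=> [f1 f2]; split; [exact: (measurable_comp_fst f1)|exact: (measurable_comp_fst f2)].
Qed.

Lemma cmeasurable_comp_snd (f : P -> C) : cmeasurable D f ->
  cmeasurable (D `*` D) (fun zw : P * P => f zw.2).
Proof.
by move=> [f1 f2]; split; [exact: (measurable_comp_snd f1)|exact: (measurable_comp_snd f2)].
Qed.

Lemma cmeasurable_kernel2 :
  cmeasurable (D `*` D) (fun zw : P * P => bkernel (of_plane zw.1) (of_plane zw.2)).
Proof.
have mo := @cmeasurable_of_plane_disc R.
apply: cmeasurableV; apply: cmeasurableX; apply: cmeasurableD.
  exact: cmeasurable_cst.
apply: cmeasurableN; apply: cmeasurableM; last exact: cmeasurable_comp_fst.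
by apply: cmeasurable_conj; exact: cmeasurable_comp_snd.
Qed.

Lemma modulus_kernel_sym (z w : C) : modulus (bkernel z w) = modulus (bkernel w z).
Proof. by rewrite -kernel_conj modulus_conj. Qed.

Definition lp (r : R) (g : P -> C) :=
  cmeasurable D g /\ (\int[sig]_(xy in D) (modulus (g xy) `^ r)%:E < +oo)%E.

Variables p q : R.
Hypotheses (p1 : 1 < p) (pq : p^-1 + q^-1 = 1).

Lemma conj_exponent_gt1 : 1 < q.
Proof.
have p0 : 0 < p by rewrite (lt_trans ltr01).
have ip : p^-1 < 1 by rewrite invf_lt1.
have ip0 : 0 < p^-1 by rewrite invr_gt0.
have qE : q^-1 = 1 - p^-1 by rewrite -pq addrC addKr.
have q0 : 0 < q by rewrite -invr_gt0 qE subr_gt0.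
by rewrite -invf_lt1// qE gtrBl.
Qed.

Let p0 : 0 < p. Proof. exact: lt_trans ltr01 p1. Qed.
Let q0 : 0 < q. Proof. exact: lt_trans ltr01 conj_exponent_gt1. Qed.
Let ip01 : 0 < p^-1 < 1.
Proof. by rewrite invr_gt0 p0 invf_lt1. Qed.
Let iq01 : 0 < q^-1 < 1.
Proof. by rewrite invr_gt0 q0 invf_lt1 ?conj_exponent_gt1. Qed.

Let wt xy : R := 1 - modulus (of_plane xy).

Let wt_gt0 xy : D xy -> 0 < wt xy.
Proof. by move=> Dxy; rewrite subr_gt0. Qed.

Let mwt (b : R) : measurable_fun D (fun xy => wt xy `^ b).
Proof.
apply: (measurableT_comp (measurable_powR _)); apply: measurable_funB => //.
exact: measurable_modulus (@cmeasurable_of_plane_disc R).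
Qed.

Variable g : P -> C.
Hypothesis gq : lp q g.

Let mg : measurable_fun D (fun xy => modulus (g xy)).
Proof. by case: gq => ? _; exact: measurable_modulus. Qed.

Let mgq : measurable_fun D (fun xy => modulus (g xy) `^ q).
Proof. exact: (measurableT_comp (measurable_powR _) mg). Qed.

Let mgw : measurable_fun D (fun w => modulus (g w) `^ q * wt w `^ p^-1).
Proof. by apply: measurable_funM; [exact: mgq|exact: mwt]. Qed.

Let K (zw : P * P) := modulus (bkernel (of_plane zw.1) (of_plane zw.2)).

Let mK : measurable_fun (D `*` D) K.
Proof. exact: measurable_modulus cmeasurable_kernel2. Qed.

Let mK1 (z : C) : measurable_fun D (fun w => modulus (bkernel z (of_plane w))).
Proof. exact: measurable_modulus (cmeasurable_kernel z). Qed.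

(** The weight (1 - |w|)^(1/p) compensates the loss in the kernel estimate with
    exponent 1/p. *)
Let weighted (z : P) : \bar R :=
  (\int[sig]_(w in D) (modulus (g w) `^ q * wt w `^ p^-1 * K (z, w))%:E)%E.

Let weighted_fun (zw : P * P) : \bar R :=
  (modulus (g zw.2) `^ q * wt zw.2 `^ p^-1 * K zw)%:E.

Let weighted_fun_ge0 zw : (0 <= weighted_fun zw)%E.
Proof. by rewrite lee_fin !mulr_ge0 ?powR_ge0 ?modulus_ge0. Qed.

Let mweighted_real : measurable_fun (D `*` D)
  (fun zw : P * P => modulus (g zw.2) `^ q * wt zw.2 `^ p^-1 * K zw).
Proof. by apply: measurable_funM; [exact: (measurable_comp_snd mgw)|exact: mK]. Qed.

Let mweighted_fun : measurable_fun (D `*` D) weighted_fun.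
Proof. by apply/measurable_EFinP; exact: mweighted_real. Qed.

Let mweighted : measurable_fun D weighted.
Proof.
exact: (measurable_partial_integral sig (@measurable_plane_disc R)
  (@measurable_plane_disc R) mweighted_fun weighted_fun_ge0).
Qed.

Let weighted_fin z : D z -> weighted z \is a fin_num.
Proof.
move=> Dz; have mD := @measurable_plane_disc R.
rewrite ge0_fin_numE; last by apply: integral_ge0 => w _; exact: (weighted_fun_ge0 (z, w)).
have [_ gfin] := gq.
pose M := (1 - modulus (of_plane z)) ^- 2.
have M0 : 0 <= M by rewrite invr_ge0 exprn_ge0// subr_ge0 ltW.
apply: (@le_lt_trans _ _ (\int[sig]_(w in D) (M%:E * (modulus (g w) `^ q)%:E))%E).
  apply: ge0_le_integral => //.
  - by move=> w _; exact: (weighted_fun_ge0 (z, w)).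
  - by apply/measurable_EFinP; apply: measurable_funM; [exact: mgw|exact: (mK1 (of_plane _))].
  - by apply: measurable_funeM; by apply/measurable_EFinP; exact: mgq.
  - move=> w Dw; rewrite -EFinM lee_fin [leRHS]mulrC -mulrA ler_wpM2l ?powR_ge0//.
    rewrite -[leRHS]mul1r; apply: ler_pM; rewrite ?powR_ge0 ?modulus_ge0//.
      have /andP[h _] := ip01.
      have e1 : (1 : R) `^ p^-1 = 1 by rewrite powR1.
      by rewrite -[leRHS]e1 ge0_ler_powR ?nnegrE ?(ltW h) ?(ltW (wt_gt0 Dw))// gerBl modulus_ge0.
    exact: modulus_kernel_le.
rewrite ge0_integralZl ?lee_fin//.
- by rewrite lte_mul_pinfty ?lee_fin.
- by apply/measurable_EFinP; exact: mgq.
- by move=> w _; rewrite lee_fin powR_ge0.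
Qed.

(** Integrating in z first, the kernel estimate cancels the weight and leaves a
    multiple of |g|^q. *)
Let integral_weighted :
  (\int[sig]_(z in D) ((wt z `^ (- p^-1))%:E * weighted z) < +oo)%E.
Proof.
have mD := @measurable_plane_disc R; have [_ gfin] := gq; have [h0 h1] := andP ip01.
pose F (zw : P * P) : \bar R := (wt zw.1 `^ (- p^-1) *
   (modulus (g zw.2) `^ q * wt zw.2 `^ p^-1 * K zw))%:E.
have F0 zw : (0 <= F zw)%E by rewrite lee_fin mulr_ge0 ?powR_ge0//; exact: (weighted_fun_ge0 zw).
have mF : measurable_fun (D `*` D) F.
  apply/measurable_EFinP; apply: measurable_funM; first exact: (measurable_comp_fst (mwt _)).
  exact: mweighted_real.
have -> : (\int[sig]_(z in D) ((wt z `^ (- p^-1))%:E * weighted z) =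
    \int[sig]_(z in D) \int[sig]_(w in D) F (z, w))%E.
  apply: eq_integral => z _; rewrite /weighted -ge0_integralZl ?lee_fin ?powR_ge0//.
  - by apply/measurable_EFinP; apply: measurable_funM; [exact: mgw|exact: (mK1 (of_plane _))].
  - by move=> w _; exact: (weighted_fun_ge0 (z, w)).
rewrite (tonelli_setX sig sig mD mD mF F0).
pose A : R := pi^-1 * (144 * (4 * schur_const p^-1)).
apply: (@le_lt_trans _ _ (\int[sig]_(w in D) (A%:E * (modulus (g w) `^ q)%:E))%E).
  apply: ge0_le_integral => //.
  - by move=> w _; apply: integral_ge0 => z _; exact: F0.
  - have mF' : measurable_fun (D `*` D) (fun wz : P * P => F (wz.2, wz.1)).
      apply/measurable_EFinP; apply: measurable_funM; first exact: (measurable_comp_snd (mwt _)).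
      apply: measurable_funM.
        by apply: measurable_funM; [exact: (measurable_comp_fst mgq)|exact: (measurable_comp_fst (mwt _))].
      apply: eq_measurable_fun mK => zw _; rewrite /K /=; exact: modulus_kernel_sym.
    by have := measurable_partial_integral sig mD mD mF'; apply.
  - by apply: measurable_funeM; by apply/measurable_EFinP; exact: mgq.
  - move=> w Dw.
    have -> : (\int[sig]_(z in D) F (z, w) = (modulus (g w) `^ q * wt w `^ p^-1)%:E *
       \int[sig]_(z in D) (wt z `^ (- p^-1) * modulus (bkernel (of_plane w) (of_plane z)))%:E)%E.
      rewrite -ge0_integralZl ?lee_fin ?mulr_ge0 ?powR_ge0//.
      - apply: eq_integral => z _; rewrite -EFinM /F /K /= modulus_kernel_sym.
        by congr EFin; ring.
      - by apply/measurable_EFinP; apply: measurable_funM; [exact: mwt|exact: (mK1 (of_plane _))].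
      - by move=> z _; rewrite lee_fin mulr_ge0 ?powR_ge0 ?modulus_ge0.
    apply: (@le_trans _ _ ((modulus (g w) `^ q * wt w `^ p^-1)%:E *
       (A * (1 - modulus (of_plane w)) `^ (- p^-1))%:E)%E).
      by rewrite lee_wpmul2l ?lee_fin ?mulr_ge0 ?powR_ge0//; exact: integral_kernel_weight_le.
    rewrite -!EFinM lee_fin -/(wt w) powRN le_eqVlt; apply/orP; left; apply/eqP.
    by field; rewrite gt_eqF// powR_gt0// wt_gt0.
rewrite ge0_integralZl ?lee_fin//.
- by rewrite lte_mul_pinfty ?lee_fin// /A mulr_ge0 ?invr_ge0 ?pi_ge0// !mulr_ge0// invr_ge0; lra.
- by apply/measurable_EFinP; exact: mgq.
- by move=> w _; rewrite lee_fin powR_ge0.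
- rewrite /A mulr_ge0 ?invr_ge0 ?pi_ge0// !mulr_ge0// invr_ge0; lra.
Qed.

Let A1 : R := pi^-1 * (144 * (4 * schur_const q^-1)).

Let A1_ge0 : 0 <= A1.
Proof.
by have [h0 h1] := andP iq01;
  rewrite /A1 mulr_ge0 ?invr_ge0 ?pi_ge0// !mulr_ge0// invr_ge0; lra.
Qed.

(** The Bergman projection with absolute values inside the integral. *)
Definition abs_projection (z : P) : \bar R :=
  (\int[sig]_(w in D) (modulus (g w) * modulus (bkernel (of_plane z) (of_plane w)))%:E)%E.

(** The bound of Schur's test for the q-th power of the previous integral. It has
    1 + B for max(1, B), where B is the weighted integral, so as to be a
    combination of integrable functions. *)
Definition abs_projection_majorant (z : P) : \bar R :=
  (((A1 / p + q^-1) `^ q)%:E * (1 + (wt z `^ (- p^-1))%:E * weighted z))%E.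

Lemma measurable_abs_projection_majorant : measurable_fun D abs_projection_majorant.
Proof.
apply: measurable_funeM; apply: emeasurable_funD; first exact: measurable_cst.
apply: emeasurable_funM; last exact: mweighted.
by apply/measurable_EFinP; exact: mwt.
Qed.

Lemma abs_projection_majorant_ge0 z : (0 <= abs_projection_majorant z)%E.
Proof.
rewrite mule_ge0 ?lee_fin ?powR_ge0// adde_ge0// mule_ge0 ?lee_fin ?powR_ge0//.
by apply: integral_ge0 => w _; exact: (weighted_fun_ge0 (z, w)).
Qed.

Lemma integral_abs_projection_majorant :
  (\int[sig]_(z in D) abs_projection_majorant z < +oo)%E.
Proof.
have mD := @measurable_plane_disc R.
have ww0 z : (0 <= (wt z `^ (- p^-1))%:E * weighted z)%E.
  rewrite mule_ge0 ?lee_fin ?powR_ge0//.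
  by apply: integral_ge0 => w _; exact: (weighted_fun_ge0 (z, w)).
have mww : measurable_fun D (fun z => (wt z `^ (- p^-1))%:E * weighted z)%E.
  apply: emeasurable_funM; last exact: mweighted.
  by apply/measurable_EFinP; exact: mwt.
rewrite ge0_integralZl ?lee_fin ?powR_ge0//.
- rewrite lte_mul_pinfty ?lee_fin ?powR_ge0//.
  rewrite (@ge0_integralD _ _ _ sig D mD (cst 1%E))//.
  apply: lte_add_pinfty; last exact: integral_weighted.
  have sD : (sig D < +oo)%E by rewrite sigma_plane_disc ltry.
  have := integrable_cst_lty 1 mD sD => /integrableP[_].
  by under eq_integral do rewrite /= normr1.
- by apply: emeasurable_funD => //; exact: measurable_cst.
- by move=> z _; rewrite adde_ge0.
Qed.

(** Schur's test at one point: Young's inequality for |g| = u v, where u and v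
    carry powers 1 / (pq) of the weights and of M = max(1, B), B being the weighted
    integral; this choice of M balances the two terms. *)
Lemma abs_projectionP z : D z -> exists2 Q : R, 0 <= Q &
  abs_projection z = Q%:E /\ ((Q `^ q)%:E <= abs_projection_majorant z)%E.
Proof.
move=> Dz; have mD := @measurable_plane_disc R.
have [hp0 hp1] := andP ip01; have [hq0 hq1] := andP iq01.
pose B := wt z `^ (- p^-1) * fine (weighted z).
have w0 : (0 <= weighted z)%E.
  by apply: integral_ge0 => w _; exact: (weighted_fun_ge0 (z, w)).
have B0 : 0 <= B by rewrite mulr_ge0 ?powR_ge0// fine_ge0.
pose M := Num.max 1 B; have M1 : 1 <= M by rewrite le_max lexx.
have BM : B <= M by rewrite le_max lexx orbT.
have M0 : 0 < M by rewrite (lt_le_trans _ M1).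
pose Y w := M `^ q^-1 * (wt z `^ q^-1 * (wt w `^ (- q^-1) * K (z, w))) / p +
   M `^ (- p^-1) * (wt z `^ (- p^-1) * (modulus (g w) `^ q * wt w `^ p^-1 * K (z, w))) / q.
have gY w : D w -> modulus (g w) * K (z, w) <= Y w.
  move=> Dw; have Wz := wt_gt0 Dz; have Ww := wt_gt0 Dw.
  pose s := p^-1 * q^-1.
  pose u := M `^ s * (wt z `^ s * wt w `^ (- s)).
  pose v := M `^ (- s) * (wt z `^ (- s) * wt w `^ s) * modulus (g w).
  have uv : u * v = modulus (g w).
    rewrite /u /v !powRN; field.
    by rewrite !gt_eqF// powR_gt0.
  have [sp sq] : s * p = q^-1 /\ s * q = p^-1.
    by rewrite /s; split; field; rewrite !gt_eqF.
  have pw (x b c : R) : (x `^ b) `^ c = x `^ (b * c) by rewrite powRrM.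
  have up : u `^ p = M `^ q^-1 * (wt z `^ q^-1 * wt w `^ (- q^-1)).
    by rewrite /u !powRM ?mulr_ge0 ?powR_ge0// !pw mulNr sp.
  have vq : v `^ q = M `^ (- p^-1) * (wt z `^ (- p^-1) * wt w `^ p^-1) * modulus (g w) `^ q.
    by rewrite /v !powRM ?mulr_ge0 ?powR_ge0 ?modulus_ge0// !pw !mulNr sq.
  have u0 : 0 <= u by rewrite !mulr_ge0 ?powR_ge0.
  have v0 : 0 <= v by rewrite !mulr_ge0 ?powR_ge0 ?modulus_ge0.
  have := conjugate_powR u0 v0 p0 q0 pq; rewrite uv up vq.
  have K0 : 0 <= K (z, w) by exact: modulus_ge0.
  move=> /(ler_wpM2r K0)/le_trans; apply; rewrite /Y le_eqVlt; apply/orP; left; apply/eqP.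
  by ring.
have mY1 : measurable_fun D (fun w => (wt w `^ (- q^-1) * K (z, w))%:E).
  by apply/measurable_EFinP; apply: measurable_funM; [exact: mwt|exact: (mK1 (of_plane _))].
have mY2 : measurable_fun D (fun w => (modulus (g w) `^ q * wt w `^ p^-1 * K (z, w))%:E).
  by apply/measurable_EFinP; apply: measurable_funM; [exact: mgw|exact: (mK1 (of_plane _))].
pose c1 := M `^ q^-1 * wt z `^ q^-1 / p.
pose c2 := M `^ (- p^-1) * wt z `^ (- p^-1) / q.
have c10 : 0 <= c1 by rewrite !mulr_ge0 ?powR_ge0// invr_ge0 ltW.
have c20 : 0 <= c2 by rewrite !mulr_ge0 ?powR_ge0// invr_ge0 ltW.
have Wz := wt_gt0 Dz.
have ub : (abs_projection z <= ((A1 / p + q^-1) * M `^ q^-1)%:E)%E.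
  apply: (@le_trans _ _ (\int[sig]_(w in D) (c1%:E * (wt w `^ (- q^-1) * K (z, w))%:E +
     c2%:E * (modulus (g w) `^ q * wt w `^ p^-1 * K (z, w))%:E))%E).
    apply: ge0_le_integral => //.
    - by move=> w _; rewrite lee_fin mulr_ge0 ?modulus_ge0.
    - by apply/measurable_EFinP; apply: measurable_funM; [exact: mg|exact: (mK1 (of_plane _))].
    - by apply: emeasurable_funD; apply: measurable_funeM.
    - move=> w Dw; rewrite -!EFinM -EFinD lee_fin (le_trans (gY _ Dw))//.
      by rewrite /Y /c1 /c2 le_eqVlt; apply/orP; left; apply/eqP; ring.
  rewrite ge0_integralD//; last 4 first.
  - by move=> w _; apply: mule_ge0; rewrite lee_fin ?c10 ?c20// !mulr_ge0 ?powR_ge0 ?modulus_ge0.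
  - exact: measurable_funeM.
  - by move=> w _; apply: mule_ge0; rewrite lee_fin ?c10 ?c20// !mulr_ge0 ?powR_ge0 ?modulus_ge0.
  - exact: measurable_funeM.
  rewrite ge0_integralZl ?lee_fin//; last first.
    by move=> w _; rewrite lee_fin mulr_ge0 ?powR_ge0 ?modulus_ge0.
  rewrite ge0_integralZl ?lee_fin//; last first.
    by move=> w _; rewrite lee_fin !mulr_ge0 ?powR_ge0 ?modulus_ge0.
  rewrite -/(weighted z) -(fineK (weighted_fin Dz)).
  apply: (@le_trans _ _ (c1%:E * (A1 * wt z `^ (- q^-1))%:E + c2%:E * (fine (weighted z))%:E)%E).
    rewrite leeD2r// lee_wpmul2l ?lee_fin//.
    exact: (@integral_kernel_weight_le R q^-1 hq0 hq1 (of_plane z) Dz).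
  rewrite -!EFinM -EFinD lee_fin mulrDl lerD//.
    rewrite /c1 powRN le_eqVlt; apply/orP; left; apply/eqP; field.
    by rewrite !gt_eqF// powR_gt0.
  have -> : c2 * fine (weighted z) = q^-1 * (M `^ (- p^-1) * B).
    by rewrite /c2 /B; ring.
  rewrite ler_wpM2l ?(ltW hq0)//.
  have -> : q^-1 = 1 + - p^-1 by rewrite -pq addrAC subrr add0r.
  rewrite powRD ?(gt_eqF M0) ?implybT// powRr1 ?(ltW M0)// mulrC.
  by rewrite ler_wpM2r ?powR_ge0.
have a0 : (0 <= abs_projection z)%E.
  by apply: integral_ge0 => w _; rewrite lee_fin mulr_ge0 ?modulus_ge0.
have afin : abs_projection z \is a fin_num.
  by rewrite ge0_fin_numE// (le_lt_trans ub)// ltry.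
exists (fine (abs_projection z)); first exact: fine_ge0.
split; first by rewrite fineK.
have -> : abs_projection_majorant z = ((A1 / p + q^-1) `^ q * (1 + B))%:E.
  by rewrite /abs_projection_majorant -(fineK (weighted_fin Dz)).
rewrite lee_fin.
have A1pq : 0 <= A1 / p + q^-1 by exact: addr_ge0 (divr_ge0 A1_ge0 (ltW p0)) (ltW hq0).
have ub' : fine (abs_projection z) <= (A1 / p + q^-1) * M `^ q^-1.
  by rewrite -lee_fin fineK.
apply: (@le_trans _ _ (((A1 / p + q^-1) * M `^ q^-1) `^ q)).
  by rewrite ge0_ler_powR ?nnegrE ?(ltW q0) ?fine_ge0// mulr_ge0 ?powR_ge0.
rewrite powRM ?powR_ge0// -powRrM mulVf ?gt_eqF// powRr1 ?(ltW M0)//.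
by rewrite ler_wpM2l ?powR_ge0// /M ge_max lerDl B0 lerDr ler01.
Qed.

End SchurTest.

(** * The Bergman projection *)

Section BergmanProjection.
Variable R : realType.
Local Notation C := R[i].
Local Notation P := (measurableTypeR R * measurableTypeR R)%type.
Local Notation sig := (@sigma R).
Local Notation D := (@plane_disc R).
Implicit Types (f : C -> C) (g h : P -> C).

Definition plane_proj g (z : C) : C := cint sig D (fun w => g w * bkernel z (of_plane w)).

Lemma bergman_projE f z : bergman_proj f z = plane_proj (f \o @of_plane R) z.
Proof. by []. Qed.

Lemma sigma_disc_lty : (sig D < +oo)%E.
Proof. by rewrite sigma_plane_disc ltry. Qed.

Lemma measurable_lp_power (r : R) g : cmeasurable D g ->
  measurable_fun D (fun xy => modulus (g xy) `^ r).
Proof. by move=> /measurable_modulus; exact: measurableT_comp (measurable_powR _). Qed.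

Lemma integrable_lp_power (r : R) g : lp r g ->
  sig.-integrable D (EFin \o (fun xy => modulus (g xy) `^ r)).
Proof.
move=> [mg goo]; apply/integrableP; split.
  by apply/measurable_EFinP; exact: measurable_lp_power.
by under eq_integral do rewrite /= ger0_norm ?powR_ge0//.
Qed.

Lemma lp_bounded (r M : R) g : 0 <= r -> cmeasurable D g ->
  (forall xy, D xy -> modulus (g xy) <= M) -> lp r g.
Proof.
move=> r0 mg gM; split => //; have mD := @measurable_plane_disc R.
apply: (@le_lt_trans _ _ (\int[sig]_(xy in D) (`|M| `^ r)%:E)%E).
  apply: ge0_le_integral => //.
  - by move=> xy _; rewrite lee_fin powR_ge0.
  - by apply/measurable_EFinP; exact: measurable_lp_power.
  - move=> xy Dxy; rewrite lee_fin ge0_ler_powR ?nnegrE ?modulus_ge0//.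
    by rewrite (le_trans (gM _ Dxy))// ler_norm.
have /integrableP[_] := integrable_cst_lty (`|M| `^ r) mD sigma_disc_lty.
by under eq_integral do rewrite /= ger0_norm ?powR_ge0//.
Qed.

Lemma lp_cst (r : R) (c : C) : 0 <= r -> lp r (fun=> c).
Proof.
move=> r0; have mc : cmeasurable D (fun=> c) by exact: cmeasurable_cst.
exact: (@lp_bounded r (modulus c) (fun=> c) r0 mc).
Qed.

Lemma lp_linear (r : R) (c : C) f g : 0 < r -> lp r (f \o @of_plane R) -> lp r g ->
  lp r (fun xy => c * f (of_plane xy) + g xy).
Proof.
move=> r0 [mf foo] [mg goo]; have mD := @measurable_plane_disc R.
have mcf : cmeasurable D (fun xy => c * f (of_plane xy)).
  by apply: cmeasurableM => //; exact: cmeasurable_cst.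
split; first exact: cmeasurableD.
pose B (xy : P) : R := 2 `^ r * (modulus c `^ r * modulus (f (of_plane xy)) `^ r + modulus (g xy) `^ r).
have iB : sig.-integrable D (EFin \o B).
  have i1 := integrableZl mD (modulus c `^ r) (integrable_lp_power (conj mf foo)).
  have i2 := integrableD mD i1 (integrable_lp_power (conj mg goo)).
  exact: (integrableZl mD (2 `^ r) i2).
have h : sig.-integrable D (EFin \o (fun xy => modulus (c * f (of_plane xy) + g xy) `^ r)).
  apply: le_integrable iB => //.
    by apply/measurable_EFinP; apply: measurable_lp_power; exact: cmeasurableD.
  move=> xy Dxy /=; rewrite lee_fin ger0_norm ?powR_ge0//.
  rewrite (le_trans _ (ler_norm _))// /B.
  set x := modulus c `^ r * _; have x0 : 0 <= x by rewrite mulr_ge0 ?powR_ge0.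
  have xE : x = modulus (c * f (of_plane xy)) `^ r.
    by rewrite modulusM powRM ?modulus_ge0.
  set u := modulus (c * f (of_plane xy)) in xE.
  have u0 : 0 <= u by exact: modulus_ge0.
  have v0 : 0 <= modulus (g xy) by exact: modulus_ge0.
  have T := ler_modulusD (c * f (of_plane xy)) (g xy).
  have [uv|/ltW vu] := leP u (modulus (g xy)).
    apply: (@le_trans _ _ ((2 * modulus (g xy)) `^ r)).
      by rewrite ge0_ler_powR ?nnegrE ?modulus_ge0 ?mulr_ge0 ?(ltW r0)// (le_trans T)// -/u; lra.
    by rewrite powRM// ler_wpM2l ?powR_ge0// lerDr.
  apply: (@le_trans _ _ ((2 * u) `^ r)).
    by rewrite ge0_ler_powR ?nnegrE ?modulus_ge0 ?mulr_ge0 ?(ltW r0)// (le_trans T)// -/u; lra.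
  by rewrite powRM// ler_wpM2l ?powR_ge0// -xE lerDl powR_ge0.
have /integrableP[_] := h.
by under eq_integral do rewrite /= ger0_norm ?powR_ge0//.
Qed.

Section Exponents.
Variables p q : R.
Hypotheses (p1 : 1 < p) (pq : p^-1 + q^-1 = 1).

Let p0 : 0 < p. Proof. exact: lt_trans ltr01 p1. Qed.
Let q1 : 1 < q. Proof. exact: conj_exponent_gt1 p1 pq. Qed.
Let q0 : 0 < q. Proof. exact: lt_trans ltr01 q1. Qed.

Lemma lp_mul_integrable g h : lp p g -> lp q h ->
  cintegrable sig D (fun xy => g xy * h xy).
Proof.
move=> gp hq; have mD := @measurable_plane_disc R.
have [mg _] := gp; have [mh _] := hq.
have i1 := integrableZl mD p^-1 (integrable_lp_power gp).
have i2 := integrableZl mD q^-1 (integrable_lp_power hq).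
apply: (@le_cintegrable _ _ _ _ _ mD _ (fun xy =>
   p^-1 * modulus (g xy) `^ p + q^-1 * modulus (h xy) `^ q)).
- exact: cmeasurableM.
- exact: (integrableD mD i1 i2).
- move=> xy _; rewrite modulusM.
  have := conjugate_powR (modulus_ge0 (g xy)) (modulus_ge0 (h xy)) p0 q0 pq.
  by rewrite [_ / p]mulrC [_ / q]mulrC.
Qed.

Lemma lp_integrable g : lp p g -> cintegrable sig D g.
Proof.
move=> gp; have mD := @measurable_plane_disc R.
have h1 := lp_cst (1 : C) (ltW q0).
by apply: (eq_cintegrable mD _ (lp_mul_integrable gp h1)) => xy _; rewrite mulr1.
Qed.

(** The kernel is expanded about z0 and integrated term by term; the remainder of
    the expansion is uniform in the variable of integration. *)
Lemma proj_analytic g : cintegrable sig D g -> analytic_on_disc (plane_proj g).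
Proof.
move=> ig z0 z0D; have mD := @measurable_plane_disc R.
have d0 : 0 < 1 - modulus z0 by rewrite subr_gt0.
pose t n (w : P) : C := n.+1%:R * (((of_plane w)^*) ^+ n / (1 - (of_plane w)^* * z0) ^+ n.+2).
have mop := @cmeasurable_of_plane_disc R.
have mt n : cmeasurable D (t n).
  apply: cmeasurableM; first exact: cmeasurable_cst.
  apply: cmeasurableM; first by apply: cmeasurableX; exact: cmeasurable_conj.
  apply: cmeasurableV; apply: cmeasurableX; apply: cmeasurableD; first exact: cmeasurable_cst.
  apply: cmeasurableN; apply: cmeasurableM; last exact: cmeasurable_cst.
  exact: cmeasurable_conj.
have c1 w : D w -> modulus (of_plane w)^* <= 1.
  by move=> Dw; rewrite modulus_conj; exact: ltW.
have tb n w : D w -> modulus (t n w) <= n.+1%:R / (1 - modulus z0) ^+ n.+2.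
  move=> Dw; have [h nz] := kernel_neq0 (c1 _ Dw) z0D.
  rewrite /t modulusM modulus_natr ler_wpM2l// modulusM modulusV !modulusX.
  rewrite -[leRHS]mul1r; apply: ler_pM.
  - by rewrite exprn_ge0// modulus_ge0.
  - by rewrite invr_ge0 exprn_ge0// modulus_ge0.
  - by rewrite exprn_ile1 ?modulus_ge0// c1.
  - rewrite lef_pV2 ?posrE ?exprn_gt0 ?modulus_gt0//.
    by rewrite lerXn2r ?nnegrE ?modulus_ge0 ?(ltW d0).
have it n : cintegrable sig D (fun w => g w * t n w).
  exact: cintegrable_mul_bounded ig (mt n) (tb n).
exists (fun n => cint sig D (fun w => g w * t n w)).
exists ((1 - modulus z0) / 2); split; first by rewrite divr_gt0.
move=> z zr; apply/cvg_modulusP.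
have zD : disc z.
  rewrite /disc /=; have := ler_modulusB z z0; move: zr; lra.
pose I := \int[sig]_(w in D) modulus (g w).
have c0 : 0 @[n --> \oo] --> (0 : R) by exact: cvg_cst.
have g0 : 4 / (1 - modulus z0) ^+ 2 * ((2 * N%:R + 1) * (1 / 2) ^+ N) * I
    @[N --> \oo] --> (0 : R).
  rewrite -[X in _ --> X](mul0r I); apply: cvgM; last exact: cvg_cst.
  rewrite -[X in _ --> X](mulr0 (4 / (1 - modulus z0) ^+ 2)).
  by apply: cvgM; [exact: cvg_cst|exact: cvg_geometric2_remainder].
apply: (squeeze_cvgr _ c0 g0); apply: nearW => N.
rewrite modulus_ge0 /= modulusB.
have ik := cintegrable_mul_kernel zD ig.
have is_ : cintegrable sig D (fun w => \sum_(0 <= n < N) (z - z0) ^+ n * (g w * t n w)).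
  by apply: (cintegrable_sum mD) => n; exact: cintegrableZ.
have -> : plane_proj g z - series (fun n => cint sig D (fun w => g w * t n w) * (z - z0) ^+ n) N =
    cint sig D (fun w => g w * (bkernel z (of_plane w) -
      \sum_(0 <= n < N) t n w * (z - z0) ^+ n)).
  rewrite /series /= (eq_bigr (fun n => cint sig D (fun w => (z - z0) ^+ n * (g w * t n w)))); last first.
    by move=> n _; rewrite cintZ// mulrC.
  rewrite -cint_sum//; last by move=> n; exact: cintegrableZ.
  rewrite -(cintN mD is_) -(cintD mD ik); last first.
    apply: (eq_cintegrable mD _ (cintegrableZ mD (-1) is_)) => w _; exact: mulN1r.
  apply: eq_cint => w _; rewrite mulrBr; congr (_ - _).
  by rewrite big_distrr/=; apply: eq_bigr => n _; ring.
set E := (fun w => g w * _).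
have Eb w : D w -> modulus (E w) <= 4 / (1 - modulus z0) ^+ 2 * ((2 * N%:R + 1) * (1 / 2) ^+ N) * modulus (g w).
  move=> Dw; rewrite /E modulusM mulrC ler_wpM2r ?modulus_ge0//.
  by apply: kernel_remainder; [exact: c1|exact: z0D|exact: ltW].
have iE : cintegrable sig D E.
  have := cintegrableD mD ik (cintegrableZ mD (-1) is_).
  apply: (eq_cintegrable mD) => w _; rewrite /E mulrBr mulN1r; congr (_ - _).
  by rewrite big_distrr/=; apply: eq_bigr => n _; ring.
rewrite (le_trans (modulus_cint mD iE))//.
have img := integrable_modulus mD ig.
rewrite /I -RintegralZl//; apply: le_Rintegral => //.
- exact: integrable_modulus.
- exact: (integrableZl mD _ img).
Qed.

(** The modulus of the projection is at most the integral of |g| |K|, whose q-th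
    power has the integrable majorant of Schur's test. *)
Lemma proj_lp g : lp q g -> lp q (plane_proj g \o @of_plane R).
Proof.
move=> gq; have mD := @measurable_plane_disc R.
have ig : cintegrable sig D g.
  have h1 := lp_cst (1 : C) (ltW p0).
  by apply: (eq_cintegrable mD _ (lp_mul_integrable h1 gq)) => xy _; rewrite mul1r.
have mp := cmeasurable_analytic (proj_analytic ig).
split => //.
apply: (@le_lt_trans _ _ (\int[sig]_(z in D) abs_projection_majorant p q g z)%E); last first.
  exact: (integral_abs_projection_majorant p1 gq).
apply: ge0_le_integral => //.
- by move=> z _; rewrite lee_fin powR_ge0.
- by apply/measurable_EFinP; exact: measurable_lp_power.
- exact: (measurable_abs_projection_majorant p gq).
- move=> z Dz; have [Q Q0 [aQ Qm]] := abs_projectionP p1 pq gq Dz.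
  apply: le_trans Qm; rewrite lee_fin ge0_ler_powR ?nnegrE ?modulus_ge0 ?(ltW q0)//.
  have ik := cintegrable_mul_kernel Dz ig.
  rewrite (le_trans (modulus_cint mD ik))// -lee_fin -aQ /abs_projection.
  have imk := integrable_modulus mD ik.
  rewrite /Rintegral fineK; last exact: integrable_fin_num.
  by rewrite le_eqVlt; apply/orP; left; apply/eqP; apply: eq_integral => w _; rewrite modulusM.
Qed.

(** Self-adjointness of the projection: after the interchange of the integrals,
    the inner one is the reproducing formula for f. The interchange is licensed
    by the integrable majorant of Schur's test. *)
Lemma proj_adjoint f g : analytic_on_disc f -> lp p (f \o @of_plane R) -> lp q g ->
  cint sig D (fun z => f (of_plane z) * (plane_proj g (of_plane z))^*) =
  cint sig D (fun w => f (of_plane w) * (g w)^*).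
Proof.
move=> fa fp gq; have mD := @measurable_plane_disc R.
have if_ := lp_integrable fp.
have [mf ffin] := fp; have [mg gfin] := gq.
have ig : cintegrable sig D g.
  have h1 := lp_cst (1 : C) (ltW p0).
  by apply: (eq_cintegrable mD _ (lp_mul_integrable h1 gq)) => xy _; rewrite mul1r.
pose F (zw : P * P) : C := f (of_plane zw.1) * ((g zw.2)^* * bkernel (of_plane zw.2) (of_plane zw.1)).
have mF : cmeasurable (D `*` D) F.
  apply: cmeasurableM; first exact: (cmeasurable_comp_fst mf).
  apply: cmeasurableM; first by apply: cmeasurable_conj; exact: cmeasurable_comp_snd.
  have [k1 k2] := cmeasurable_conj (@cmeasurable_kernel2 R).
  split; [apply: eq_measurable_fun k1|apply: eq_measurable_fun k2] => zw _;
    by rewrite kernel_conj.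
have Fz z : D z -> cintegrable sig D (fun w => F (z, w)).
  move=> Dz; have := cintegrableZ mD (f (of_plane z)) (cintegrable_conj mD (cintegrable_mul_kernel Dz ig)).
  by apply: (eq_cintegrable mD) => w _; rewrite conjC_M kernel_conj.
have Fw w : D w -> cintegrable sig D (fun z => F (z, w)).
  move=> Dw; have := cintegrableZ mD ((g w)^*) (cintegrable_mul_kernel Dw if_).
  by apply: (eq_cintegrable mD) => z _; rewrite /F /=; ring.
have Foo : (\int[sig]_(z in D) \int[sig]_(w in D) (modulus (F (z, w)))%:E < +oo)%E.
  have mmF : measurable_fun (D `*` D) (fun zw => (modulus (F zw))%:E).
    by apply/measurable_EFinP; exact: measurable_modulus.
  apply: (@le_lt_trans _ _ (\int[sig]_(z in D) (p^-1%:E * (modulus (f (of_plane z)) `^ p)%:E +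
      q^-1%:E * abs_projection_majorant p q g z))%E).
    apply: ge0_le_integral => //.
    - by move=> z _; apply: integral_ge0 => w _; rewrite lee_fin modulus_ge0.
    - by apply: (measurable_partial_integral sig mD mD mmF) => zw; rewrite lee_fin modulus_ge0.
    - apply: emeasurable_funD; apply: measurable_funeM.
        by apply/measurable_EFinP; exact: measurable_lp_power.
      exact: (measurable_abs_projection_majorant p gq).
    - move=> z Dz; have [Q Q0 [aQ Qm]] := abs_projectionP p1 pq gq Dz.
      have -> : (\int[sig]_(w in D) (modulus (F (z, w)))%:E =
          (modulus (f (of_plane z)))%:E * abs_projection g z)%E.
        rewrite /abs_projection -ge0_integralZl ?lee_fin ?modulus_ge0//.
        + apply: eq_integral => w _; rewrite -EFinM /F /= !modulusM modulus_conj.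
          by rewrite (modulus_kernel_sym (of_plane w)).
        + apply/measurable_EFinP; apply: measurable_funM; first exact: measurable_modulus.
          exact: measurable_modulus (cmeasurable_kernel _).
        + by move=> w _; rewrite lee_fin mulr_ge0 ?modulus_ge0.
      rewrite aQ -EFinM.
      have Y := conjugate_powR (modulus_ge0 (f (of_plane z))) Q0 p0 q0 pq.
      apply: (@le_trans _ _ (p^-1 * modulus (f (of_plane z)) `^ p + q^-1 * Q `^ q)%:E).
        by rewrite lee_fin [p^-1 * _]mulrC [q^-1 * _]mulrC.
      rewrite EFinD !EFinM leeD2l// lee_wpmul2l// lee_fin invr_ge0 ltW//.
  rewrite ge0_integralD//; last 4 first.
  - by move=> z _; rewrite -EFinM lee_fin mulr_ge0 ?powR_ge0// invr_ge0 ltW.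
  - apply: measurable_funeM; apply/measurable_EFinP; exact: measurable_lp_power.
  - by move=> z _; rewrite mule_ge0 ?abs_projection_majorant_ge0// lee_fin invr_ge0 ltW.
  - apply: measurable_funeM; exact: (measurable_abs_projection_majorant p gq).
  apply: lte_add_pinfty.
  - rewrite ge0_integralZl ?lee_fin ?invr_ge0 ?(ltW p0)//.
    + by rewrite lte_mul_pinfty ?lee_fin ?invr_ge0 ?(ltW p0).
    + by apply/measurable_EFinP; exact: measurable_lp_power.
    + by move=> z _; rewrite lee_fin powR_ge0.
  - rewrite ge0_integralZl ?lee_fin ?invr_ge0 ?(ltW q0)//.
    + by rewrite lte_mul_pinfty ?lee_fin ?invr_ge0 ?(ltW q0)//; exact: (integral_abs_projection_majorant p1 gq).
    + exact: (measurable_abs_projection_majorant p gq).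
    + by move=> z _; exact: abs_projection_majorant_ge0.
transitivity (cint sig D (fun z => cint sig D (fun w => F (z, w)))).
  apply: eq_cint => z Dz; rewrite -(cint_conj mD (cintegrable_mul_kernel Dz ig)) -cintZ//.
    by apply: eq_cint => w _; rewrite conjC_M kernel_conj.
  exact: (cintegrable_conj mD (cintegrable_mul_kernel Dz ig)).
rewrite (cint_fubini mD mD mF Foo Fz Fw).
apply: eq_cint => w Dw.
transitivity ((g w)^* * cint sig D (fun z => f (of_plane z) * bkernel (of_plane w) (of_plane z))).
  rewrite -cintZ//; last exact: cintegrable_mul_kernel.
  by apply: eq_cint => z _; rewrite /F /=; ring.
by rewrite (reproducing fa Dw if_) mulrC.
Qed.

End Exponents.
End BergmanProjection.

(** * Extremal functions *)

Section Duality.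
Variable R : realType.
Local Notation C := R[i].
Local Notation P := (measurableTypeR R * measurableTypeR R)%type.
Local Notation sig := (@sigma R).
Local Notation D := (@plane_disc R).
Implicit Types (f h F : C -> C) (z w : C).

Lemma bergman_lp (r : R) f : bergman r f -> lp r (f \o @of_plane R).
Proof. by move=> [fa foo]; split => //; exact: cmeasurable_analytic. Qed.

Lemma bergman_linear (r : R) (c : C) f h : 0 < r ->
  bergman r f -> bergman r h -> bergman r (fun z => c * f z + h z).
Proof.
move=> r0 bf bh; split; first by apply: analytic_linear; [case: bf|case: bh].
by have [] := lp_linear c r0 (bergman_lp bf) (bergman_lp bh).
Qed.

Lemma bergman0 (r : R) : 0 < r -> bergman r (fun=> 0 : C).
Proof.
move=> r0; split.
  move=> z0 _; exists (fun=> 0), 1; split=> // z _; apply/cvg_modulusP.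
  have c0 : 0 @[n --> \oo] --> (0 : R) by exact: cvg_cst.
  apply: cvg_trans c0; apply: near_eq_cvg; apply: nearW => n.
  by rewrite /series /= big1 ?subrr ?modulus0// => i _; rewrite mul0r.
by have [_] := lp_cst (0 : C) (ltW r0).
Qed.

Lemma bergman_scale (r : R) (c : C) f : 0 < r -> bergman r f ->
  bergman r (fun z => c * f z).
Proof.
move=> r0 bf; have := bergman_linear c r0 bf (bergman0 r0).
by congr (bergman r _); apply/funext => z; rewrite addr0.
Qed.

Lemma bergman_kernel (r : R) z : 0 < r -> disc z -> bergman r (fun w => bkernel w z).
Proof.
move=> r0 zD; have z1 : modulus z^* <= 1 by rewrite modulus_conj; exact: ltW.
have an := analytic_kernel z1; split => //.
have [] // := @lp_bounded R r ((1 - modulus z) ^- 2)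
  ((fun w => bkernel w z) \o @of_plane R) (ltW r0) (cmeasurable_analytic an).
by move=> xy Dxy /=; rewrite modulus_kernel_sym; exact: modulus_kernel_le.
Qed.

Lemma bergman_norm_ge0 (r : R) f : 0 <= bergman_norm r f.
Proof. exact: powR_ge0. Qed.

Lemma bergman_norm_powR (r : R) f : 0 < r ->
  bergman_norm r f `^ r = \int[sig]_(xy in D) modulus (f (of_plane xy)) `^ r.
Proof.
move=> r0; rewrite /bergman_norm -powRrM mulVf ?gt_eqF// powRr1//.
by apply: Rintegral_ge0 => xy _; exact: powR_ge0.
Qed.

Lemma bergman_norm_scale (r : R) (c : C) f : 0 < r -> bergman r f ->
  bergman_norm r (fun z => c * f z) = modulus c * bergman_norm r f.
Proof.
move=> r0 bf; have mD := @measurable_plane_disc R.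
apply: (powR_injective r0); rewrite ?nnegrE ?mulr_ge0 ?bergman_norm_ge0 ?modulus_ge0//.
have m0 := modulus_ge0 c; have n0 := bergman_norm_ge0 r f.
have e := powRM r m0 n0; rewrite e.
apply: (etrans (bergman_norm_powR _ r0)).
have e2 := bergman_norm_powR f r0; rewrite e2.
have iF := integrable_lp_power (bergman_lp bf).
rewrite -(RintegralZl (modulus c `^ r) mD iF).
by apply: eq_Rintegral => xy _; rewrite modulusM powRM ?modulus_ge0.
Qed.

Section DensityMap.
Variables p q : R.
Hypotheses (p1 : 1 < p) (pq : p^-1 + q^-1 = 1).

Let p0 : 0 < p. Proof. exact: lt_trans ltr01 p1. Qed.
Let q1 : 1 < q. Proof. exact: conj_exponent_gt1 p1 pq. Qed.
Let q0 : 0 < q. Proof. exact: lt_trans ltr01 q1. Qed.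
Let qp : q^-1 + p^-1 = 1. Proof. by rewrite addrC. Qed.

(** The duality map of L^p, one point at a time: extremal_density p F is the
    composition of F with this map. *)
Definition density w : C := (modulus w `^ (p - 1))%:C * csgn w.

Lemma conj_exponentE : (p - 1) * q = p.
Proof.
have -> : p - 1 = p / q by have -> : q^-1 = 1 - p^-1; [rewrite -pq addrAC subrr add0r|field; rewrite gt_eqF].
by rewrite mulfVK// gt_eqF.
Qed.

Lemma modulus_density w : modulus (density w) = modulus w `^ (p - 1).
Proof.
rewrite /density modulusM modulus_real ger0_norm ?powR_ge0// modulus_csgn.
case: eqVneq => [->|_]; last by rewrite mulr1.
by rewrite mulr0 modulus0 powR0// subr_eq0 gt_eqF.
Qed.

Lemma modulus_density_powR w : modulus (density w) `^ q = modulus w `^ p.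
Proof. by rewrite modulus_density -powRrM conj_exponentE. Qed.

Lemma mul_conj_density w : w * (density w)^* = (modulus w `^ p)%:C.
Proof.
rewrite /density conjC_M conjC_real {1}(csgnE w) mulrACA -rmorphM/=.
rewrite mulr_powRB1 ?modulus_ge0// mul_conjC modulus_csgn.
case: eqVneq => [->|_]; last by rewrite expr1n mulr1.
by rewrite modulus0 powR0 ?gt_eqF// mul0r.
Qed.

Lemma densityE w : density w = (modulus w `^ (p - 1) / modulus w)%:C * w.
Proof.
rewrite {4}(csgnE w) mulrA -rmorphM/= /density.
have [->|w0] := eqVneq w 0; first by rewrite /csgn eqxx !mulr0.
by rewrite divfK// modulus_eq0.
Qed.

(** Away from 0 the map is a continuous multiple of w; at 0 it is continuous
    because its modulus is |w|^(p-1) with p > 1. *)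
Lemma density_continuous (u : nat -> C) w :
  modulus (u n - w) @[n --> \oo] --> (0 : R) ->
  modulus (density (u n) - density w) @[n --> \oo] --> (0 : R).
Proof.
move=> uw.
have mu : modulus (u n) @[n --> \oo] --> modulus w.
  apply/cvgrPdist_le => e e0; have /cvgrPdist_le/(_ _ e0) := uw.
  apply: filterS => n; rewrite sub0r normrN ger0_norm ?modulus_ge0// => h.
  rewrite ler_norml; have := ler_modulusB (u n) w; have := ler_modulusB w (u n).
  by rewrite (modulusB w); lra.
have c0 : 0 @[n --> \oo] --> (0 : R) by exact: cvg_cst.
have [w0|w0] := eqVneq w 0.
  have p10 : 0 < p - 1 by rewrite subr_gt0.
  have d0 : density w = 0 by rewrite densityE w0 mulr0.
  apply/cvgrPdist_lt => e e0.
  have e1 : 0 < e `^ (p - 1)^-1 by rewrite powR_gt0.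
  have /cvgrPdist_lt/(_ _ e1) := uw; apply: filterS => n.
  rewrite !sub0r !normrN !ger0_norm ?modulus_ge0// d0 w0 !subr0 modulus_density => h.
  have := gt0_ltr_powR p10; move=> /(_ _ _ _ _ h); rewrite !nnegrE modulus_ge0 powR_ge0.
  by move=> /(_ erefl erefl); rewrite -powRrM mulVf ?gt_eqF// powRr1// ltW.
have mw : 0 < modulus w by rewrite modulus_gt0.
pose k (r : R) := r `^ (p - 1) / r.
have ck : k (modulus (u n)) @[n --> \oo] --> k (modulus w).
  have ck : {for modulus w, continuous k}.
    apply: cvgM; last by apply: cvgV; [rewrite gt_eqF|exact: cvg_id].
    have [/derivable1_diffP/differentiable_continuous du _] := is_derive1_powR (p - 1) mw.
    exact: du.
  exact: (cvg_comp _ _ mu ck).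
have ck0 : `|k (modulus (u n)) - k (modulus w)| @[n --> \oo] --> (0 : R).
  have := cvg_norm (cvgB ck (cvg_cst (k (modulus w)))).
  by rewrite subrr normr0; apply.
have bound : `|k (modulus (u n)) - k (modulus w)| * modulus (u n) +
    k (modulus w) * modulus (u n - w) @[n --> \oo] --> (0 : R).
  have := cvgD (cvgM ck0 mu) (cvgM (cvg_cst (k (modulus w))) uw).
  by rewrite mul0r mulr0 addr0; apply.
apply: (squeeze_cvgr _ c0 bound); apply: nearW => n.
rewrite modulus_ge0 !densityE -/(k (modulus (u n))) -/(k (modulus w)).
rewrite (_ : _ - _ = (k (modulus (u n)) - k (modulus w))%:C * u n +
  (k (modulus w))%:C * (u n - w)); last by rewrite rmorphB/=; ring.
rewrite (le_trans (ler_modulusD _ _))// !modulusM !modulus_real lerD2l.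
by rewrite ger0_norm// divr_ge0 ?powR_ge0 ?modulus_ge0.
Qed.

(** Convexity of |.|^p, by Young's inequality: the density at b is a
    subgradient. *)
Lemma powR_subgradient (a b : C) :
  modulus b `^ p - modulus a `^ p <= p * complex.Re ((b - a) * (density b)^*).
Proof.
rewrite mulrBl mul_conj_density cReD cReN /=.
have h1 : complex.Re (a * (density b)^*) <= modulus a `^ p / p + modulus b `^ p / q.
  rewrite (le_trans (ler_Re_modulus _))// modulusM modulus_conj.
  by rewrite -(modulus_density_powR b); apply: conjugate_powR; rewrite ?modulus_ge0.
have h2 : p * complex.Re (a * (density b)^*) <= modulus a `^ p + modulus b `^ p * (p - 1).
  have := ler_wpM2l (ltW p0) h1; rewrite mulrDr mulrCA divff ?gt_eqF// mulr1.
  move=> /le_trans; apply; rewrite lerD2l mulrCA ler_wpM2l ?powR_ge0//.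
  by rewrite -{1}conj_exponentE mulfK// gt_eqF.
rewrite mulrBr; lra.
Qed.

Lemma lp_density (f : P -> C) : lp p f -> lp q (density \o f).
Proof.
move=> [mf foo]; have mD := @measurable_plane_disc R; split.
  apply: cmeasurableM; last exact: (cmeasurable_csgn mD mf).
  by apply: cmeasurable_real; exact: measurable_lp_power.
by under eq_integral do rewrite /= modulus_density_powR.
Qed.

(** Young's inequality for f / |f| and G, or for large multiples of f when
    |f| = 0. *)
Lemma lp_holder f (G : P -> C) : bergman p f -> lp q G ->
  \int[sig]_(xy in D) modulus (G xy) `^ q = 1 ->
  modulus (cint sig D (fun xy => f (of_plane xy) * (G xy)^*)) <= bergman_norm p f.
Proof.
move=> bf Gq G1; have mD := @measurable_plane_disc R.
set N := bergman_norm p f; have N0 : 0 <= N by exact: bergman_norm_ge0.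
have cG : lp q (fun xy => (G xy)^*).
  case: Gq => mG Goo; split; first exact: cmeasurable_conj.
  by under eq_integral do rewrite modulus_conj.
have ifG := lp_mul_integrable p1 pq (bergman_lp bf) cG.
set x := modulus _; have x0 : 0 <= x by exact: modulus_ge0.
have young (l : R) : 0 < l -> l * x <= (l * N) `^ p / p + q^-1.
  move=> l0; have l0' := ltW l0.
  have i1 := integrableZl mD (l `^ p / p) (integrable_lp_power (bergman_lp bf)).
  have i2 := integrableZl mD q^-1 (integrable_lp_power Gq).
  have imf := integrable_modulus mD ifG.
  have := RintegralD mD i1 i2.
  have := RintegralZl (l `^ p / p) mD (integrable_lp_power (bergman_lp bf)).
  have := RintegralZl q^-1 mD (integrable_lp_power Gq) => /= -> -> eI.
  rewrite powRM// (bergman_norm_powR f p0) mulrAC -[X in _ + X]mulr1 -G1 -eI.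
  apply: (@le_trans _ _ (\int[sig]_(xy in D) (l * modulus (f (of_plane xy) * (G xy)^*)))).
    have -> := RintegralZl l mD imf; rewrite ler_wpM2l//; exact: modulus_cint.
  apply: le_Rintegral => //.
  - exact: (integrableZl mD l imf).
  - exact: (integrableD mD i1 i2).
  - move=> xy _; rewrite modulusM modulus_conj mulrA.
    have := @conjugate_powR _ (l * modulus (f (of_plane xy))) (modulus (G xy)) p q.
    rewrite mulr_ge0 ?modulus_ge0// => /(_ erefl erefl p0 q0 pq).
    move=> /le_trans; apply; rewrite powRM ?modulus_ge0// [_ / q]mulrC.
    by rewrite [l `^ p * _ / p]mulrAC.
have [N00|Nn0] := eqVneq N 0.
  rewrite N00 leNgt; apply/negP => xp.
  have l0 : 0 < x^-1 * (1 + q^-1) by rewrite mulr_gt0 ?invr_gt0// addr_gt0 ?invr_gt0.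
  have := young _ l0; rewrite N00 mulr0 powR0 ?gt_eqF// mul0r add0r.
  rewrite mulrAC mulVf ?gt_eqF// mul1r; lra.
have Np : 0 < N by rewrite lt_def Nn0.
have l0 : 0 < N^-1 by rewrite invr_gt0.
have := young _ l0; rewrite mulVf// powR1 div1r pq.
by rewrite mulrC ler_pdivrMr// mul1r.
Qed.

End DensityMap.

Lemma sup_max (A : set R) (x : R) : A x -> (forall y, A y -> y <= x) -> sup A = x.
Proof.
move=> Ax ub; apply/eqP; rewrite eq_le; apply/andP; split.
  by apply: ge_sup => //; exists x.
by apply: ub_le_sup => //; exists x.
Qed.

Section Extremal.
Variables (p q : R) (F : C -> C).
Hypotheses (p1 : 1 < p) (pq : p^-1 + q^-1 = 1).
Hypotheses (bF : bergman p F) (F1 : bergman_norm p F = 1).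

Let p0 : 0 < p. Proof. exact: lt_trans ltr01 p1. Qed.
Let q1 : 1 < q. Proof. exact: conj_exponent_gt1 p1 pq. Qed.
Let q0 : 0 < q. Proof. exact: lt_trans ltr01 q1. Qed.
Let qp : q^-1 + p^-1 = 1. Proof. by rewrite addrC. Qed.

Let G (xy : P) : C := density p (F (of_plane xy)).

Let Gq : lp q G.
Proof. exact: (lp_density p1 pq (bergman_lp bF)). Qed.

Let intF1 : \int[sig]_(xy in D) modulus (F (of_plane xy)) `^ p = 1.
Proof. by rewrite -bergman_norm_powR// F1 powR1. Qed.

Let intG1 : \int[sig]_(xy in D) modulus (G xy) `^ q = 1.
Proof.
by rewrite -intF1; apply: eq_Rintegral => xy _; rewrite modulus_density_powR.
Qed.

Definition density_functional (f : C -> C) : C :=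
  cint sig D (fun xy => f (of_plane xy) * (density p (F (of_plane xy)))^*).

Lemma density_functional_self : density_functional F = 1.
Proof.
rewrite /density_functional (@eq_cint _ _ _ _ _ _ (fun xy => (modulus (F (of_plane xy)) `^ p)%:C)).
  apply: complexP; rewrite /cint /=; first exact: intF1.
  by rewrite /Rintegral integral0.
by move=> xy _; rewrite mul_conj_density.
Qed.

Lemma bergman_proj_density : bergman q (bergman_proj (extremal_density p F)).
Proof.
have [_ oo] := proj_lp p1 pq Gq.
have ig := lp_integrable q1 qp Gq.
by split; [exact: (proj_analytic ig)|exact: oo].
Qed.

Lemma functional_of_projE f : bergman p f ->
  functional_of_kernel (bergman_proj (extremal_density p F)) f = density_functional f.
Proof.
move=> bf; have [fa _] := bf.
have E : bergman_proj (extremal_density p F) = plane_proj G.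
  by apply/funext => z; exact: bergman_projE.
rewrite /functional_of_kernel E disc_integralE.
exact: (proj_adjoint p1 pq fa (bergman_lp bf) Gq).
Qed.

Lemma density_functional_le f : bergman p f ->
  modulus (density_functional f) <= bergman_norm p f.
Proof. by move=> bf; exact: (lp_holder p1 pq bf Gq intG1). Qed.

Lemma cintegrable_density f : bergman p f ->
  cintegrable sig D (fun xy => f (of_plane xy) * (density p (F (of_plane xy)))^*).
Proof.
move=> bf; have cG : lp q (fun xy => (G xy)^*).
  case: Gq => mG Goo; split; first exact: cmeasurable_conj.
  by under eq_integral do rewrite modulus_conj.
exact: (lp_mul_integrable p1 pq (bergman_lp bf) cG).
Qed.

Lemma density_functional_linear (c : C) f h : bergman p f -> bergman p h ->
  density_functional (fun z => c * f z + h z) =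
  c * density_functional f + density_functional h.
Proof.
move=> bf bh; have mD := @measurable_plane_disc R.
have i1 := cintegrable_density bf; have i2 := cintegrable_density bh.
rewrite /density_functional -(cintZ mD c i1) -(cintD mD (cintegrableZ mD c i1) i2).
by apply: eq_cint => xy _; rewrite mulrDl mulrA.
Qed.

(** The functional is at most 1 on the unit sphere, by Hölder's inequality, and
    takes the value 1 at F. *)
Lemma density_functional_extremal :
  is_extremal p (functional_of_kernel (bergman_proj (extremal_density p F))) F.
Proof.
have sF : bergman_sphere p F by [].
have E1 := functional_of_projE; have S1 := density_functional_self.
have le1 f : bergman_sphere p f ->
    modulus (functional_of_kernel (bergman_proj (extremal_density p F)) f) <= 1.
  by move=> [bf f1]; rewrite E1// -f1; exact: density_functional_le.
have supRe : sup [set complex.Re (functional_of_kernel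
     (bergman_proj (extremal_density p F)) g) | g in bergman_sphere p] = 1.
  apply: sup_max; first by exists F; rewrite ?(E1 _ bF) ?S1.
  by move=> _ [f sf <-]; rewrite (le_trans (ler_Re_modulus _))// le1.
split => //.
- split.
  + move=> c f h bf bh; have bcfh := bergman_linear c p0 bf bh.
    by rewrite (E1 _ bcfh) (E1 _ bf) (E1 _ bh) density_functional_linear.
  + by exists 1 => f bf; rewrite mul1r E1//; exact: density_functional_le.
- by exists F => //; rewrite E1// S1 oner_eq0.
- by rewrite supRe E1// S1.
- rewrite supRe; symmetry; apply: sup_max.
    by exists F => //; rewrite E1// S1 modulus1.
  by move=> _ [f sf <-]; exact: le1.
Qed.

Section VariationalArgument.
Variable phi : (C -> C) -> C.
Hypotheses (dphi : bergman_dual p phi) (nzphi : nonzero_functional p phi).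
Hypothesis exF : is_extremal p phi F.

Local Notation N := (dual_norm p phi).

Let phi_linear (c : C) f h : bergman p f -> bergman p h ->
  phi (fun z => c * f z + h z) = c * phi f + phi h.
Proof. by case: dphi => lin _; exact: lin. Qed.

Let phi0 : phi (fun=> 0) = 0.
Proof.
have b0 := @bergman0 p p0; have := phi_linear 1 b0 b0.
rewrite (_ : (fun z => _) = fun=> 0); last by apply/funext => z; rewrite mulr0 addr0.
by rewrite mul1r => /eqP; rewrite eq_sym -subr_eq0 addrK => /eqP.
Qed.

Let phi_scale (c : C) f : bergman p f -> phi (fun z => c * f z) = c * phi f.
Proof.
move=> bf; have := phi_linear c bf (@bergman0 p p0); rewrite phi0 addr0 => <-.
by congr phi; apply/funext => z; rewrite addr0.
Qed.

Let phi_le f : bergman p f -> modulus (phi f) <= N * bergman_norm p f.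
Proof.
move=> bf; have [_ [M phiM]] := dphi.
have [f0|f0] := eqVneq (bergman_norm p f) 0.
  by have := phiM _ bf; rewrite f0 !mulr0.
have fp : 0 < bergman_norm p f by rewrite lt_def f0 bergman_norm_ge0.
set n := bergman_norm p f in f0 fp *.
have ni : modulus (n%:C^-1) = n^-1 by rewrite modulusV modulus_real gtr0_norm.
have sf : bergman_sphere p (fun z => n%:C^-1 * f z).
  split; first exact: bergman_scale.
  by rewrite bergman_norm_scale// ni mulVf.
rewrite -ler_pdivrMr// mulrC -ni -modulusM -phi_scale//.
apply: ub_le_sup; last by exists (fun z => n%:C^-1 * f z).
by exists M => _ [h [bh h1] <-]; have := phiM _ bh; rewrite h1 mulr1.
Qed.

Lemma dual_norm_gt0 : 0 < N.
Proof.
have [f bf f0] := nzphi; have := phi_le bf.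
have h : 0 < modulus (phi f) by rewrite modulus_gt0.
move=> /(lt_le_trans h); rewrite pmulr_lgt0// lt_def bergman_norm_ge0 andbT.
apply/negP => /eqP n0; have [_ [M /(_ _ bf)]] := dphi.
by rewrite n0 mulr0 leNgt h.
Qed.

Let Re_phiF : complex.Re (phi F) = N.
Proof. by case: exF => _ _ _ -> ->. Qed.

(** The perturbation F + t h, along the sequence t = 1 / (n + 1) to which
    dominated convergence applies. *)
Let Ft (h : C -> C) n : C -> C := fun z => (n.+1%:R^-1)%:C * h z + F z.

Let bFt h n : bergman p h -> bergman p (Ft h n).
Proof. by move=> bh; exact: bergman_linear. Qed.

Let variation (h : C -> C) n (xy : P) : C :=
  h (of_plane xy) * (density p (Ft h n (of_plane xy)))^*.

Let variation_integrable h n : bergman p h -> cintegrable sig D (variation h n).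
Proof.
move=> bh; have /= [md doo] := lp_density p1 pq (bergman_lp (bFt n bh)).
have cd : lp q (fun xy => (density p (Ft h n (of_plane xy)))^*).
  by split; [exact: cmeasurable_conj|under eq_integral do rewrite modulus_conj].
exact: (lp_mul_integrable p1 pq (bergman_lp bh) cd).
Qed.

(** N + t Re phi(h) <= N |F + t h|, while |F + t h| <= 1 + (|F + t h|^p - 1) / p
    and the subgradient inequality bounds |F + t h|^p - |F|^p pointwise. *)
Let variation_le h n : bergman p h ->
  complex.Re (phi h) <= N * complex.Re (cint sig D (variation h n)).
Proof.
move=> bh; have mD := @measurable_plane_disc R.
set t : R := n.+1%:R^-1; have t0 : 0 < t by rewrite invr_gt0 ltr0n.
have N0 := dual_norm_gt0.
have bt := bFt n bh.
set nt := bergman_norm p (Ft h n).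
have nt0 : 0 <= nt by exact: bergman_norm_ge0.
have e1 : N + t * complex.Re (phi h) <= N * nt.
  have := phi_le bt; apply: le_trans; rewrite (le_trans _ (ler_Re_modulus _))//.
  by rewrite phi_linear// cReD Re_phiF cReM/= mul0r subr0 addrC.
have e2 : nt <= 1 + (nt `^ p - 1) / p.
  have := conjugate_powR nt0 ler01 p0 q0 pq; rewrite mulr1 powR1 div1r.
  have -> : q^-1 = 1 - p^-1 by rewrite -pq addrAC subrr add0r.
  by rewrite mulrBl div1r; lra.
have e3 : nt `^ p - 1 <= p * (t * complex.Re (cint sig D (variation h n))).
  have iF := integrable_lp_power (bergman_lp bF).
  have it := integrable_lp_power (bergman_lp bt).
  have [iv _] := variation_integrable n bh.
  have := RintegralB mD it iF => /= eB.
  have i1 := integrableZl mD t iv.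
  rewrite /nt (bergman_norm_powR _ p0) -intF1 -eB.
  have := RintegralZl t mD iv; have := RintegralZl p mD i1 => /= e4 e5.
  rewrite -e5 -e4.
  apply: le_Rintegral => //.
  - exact: (integrableB mD it iF).
  - exact: (integrableZl mD p (integrableZl mD t iv)).
  - move=> xy _; have := powR_subgradient p1 pq (F (of_plane xy)) (Ft h n (of_plane xy)).
    move=> /le_trans; apply; rewrite {1}/Ft addrK -mulrA cReM/= mul0r subr0.
    by rewrite -/t /variation.
have e4 : N * nt <= N * (1 + t * complex.Re (cint sig D (variation h n))).
  rewrite ler_wpM2l ?(ltW N0)// (le_trans e2)// lerD2l ler_pdivrMr//.
  by rewrite mulrC.
have := le_trans e1 e4; rewrite mulrDr mulr1 lerD2l mulrCA ler_pM2l//.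
Qed.

(** The limit t -> 0 of the previous inequality; by Young's inequality, |h|^p and
    (|F| + |h|)^p dominate the integrands. *)
Let Re_phi_le h : bergman p h -> complex.Re (phi h) <= N * complex.Re (density_functional h).
Proof.
move=> bh; have mD := @measurable_plane_disc R.
pose B (xy : P) : R := p^-1 * modulus (h (of_plane xy)) `^ p +
  q^-1 * modulus (1 * (modulus (F (of_plane xy)))%:C + (modulus (h (of_plane xy)))%:C) `^ p.
have lF := bergman_lp bF; have lh := bergman_lp bh.
have absl (f : C -> C) : bergman p f -> lp p ((fun z => (modulus (f z))%:C) \o @of_plane R).
  move=> bf; have [mf foo] := bergman_lp bf; split.
    by apply: cmeasurable_real; exact: measurable_modulus.
  by under eq_integral do rewrite /= modulus_real ger0_norm ?modulus_ge0//.
have iB : sig.-integrable D (EFin \o B).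
  have i1 := integrableZl mD p^-1 (integrable_lp_power lh).
  have i2 := integrableZl mD q^-1 (integrable_lp_power
    (lp_linear 1 p0 (absl _ bF) (absl _ bh))).
  exact: (integrableD mD i1 i2).
have vB n xy : D xy -> modulus (variation h n xy) <= B xy.
  move=> _; rewrite /variation modulusM modulus_conj.
  have Y := @conjugate_powR _ (modulus (h (of_plane xy))) (modulus (density p (Ft h n (of_plane xy)))) p q
    (modulus_ge0 _) (modulus_ge0 _) p0 q0 pq.
  rewrite (le_trans Y)// modulus_density_powR// /B [_ / p]mulrC [_ / q]mulrC lerD2l.
  rewrite ler_wpM2l ?invr_ge0 ?(ltW q0)// ge0_ler_powR ?nnegrE ?modulus_ge0 ?(ltW p0)//.
  rewrite mul1r -rmorphD/= modulus_real ger0_norm ?addr_ge0 ?modulus_ge0//.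
  rewrite /Ft (le_trans (ler_modulusD _ _))// addrC lerD2l modulusM modulus_real.
  rewrite ger0_norm ?invr_ge0// ler_piMl ?modulus_ge0// invf_le1 ?ler1n ?ltr0n//.
have vl xy : D xy -> modulus (variation h n xy -
    h (of_plane xy) * (density p (F (of_plane xy)))^*) @[n --> \oo] --> (0 : R).
  move=> _; rewrite /variation.
  have Fl : modulus (Ft h n (of_plane xy) - F (of_plane xy)) @[n --> \oo] --> (0 : R).
    rewrite -(mul0r (modulus (h (of_plane xy)))).
    under eq_fun do rewrite /Ft addrK modulusM modulus_real ger0_norm ?invr_ge0//.
    by apply: cvgM; [exact: cvg_harmonic|exact: cvg_cst].
  have := density_continuous p1 Fl => dl.
  rewrite -(mulr0 (modulus (h (of_plane xy)))).
  under eq_fun do rewrite -mulrBr modulusM -conjC_N -conjC_D modulus_conj.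
  by apply: cvgM => //; exact: cvg_cst.
have mv n : cmeasurable D (variation h n).
  exact: cintegrable_measurable (variation_integrable n bh).
have cRe : complex.Re (cint sig D (variation h n)) @[n --> \oo] -->
    complex.Re (density_functional h).
  by have [] := cint_dominated mD mv iB vB vl.
have cN : N * complex.Re (cint sig D (variation h n)) @[n --> \oo] -->
    N * complex.Re (density_functional h).
  by apply: cvgM; [exact: cvg_cst|exact: cRe].
rewrite -(cvg_lim (@Rhausdorff R) cN); apply: limr_ge.
  by apply/cvg_ex; eexists; exact: cN.
by apply: nearW => n; exact: variation_le.
Qed.

Theorem extremal_functionalE h : bergman p h -> phi h = N%:C * density_functional h.
Proof.
move=> bh; pose L h := phi h - N%:C * density_functional h.
suff : L h = 0 by move=> /eqP; rewrite subr_eq0 => /eqP.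
(* a complex-linear form with nonpositive real part vanishes: evaluate it at
   conj(L h) h *)
have bc : bergman p (fun z => (L h)^* * h z) by exact: bergman_scale.
have Lc : L (fun z => (L h)^* * h z) = (L h)^* * L h.
  have b0 := @bergman0 p p0.
  have d0 : density_functional (fun=> 0) = 0.
    have := density_functional_linear 1 b0 b0.
    rewrite (_ : (fun z => _) = fun=> 0); last by apply/funext => z; rewrite mulr0 addr0.
    by rewrite mul1r => /eqP; rewrite eq_sym -subr_eq0 addrK => /eqP.
  rewrite {1}/L phi_scale//.
  have -> : density_functional (fun z => (L h)^* * h z) = (L h)^* * density_functional h.
    rewrite -[RHS]addr0 -d0 -density_functional_linear//.
    by congr density_functional; apply/funext => z; rewrite addr0.
  by rewrite /L mulrBr; congr (_ - _); rewrite mulrCA.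
have := Re_phi_le bc; have := congr1 (@complex.Re R) Lc.
rewrite [X in _ = X -> _](_ : _ = modulus (L h) ^+ 2); last by rewrite mulrC mul_conjC.
rewrite {1}/L cReD cReN [in X in - X]cReM /= mul0r subr0 => e1 e2.
apply/eqP; rewrite -modulus_eq0 -sqrf_eq0 eq_le sqr_ge0 andbT -e1 subr_le0.
exact: e2.
Qed.

End VariationalArgument.

(** Both functionals are evaluated at the Bergman kernel of z: the one with kernel
    k gives conj(k(z)) by the reproducing formula, and the pairing with the
    density gives the conjugate of its projection at z. *)
Lemma extremal_kernelE (phi : (C -> C) -> C) (k : C -> C) z :
  bergman_dual p phi -> nonzero_functional p phi -> is_kernel p q phi k ->
  is_extremal p phi F -> disc z ->
  bergman_proj (extremal_density p F) z = k z / (dual_norm p phi)%:C.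
Proof.
move=> dphi nz [bk kE] ex zD; have mD := @measurable_plane_disc R.
have bz := bergman_kernel p0 zD.
have ik := lp_integrable q1 qp (bergman_lp bk).
have ig := lp_integrable q1 qp Gq.
have e1 : phi (fun w => bkernel w z) = (k z)^*.
  rewrite kE// -(reproducing (proj1 bk) zD ik).
  rewrite -(cint_conj mD (cintegrable_mul_kernel zD ik)) /functional_of_kernel disc_integralE.
  by apply: eq_cint => xy _; rewrite conjC_M kernel_conj mulrC.
have e2 : density_functional (fun w => bkernel w z) =
    (bergman_proj (extremal_density p F) z)^*.
  rewrite bergman_projE -(cint_conj mD (cintegrable_mul_kernel zD ig)).
  by apply: eq_cint => xy _; rewrite conjC_M kernel_conj mulrC.
have := extremal_functionalE dphi nz ex bz; rewrite e1 e2 => e3.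
have N0 : (dual_norm p phi)%:C != 0.
  by rewrite -modulus_gt0 modulus_real gtr0_norm; exact: dual_norm_gt0.
apply: (mulIf N0); rewrite divfK//.
by rewrite -[RHS]conjC_K e3 conjC_M conjC_real conjC_K mulrC.
Qed.

End Extremal.
End Duality.

Theorem theorem2p2 (R : realType) (p q : R) (F : R[i] -> R[i])
    (hp : 1 < p) (hpq : p^-1 + q^-1 = 1)
    (hF : bergman p F) (hF1 : bergman_norm p F = 1) :
  (bergman q (bergman_proj (extremal_density p F)) /\
   is_extremal p
     (functional_of_kernel (bergman_proj (extremal_density p F))) F) /\
  (forall (phi : (R[i] -> R[i]) -> R[i]) (k : R[i] -> R[i]),
     bergman_dual p phi -> nonzero_functional p phi ->
     is_kernel p q phi k -> is_extremal p phi F ->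
     forall z, disc z ->
       bergman_proj (extremal_density p F) z = k z / (dual_norm p phi)%:C).
Proof.
split; first split.
- exact: (bergman_proj_density hp hpq hF).
- exact: density_functional_extremal hp hpq hF hF1.
- by move=> phi k dphi nz kphi ex z zD; exact: (extremal_kernelE hp hpq hF hF1 dphi nz kphi ex zD).
Qed.
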